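(* Let $P=\frac12\delta_{-1}+\frac12\delta_{+1}$. For all $0\le\lambda<1$, $$\lim_{N\to\infty}\mathsf{err}^*(\lambda)=1-\lim_{N\to\infty}D_{\mathsf{TV}}(\mathbb P_\lambda,\mathbb P_0)=\mathsf{erfc}\Big(\frac{\sqrt{\mu(\lambda)}}{2}\Big),\qquad \mu(\lambda)=\frac14\big(-\log(1-\lambda)-\lambda\big).$$
   Context: Model. For $\lambda\ge 0$ and $N\ge1$, let $x^*_1,\dots,x^*_N$ be i.i.d. from $P$, let $W_{ij}$ ($1\le i<j\le N$) be i.i.d. $\mathcal N(0,1)$ independent of the $x_i^*$, and $Y_{ij}=\sqrt{\lambda/N}\,x_i^*x_j^*+W_{ij}$ for $1\le i<j\le N$. $\mathbb{P}_\lambda$ is the law of $\boldsymbol Y=(Y_{ij})_{i<j}$ on $\mathbb R^{N(N-1)/2}$ and $L(\boldsymbol Y;\lambda)=\frac{d\mathbb P_\lambda}{d\mathbb P_0}(\boldsymbol Y)$. The minimal risk for testing $\mathbb P_0$ against $\mathbb P_\lambda$ is $$\mathsf{err}^*(\lambda)=\min_T\big\{\mathbb P_\lambda(T(\boldsymbol Y)=0)+\mathbb P_0(T(\boldsymbol Y)=1)\big\}=\mathbb P_\lambda(L(\boldsymbol Y;\lambda)\le1)+\mathbb P_0(L(\boldsymbol Y;\lambda)>1),$$ the minimum being over measurable $T:\mathbb R^{N(N-1)/2}\to\{0,1\}$. $D_{\mathsf{TV}}(\mathbb P,\mathbb Q)=\sup_A|\mathbb P(A)-\mathbb Q(A)|$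 is the total variation distance, and $\mathsf{erfc}(x)=\frac{2}{\sqrt\pi}\int_x^\infty e^{-t^2}dt$. *)

(* Defs.v *)
From HB Require Import structures.
From mathcomp Require Import all_boot all_order all_algebra.
From mathcomp Require Import all_classical all_reals all_analysis.
From mathcomp Require Import measurable_realfun.

Set Implicit Arguments.
Unset Strict Implicit.
Unset Printing Implicit Defensive.

Import Order.TTheory GRing.Theory Num.Theory.
Import numFieldNormedType.Exports.

Local Open Scope classical_set_scope.
Local Open Scope ring_scope.

Definition erfc (R : realType) (x : R) : R :=
  2 / Num.sqrt pi * \int[@lebesgue_measure R]_(t in `[x, +oo[) expR (- t ^+ 2).

Definition rademacher (R : realType) (A : set R) : \bar R :=
  ((2^-1)%:E * \d_(-1 : R)%R A + (2^-1)%:E * \d_(1 : R)%R A)%E.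

Definition mutually_independent (R : realType) (d : measure_display)
    (Omega : measurableType d) (Pr : probability Omega R) (I : finType)
    (X : I -> {RV Pr >-> R}) : Prop :=
  forall (J : {set I}) (A : I -> set R), (forall i, measurable (A i)) ->
    Pr (\bigcap_(i in [set` J]) X i @^-1` A i) =
    (\prod_(i in J) Pr (X i @^-1` A i))%E.

Definition upper_pair (N : nat) := {p : 'I_N * 'I_N | (p.1 < p.2)%N}.

Lemma card_upper_pair (N : nat) : #|{: upper_pair N}| = 'C(N, 2).
Proof.
rewrite card_sig -sum1_card -(pair_big_dep xpredT (fun i j : 'I_N => i < j)%N
  (fun _ _ => 1%N)) /= (exchange_big_dep xpredT) //= -bin2_sum big_mkord.
apply: eq_bigr => j _; rewrite sum1_card -[RHS]card_ord.
have winj : injective (widen_ord (ltnW (ltn_ord j))).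
  by move=> k l /(congr1 val) /= kl; exact: val_inj.
rewrite -(card_imset _ winj); apply: eq_card => i.
apply/idP/imsetP => [ij|[k _ ->]]; last exact (ltn_ord k).
by exists (Ordinal ij) => //; exact: val_inj.
Qed.

Section Model.
Context (R : realType) (d : measure_display) (Omega : measurableType d).
Context (Pr : probability Omega R) (N : nat).

Definition spike_noise (x : 'I_N -> {RV Pr >-> R})
    (W : upper_pair N -> {RV Pr >-> R}) (s : 'I_N + upper_pair N) :
    {RV Pr >-> R} :=
  match s with inl i => x i | inr p => W p end.

(* Mutual independence of the joined family says at once that the x_i are
   independent, that the W_ij are independent, and that the two families are
   independent of each other. *)
Definition spiked_wigner_model (x : 'I_N -> {RV Pr >-> R})
    (W : upper_pair N -> {RV Pr >-> R}) : Prop :=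
  [/\ mutually_independent (spike_noise x W),
      forall i (A : set R), measurable A ->
        distribution Pr (x i) A = rademacher A &
      forall p (A : set R), measurable A ->
        distribution Pr (W p) A = normal_prob 0 1 A].

(* Y_ij = sqrt(lambda / N) x_i x_j + W_ij; the coordinates of
   R^(N(N-1)/2) are the pairs i < j in the order of their enumeration. *)
Definition observation (lambda : R) (x : 'I_N -> {RV Pr >-> R})
    (W : upper_pair N -> {RV Pr >-> R}) (w : Omega) :
    #|{: upper_pair N}|.-tuple R :=
  [tuple (let p := enum_val k in
          Num.sqrt (lambda / N%:R) * x (val p).1 w * x (val p).2 w + W p w)
   | k < #|{: upper_pair N}|].

Lemma measurable_observation lambda x W :
  measurable_fun setT (observation lambda x W).
Proof.
apply/measurable_fun_tnthP => k.
rewrite (_ : _ \o _ = fun w => let p := enum_val k in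
   Num.sqrt (lambda / N%:R) * x (val p).1 w * x (val p).2 w + W p w); last first.
  by apply/funext => w /=; rewrite tnth_mktuple.
by apply: measurable_funD => //; apply: measurable_funM => //;
  apply: measurable_funM.
Qed.

HB.instance Definition _ lambda x W :=
  isMeasurableFun.Build _ _ _ _ (observation lambda x W)
    (measurable_observation lambda x W).

Definition observation_law (lambda : R) (x : 'I_N -> {RV Pr >-> R})
    (W : upper_pair N -> {RV Pr >-> R}) :
    probability (#|{: upper_pair N}|.-tuple R) R :=
  distribution Pr (observation lambda x W).

End Model.

Section Testing.
Context (R : realType) (d : measure_display) (T : measurableType d).
Local Open Scope ereal_scope.

Definition testing_risk (P0 P1 : probability T R) (t : {mfun T >-> bool}) :=
  P1 (t @^-1` [set false]) + P0 (t @^-1` [set true]).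

(* The infimum is a minimum: see minimal_risk_attained. *)
Definition minimal_risk (P0 P1 : probability T R) : \bar R :=
  ereal_inf [set testing_risk P0 P1 t | t in [set: {mfun T >-> bool}]].

Definition tv_distance (P Q : probability T R) : \bar R :=
  ereal_sup [set `|P A - Q A| | A in measurable].

Lemma minimal_risk_attained (P0 P1 : probability T R) :
  exists t : {mfun T >-> bool}, minimal_risk P0 P1 = testing_risk P0 P1 t.
Proof.
pose nu : {charge set T -> \bar R} :=
  cadd (charge_of_finite_measure P1) (copp (charge_of_finite_measure P0)).
have nuE A : nu A = P1 A - P0 A by [].
have [P [N [[mP posP] [mN negN] PN0 PNT]]] := Hahn_decomposition nu.
have riskE (t : {mfun T >-> bool}) :
    testing_risk P0 P1 t = 1 - nu (t @^-1` [set true]).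
  have mt : measurable (t @^-1` [set true]).
    by rewrite -[X in measurable X]setTI; exact: measurable_funP.
  have -> : testing_risk P0 P1 t =
      P1 (~` (t @^-1` [set true])) + P0 (t @^-1` [set true]).
    rewrite /testing_risk; congr (P1 _ + _).
    by apply/seteqP; split => y /=; case: (t y).
  rewrite probability_setC// nuE fin_num_oppeB ?fin_num_measure//.
  by rewrite addeA.
have mtP : measurable_fun setT (fun y => `[< P y >]).
  apply: (@measurable_fun_bool _ _ _ _ true).
  by rewrite setTI (_ : _ @^-1` _ = P)//; apply/seteqP; split => y /asboolP.
pose tP : {mfun T >-> bool} :=
  HB.pack (fun y => `[< P y >]) (isMeasurableFun.Build _ _ _ _ _ mtP).
exists tP; apply/eqP; rewrite eq_le; apply/andP; split.
  by apply: ereal_inf_lbound; exists tP.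
apply: le_ereal_inf_tmp => _ [t _ <-].
rewrite !riskE leeD2l// leeN2.
have mt : measurable (t @^-1` [set true]).
  by rewrite -[X in measurable X]setTI; exact: measurable_funP.
have -> : tP @^-1` [set true] = P.
  by apply/seteqP; split => y /asboolP.
move: (t @^-1` _) mt => A mA.
rewrite (charge_partition nu mA mP mN)// (chargeDI nu mP mA) addeC [P `&` A]setIC.
rewrite leeD2r//; apply: (@le_trans _ _ 0).
  by apply: negN; [exact: measurableI|exact: subIsetr].
by apply: posP; [exact: measurableD|exact: subDsetl].
Qed.

End Testing.

(* Main.v *)
(* With L the likelihood ratio, err*(lambda) = E_0 min(1, L) and D_TV is its
   complement to 1, so one needs the limit of E_0 min(1, L).  In place of the
   asymptotic normality of log L, the argument interpolates the signal strength.
   Write L_u = 2^-N sum_x exp(u <t_x, w> - u^2 |t_x|^2 / 2), where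
   t_x = (x_i x_j / sqrt N)_{i < j}, for the likelihood ratio at
   lambda = u^2, and let F(t, l) = E min(1, l exp(sqrt 2 t Z - t^2)), Z
   standard normal.  With tau(u)^2 = mu(lambda) - mu(u^2) + eta, Gaussian integration by
   parts (a consequence of the Cameron-Martin formula) gives
     d/du E F(tau(u), L_u) = u/2 E F_ll(tau, L_u) (B_u - L_u^2 / (1 - u^2)),
   where B_u is the two-replica average of N (overlap)^2.  A cavity argument
   over the N vertices shows that this is O(N^(-1/2)) uniformly in u, hence
   E F(sqrt eta, L) = F(sqrt (mu(lambda) + eta), 1) + O(N^(-1/2)), and
   F(t, 1) = erfc(t / 2).  Finally F(t, l) -> min(1, l) as t -> 0. *)
Require Import Defs.
From HB Require Import structures.
From mathcomp Require Import all_boot all_order all_algebra.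
From mathcomp Require Import all_classical all_reals all_analysis.
From mathcomp Require Import measurable_realfun.
From mathcomp Require Import ring lra.

Set Implicit Arguments.
Unset Strict Implicit.
Unset Printing Implicit Defensive.

Import Order.TTheory GRing.Theory Num.Theory.
Import numFieldNormedType.Exports.

Local Open Scope classical_set_scope.
Local Open Scope ring_scope.

(** The function mu is the one for which the flow closes. The Black-Scholes function solves F_t = 2
    t l^2 F_ll, and sqrt N times the overlap of two replicas at strength u is nearly Gaussian with
    variance 1 / (1 - u^2), so B_u should be close to L_u^2 / (1 - u^2). Integration by parts only
    yields B_u - L_u^2; the decrease of tau^2 supplies the missing multiple of L_u^2, which forces
    d/du mu(u^2) = (u / 2) (1 / (1 - u^2) - 1). The positive eta keeps tau away from 0, where F_ll
    is unbounded. The obstacle is that only second moments of L_u stay bounded for every lambda < 1: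
    quadruples of equal replicas already make E L^4 grow exponentially once lambda > log 2. The
    square of the cavity fluctuation, a four-replica quantity, is therefore estimated after division
    by the squared likelihood ratio without the vertex, so that two of the four replicas average
    out. This division is why F_ll has to be Lipschitz in the relative increment of l. *)

(** * Densities, shifts and the Cameron-Martin formula *)

Section density.
Context {R : realType} d (T : measurableType d).
Variable mu : {sigma_finite_measure set T -> \bar R}.

(** By uniqueness [g] agrees almost everywhere with the Radon-Nikodym derivative, for which the
    change of variables holds. [nu] is kept abstract so that the rule applies to the normal law, to
    a restricted measure and to the law of a shifted vector. *)
Lemma ge0_integral_density (nu : {finite_measure set T -> \bar R}) (g : T -> R) :
  measurable_fun setT g -> (forall x, 0 <= g x) ->
  (forall A, measurable A -> nu A = (\int[mu]_(x in A) (g x)%:E)%E) ->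
  forall (E : set T) (f : T -> \bar R), measurable E -> measurable_fun E f ->
  (forall x, 0 <= f x)%E ->
  (\int[nu]_(x in E) f x = \int[mu]_(x in E) (f x * (g x)%:E))%E.
Proof.
move=> mg g0 nuE E f mE mf f0.
have mgE : measurable_fun setT (EFin \o g) by exact/measurable_EFinP.
have ig : mu.-integrable setT (EFin \o g).
  apply/integrableP; split => //.
  under eq_integral do rewrite gee0_abs ?lee_fin ?g0//.
  by rewrite -nuE// ltey_eq fin_num_measure.
have numu : nu `<< mu.
  apply/null_content_dominatesP => A mA muA; rewrite nuE//.
  by apply: null_set_integral => //; exact: measurable_funTS.
rewrite -(@Radon_Nikodym_SigmaFinite.change_of_variables _ _ _ nu mu numu f E)//.
apply: ae_eq_integral => //.
- apply: emeasurable_funM => //; apply: measurable_funTS.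
  exact: (measurable_int _ (Radon_Nikodym_SigmaFinite.f_integrable numu)).
- by apply: emeasurable_funM => //; exact: measurable_funTS.
- apply: ae_eqe_mul2l; apply: integral_ae_eq => //=.
  + exact: integrableS (Radon_Nikodym_SigmaFinite.f_integrable numu).
  + exact: measurable_funTS.
  + by move=> A EA mA; rewrite -Radon_Nikodym_SigmaFinite.f_integral// nuE.
Qed.

End density.

(** The proofs [mg] and [g0] are arguments of the definition so that a measure structure can be
    attached to it. *)
Definition density_measure {R : realType} d (T : measurableType d)
    (mu : {measure set T -> \bar R}) (g : T -> R)
    (mg : measurable_fun setT g) (g0 : forall x, 0 <= g x) (A : set T) : \bar R :=
  (\int[mu]_(x in A) (g x)%:E)%E.

Section density_measure.
Context {R : realType} d (T : measurableType d).
Variables (mu : {measure set T -> \bar R}) (g : T -> R).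
Variables (mg : measurable_fun setT g) (g0 : forall x, 0 <= g x).

Let density0 : density_measure mu mg g0 set0 = 0%E.
Proof. by rewrite /density_measure integral_set0. Qed.

Let density_ge0 A : (0 <= density_measure mu mg g0 A)%E.
Proof. by apply: integral_ge0 => x _; rewrite lee_fin. Qed.

Let density_sigma_additive : semi_sigma_additive (density_measure mu mg g0).
Proof.
move=> F mF tF mUF; rewrite /density_measure ge0_integral_bigcup//=.
- apply: is_cvg_ereal_nneg_natsum_cond => n _ _.
  by apply: integral_ge0 => x _; rewrite lee_fin.
- by apply/measurable_EFinP; exact: measurable_funTS.
- by move=> x _; rewrite lee_fin.
Qed.

HB.instance Definition _ := isMeasure.Build _ _ _ (density_measure mu mg g0)
  density0 density_ge0 density_sigma_additive.

End density_measure.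

Section normal_shift.
Context {R : realType}.
Local Notation mu := (@lebesgue_measure R).

Lemma lebesgue_measure_shift (t : R) (A : set R) : measurable A ->
  mu ((fun x => x + t) @^-1` A) = mu A.
Proof.
move=> mA.
have mf : measurable_fun setT (fun x : measurableTypeR R => x + t : measurableTypeR R).
  by apply: measurable_funD.
pose mf' := isMeasurableFun.Build _ _ _ _ _ mf.
pose F : {mfun measurableTypeR R >-> measurableTypeR R} := HB.pack (fun x : measurableTypeR R
  => x + t : measurableTypeR R) mf'.
rewrite [RHS](@lebesgue_measure_unique R (pushforward mu F))//.
move=> X [[a b]] /= _ <-.
rewrite /pushforward /=.
rewrite (_ : _ @^-1` _ = `](a - t), (b - t)]%classic); last first.
  by apply/seteqP; split => x /=; rewrite !in_itv/= ltrBlDr lerBrDr.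
rewrite !lebesgue_measure_itv/= !lte_fin ltrD2r.
by case: ifP => // _; rewrite -!EFinB; congr EFin; ring.
Qed.

Lemma integral_normal_prob (A : set R) (f : R -> \bar R) :
  measurable A -> measurable_fun A f -> (forall x, 0 <= f x)%E ->
  (\int[normal_prob 0 1]_(x in A) f x =
   \int[mu]_(x in A) (f x * (normal_pdf 0 1 x)%:E))%E.
Proof.
move=> mA mf f0; apply: (@ge0_integral_density _ _ _ mu (normal_prob 0 1)) => //.
  exact: measurable_normal_pdf.
by move=> x; exact: normal_pdf_ge0.
Qed.

(** The one-dimensional Cameron-Martin formula: completing the square, the density at x - t is the
    density at x times exp(t x - t^2 / 2). *)
Lemma normal_prob_shift (t : R) (A : set R) : measurable A ->
  normal_prob 0 1 ((fun x => x + t) @^-1` A) =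
  (\int[normal_prob 0 1]_(x in A) (expR (t * x - t ^+ 2 / 2))%:E)%E.
Proof.
move=> mA.
have mf : measurable_fun setT (fun x : measurableTypeR R => x + t : measurableTypeR R).
  by apply: measurable_funD.
pose mf' := isMeasurableFun.Build _ _ _ _ _ mf.
pose F : {mfun measurableTypeR R >-> measurableTypeR R} := HB.pack (fun x : measurableTypeR R
  => x + t : measurableTypeR R) mf'.
rewrite integral_normal_prob//; last first.
  apply/measurable_funTS/measurableT_comp => //; apply/measurableT_comp => //.
  by apply: measurable_funB => //; exact: measurable_funM.
transitivity (\int[pushforward mu F]_(x in A) (normal_pdf 0 1 (x - t))%:E)%E.
  rewrite ge0_integral_pushforward//=.
  - rewrite /normal_prob; apply: eq_integral => x _.
    by rewrite /= addrK.
  - apply/measurable_funTS/measurableT_comp => //.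
    apply: (measurableT_comp (measurable_normal_pdf 0 1)).
    by apply: measurable_funB.
  - by move=> x _; rewrite lee_fin normal_pdf_ge0.
rewrite (eq_measure_integral mu); last first.
  by move=> B mB _; exact: lebesgue_measure_shift.
apply: eq_integral => x _; rewrite -EFinM; congr EFin.
rewrite !normal_pdfE ?oner_eq0// mulrCA /normal_fun -expRD; congr (_ * expR _).
by field.
Qed.

End normal_shift.

Section tuple_measure.
Context {R : realType} (n : nat).

Definition rect (A : 'I_n -> set R) : set (n.-tuple R) :=
  [set w | forall k, A k (tnth w k)].

Lemma rectE (A : 'I_n -> set R) :
  rect A = \bigcap_(k in [set: 'I_n]) ((fun w : n.-tuple R => tnth w k) @^-1` A k).
Proof. by apply/seteqP; split => w h k //=; exact: h. Qed.

Lemma measurable_rect (A : 'I_n -> set R) : (forall k, measurable (A k)) ->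
  measurable (rect A).
Proof.
move=> mA; rewrite rectE; apply: fin_bigcap_measurable => // k _.
by rewrite -[X in measurable X]setTI; apply: measurable_tnth.
Qed.

(** Rectangles are stable under intersection and generate the product sigma-algebra. *)
Lemma tuple_measure_unique (m1 m2 : {measure set (n.-tuple R) -> \bar R}) :
  (m1 setT < +oo)%E ->
  (forall A, (forall k, measurable (A k)) -> m1 (rect A) = m2 (rect A)) ->
  forall B, measurable B -> m1 B = m2 B.
Proof.
move=> m1oo m12 B mB.
pose G : set (set (n.-tuple R)) := [set rect A | A in [set A | forall k, measurable (A k)]].
have GT : G setT.
  by exists (fun=> setT) => //; apply/seteqP; split.
apply: (measure_unique G (fun=> setT)) => //.
- apply/seteqP; split.
  + apply: smallest_sub; first exact: smallest_sigma_algebra.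
    elim/big_ind : _ => [//|X Y hX hY Z [/hX//|/hY//]|i _ X [C mC <-]].
    rewrite setTI; apply: sub_sigma_algebra.
    exists (fun k => if k == i then C else setT) => /=.
      by move=> k; case: ifP.
    apply/seteqP; split => w /=.
      by move=> /(_ i); rewrite eqxx.
    by move=> Cw k; case: eqP => [->|].
  + apply: smallest_sub; first exact: sigma_algebra_measurable.
    by move=> X [A mA <-]; exact: measurable_rect.
- move=> X Y [A mA <-] [C mC <-].
  exists (fun k => A k `&` C k) => /=.
    by move=> k; exact: measurableI.
  apply/seteqP; split => w /=.
    by move=> h; split => k; have [] := h k.
  by move=> [h1 h2] k; split.
- by rewrite bigcup_const//; exists 0%N.
- by move=> A [C mC <-]; exact: m12.
Qed.

End tuple_measure.

Definition tshift {R : realType} n (theta : 'I_n -> R) (w : n.-tuple R) :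
  n.-tuple R := [tuple tnth w k + theta k | k < n].

(** The Wick exponential: the density of the standard Gaussian law shifted by [theta] with respect
    to the unshifted one. *)
Definition wick {R : realType} n (theta : 'I_n -> R) (w : n.-tuple R) : R :=
  expR (\sum_k theta k * tnth w k - (\sum_k theta k ^+ 2) / 2).

(** Prescribing the rectangles determines [gam], by [tuple_measure_unique], and it is the form in
    which the independence of the model arrives. *)
Definition iid_normal {R : realType} n (gam : probability (n.-tuple R) R) :=
  forall A : 'I_n -> set R, (forall k, measurable (A k)) ->
  (gam (rect A) = \prod_k normal_prob 0 1 (A k))%E.

Section cameron_martin.
Context {R : realType} (n : nat) (gam : probability (n.-tuple R) R).

Lemma measurable_tshift (theta : 'I_n -> R) : measurable_fun setT (tshift theta).
Proof.
apply/measurable_fun_tnthP => k.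
rewrite (_ : _ \o _ = fun w => tnth w k + theta k); last first.
  by apply/funext => w /=; rewrite tnth_mktuple.
by apply: measurable_funD => //; exact: measurable_tnth.
Qed.

Lemma measurable_lin (theta : 'I_n -> R) :
  measurable_fun setT (fun w : n.-tuple R => \sum_k theta k * tnth w k).
Proof.
by apply: measurable_sum => k; apply: measurable_funM => //; exact: measurable_tnth.
Qed.

Lemma measurable_wick (theta : 'I_n -> R) : measurable_fun setT (wick theta).
Proof.
apply: measurableT_comp => //; apply: measurable_funB => //.
exact: measurable_lin.
Qed.

Lemma wick_gt0 (theta : 'I_n -> R) w : 0 < wick theta w.
Proof. exact: expR_gt0. Qed.

Hypothesis gamE : iid_normal gam.

(** Both sides are measures in [A], so rectangles suffice; there coordinate [i] separates from the
    others and the one-dimensional formula applies. *)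
Lemma cameron_martin_set1 (i : 'I_n) (t : R) (A : set (n.-tuple R)) :
  measurable A ->
  gam (tshift (fun k => if k == i then t else 0) @^-1` A) =
  (\int[gam]_(w in A) (expR (t * tnth w i - t ^+ 2 / 2))%:E)%E.
Proof.
pose s := tshift (fun k => if k == i then t else 0) : n.-tuple R -> n.-tuple R.
have ms : measurable_fun setT s by exact: measurable_tshift.
pose g (w : n.-tuple R) := expR (t * tnth w i - t ^+ 2 / 2).
pose g1 (x : R) := expR (t * x - t ^+ 2 / 2).
have mg1 : measurable_fun setT g1.
  apply: measurableT_comp => //.
  by apply: measurable_funB => //; exact: measurable_funM.
have mg : measurable_fun setT g.
  by apply: (measurableT_comp mg1); exact: measurable_tnth.
have g0 w : 0 <= g w by exact: expR_ge0.
pose S : {mfun n.-tuple R >-> n.-tuple R} :=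
  HB.pack s (isMeasurableFun.Build _ _ _ _ s ms).
move: A; apply: (@tuple_measure_unique _ _ (pushforward gam S) (density_measure gam mg g0)).
  by rewrite [X in (X < _)%E](_ : _ = 1%E) ?ltry//; exact: probability_setT.
move=> A mA.
pose upd C k := if k == i then C else A k.
have mupd C : measurable C -> forall k, measurable (upd C k).
  by move=> mC k; rewrite /upd; case: ifP.
pose c := (\prod_(k | k != i) normal_prob 0 1 (A k))%E.
have gam_upd C : measurable C -> gam (rect (upd C)) = (normal_prob 0 1 C * c)%E.
  move=> mC; rewrite gamE; last exact: mupd.
  rewrite (bigD1 i)//= /upd eqxx; congr (_ * _)%E.
  by apply: eq_bigr => k /negbTE ->.
have c0 : (0 <= c)%E by apply: prode_ge0 => k _; exact: measure_ge0.
have cfin : c \is a fin_num.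
  by apply: prode_fin_num => k _; apply: fin_num_measure; exact: mA.
transitivity (normal_prob 0 1 ((fun x : R => x + t)%R @^-1` A i) * c)%E.
  rewrite -gam_upd; last first.
    by rewrite -[X in measurable X]setTI; apply: measurable_funD.
  rewrite /pushforward; congr (gam _); apply/seteqP; split => w /= h k.
    by have := h k; rewrite /upd tnth_mktuple; case: eqP => [->//|_]; rewrite addr0.
  by have := h k; rewrite /upd tnth_mktuple; case: eqP => [->//|_]; rewrite addr0.
rewrite normal_prob_shift// muleC.
(* [D] is the rectangle with coordinate [i] left free. Restricted to [D] and pushed to coordinate
   [i], [gam] becomes [c] times the standard normal law, which turns the integral over the rectangle
   into a one-dimensional one. *)
pose D := rect (upd setT).
have mD : measurable D by apply: measurable_rect => k; exact: mupd.
have rectA : rect A = D `&` (fun w : n.-tuple R => tnth w i) @^-1` A i.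
  apply/seteqP; split => [w h|w [h1 h2] k].
    split; last exact: h.
    by move=> k; rewrite /upd; case: eqP => // _; exact: h.
  by have := h1 k; rewrite /upd; case: eqP => [->//|].
have mti : measurable_fun setT (fun w : n.-tuple R => tnth w i) by exact: measurable_tnth.
have mpre : measurable ((fun w : n.-tuple R => tnth w i) @^-1` A i).
  by rewrite -[X in measurable X]setTI; exact: mti.
pose E := (fun w : n.-tuple R => tnth w i) @^-1` A i.
have gDoo : (gam D < +oo)%E by rewrite (le_lt_trans (probability_le1 gam mD))// ltry.
transitivity (\int[mfrestr mD gDoo]_(w in E) (g w)%:E)%E; last first.
  rewrite (@ge0_integral_density _ _ _ gam (mfrestr mD gDoo) (\1_D))//=.
  - rewrite /density_measure rectA setIC integral_mkcondr.
    apply: eq_integral => w _; rewrite patchE indicE.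
    by case: ifPn => _; rewrite ?mule1 ?mule0.
  - by move=> B mB; rewrite integral_indic//= /mfrestr /mrestr setIC.
  - by apply/measurable_funTS/measurable_EFinP.
pose k := NngNum (fine_ge0 c0).
have mti' : measurable_fun setT
  (fun w : n.-tuple R => tnth w i : measurableTypeR R) by exact: mti.
pose mixT := isMeasurableFun.Build _ _ _ _ _ mti'.
pose T : {mfun n.-tuple R >-> measurableTypeR R} :=
  HB.pack (fun w : n.-tuple R => tnth w i : measurableTypeR R) mixT.
transitivity (\int[pushforward (mfrestr mD gDoo) T]_(x in A i) (g1 x)%:E)%E; last first.
  rewrite ge0_integral_pushforward//=.
  - exact: mA.
  - by apply: (@measurable_funTS _ _ _ _ (A i)); exact/measurable_EFinP.
  - by move=> x _; rewrite lee_fin expR_ge0.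
transitivity (\int[mscale k (normal_prob 0 1)]_(x in A i) (g1 x)%:E)%E.
  rewrite ge0_integral_mscale//=; first by rewrite fineK.
  - exact: mA.
  - by apply: (@measurable_funTS _ _ _ _ (A i)); exact/measurable_EFinP.
  - by move=> x _; rewrite lee_fin expR_ge0.
apply: eq_measure_integral => B mB BA.
rewrite /pushforward /mfrestr /mrestr/= /mscale/= fineK//.
rewrite muleC -gam_upd//; congr (gam _); apply/seteqP; split.
  move=> w h; split.
    by have := h i; rewrite /upd eqxx.
  by move=> j; have := h j; rewrite /upd; case: eqP.
move=> w [h1 h2] j; rewrite /upd; case: eqP => [->//|/eqP ji].
by have := h2 j; rewrite /upd (negbTE ji).
Qed.

Let cameron_martin_at (theta : 'I_n -> R) := forall f : n.-tuple R -> \bar R,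
  measurable_fun setT f -> (forall w, 0 <= f w)%E ->
  (\int[gam]_w f (tshift theta w) = \int[gam]_w (f w * (wick theta w)%:E))%E.

Let cameron_martin1 (i : 'I_n) (t : R) :
  cameron_martin_at (fun k => if k == i then t else 0).
Proof.
pose theta k := if k == i then t else 0; rewrite -/theta => f mf f0.
pose S : {RV gam >-> n.-tuple R} :=
  HB.pack (tshift theta) (isMeasurableFun.Build _ _ _ _ _ (measurable_tshift theta)).
have -> : (\int[gam]_w f (tshift theta w) = \int[distribution gam S]_w f w)%E.
  by rewrite /distribution ge0_integral_pushforward.
apply: ge0_integral_density => //; first exact: measurable_wick.
- by move=> w; exact/ltW/wick_gt0.
- move=> A mA; rewrite -[LHS]/(gam (tshift theta @^-1` A)) cameron_martin_set1//.
  apply: eq_integral => w _; congr (expR _)%:E.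
  rewrite (bigD1 i)//= big1 => [|k /negbTE ki]; last by rewrite /theta ki mul0r.
  rewrite [in RHS](bigD1 i)//= big1 => [|k /negbTE ki]; last by rewrite /theta ki expr0n.
  by rewrite /theta eqxx !addr0.
Qed.

Let cameron_martinD (theta1 theta2 : 'I_n -> R) :
  cameron_martin_at theta1 -> cameron_martin_at theta2 ->
  cameron_martin_at (fun k => theta1 k + theta2 k).
Proof.
move=> h1 h2 f mf f0.
under eq_integral.
  move=> w _.
  rewrite (_ : tshift _ w = tshift theta2 (tshift theta1 w)); last first.
    by apply: eq_from_tnth => k; rewrite !tnth_mktuple addrA.
  over.
rewrite (h1 (fun w => f (tshift theta2 w))
  (measurableT_comp mf (measurable_tshift theta2)) (fun w => f0 _)).
(* The first density is evaluated with the second shift undone, so that the integrand becomes a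
   function of the vector shifted by [theta2] and the second formula applies. Undoing the shift
   yields the cross term of the squared norm. *)
pose g w := (f w * (wick theta1 (tshift (fun k => - theta2 k) w))%:E)%E.
transitivity (\int[gam]_w g (tshift theta2 w))%E.
  apply: eq_integral => w _; rewrite /g; congr (_ * (wick _ _)%:E)%E.
  by apply: eq_from_tnth => k; rewrite !tnth_mktuple addrK.
rewrite h2.
- apply: eq_integral => w _; rewrite /g -muleA -EFinM -expRD.
  congr (_ * (expR _)%:E)%E.
  under eq_bigr do rewrite tnth_mktuple mulrDr mulrN.
  under [in RHS]eq_bigr do rewrite mulrDl.
  under [X in _ = _ - X / 2]eq_bigr do rewrite sqrrD.
  rewrite !big_split/= sumrN.
  by field.
- apply: emeasurable_funM => //; apply/measurable_EFinP.
  apply: (measurableT_comp (measurable_wick _)); exact: measurable_tshift.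
- by move=> w; rewrite mule_ge0// lee_fin ltW// wick_gt0.
Qed.

(** Induction on the number of coordinates already shifted, one coordinate at a time. *)
Lemma cameron_martin (theta : 'I_n -> R) (f : n.-tuple R -> \bar R) :
  measurable_fun setT f -> (forall w, 0 <= f w)%E ->
  (\int[gam]_w f (tshift theta w) = \int[gam]_w (f w * (wick theta w)%:E))%E.
Proof.
suff : forall m, cameron_martin_at (fun k => if (k < m)%N then theta k else 0).
  move=> /(_ n); rewrite (_ : (fun k => _) = theta); first exact.
  by apply/funext => k; rewrite ltn_ord.
elim=> [|m IHm].
  move=> g mg g0; apply: eq_integral => w _.
  rewrite /wick !big1//=; [|by move=> k _; rewrite expr0n|by move=> k _; rewrite mul0r].
  rewrite mul0r subrr expR0 mule1; congr g.
  by apply: eq_from_tnth => k; rewrite tnth_mktuple addr0.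
have [mn|nm] := ltnP m n; last first.
  rewrite (_ : (fun k : 'I_n => _) = (fun k : 'I_n => if (k < m)%N then theta k else 0))//.
  apply/funext => k; rewrite (leq_trans (ltn_ord k) nm).
  by rewrite (leq_trans (ltn_ord k) (leq_trans nm (leqnSn m))).
rewrite (_ : (fun k : 'I_n => _) = (fun k : 'I_n => (if (k < m)%N then theta k else 0) +
   (if k == Ordinal mn then theta (Ordinal mn) else 0))).
  exact: (cameron_martinD IHm (cameron_martin1 _ _)).
apply/funext => k; rewrite ltnS leq_eqVlt -val_eqE/=.
have [km|km] := eqVneq (nat_of_ord k) m; last by rewrite addr0.
by rewrite km ltnn add0r; congr theta; exact: val_inj.
Qed.

End cameron_martin.

(** * Expectations of functions of subexponential growth *)

Section tame.
Context {R : realType} (n : nat) (gam : probability (n.-tuple R) R).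
Hypothesis gamE : iid_normal gam.
Implicit Types (f g : n.-tuple R -> R) (theta : 'I_n -> R).

Let norm1 (w : n.-tuple R) : R := \sum_k `|tnth w k|.

Let norm1_ge0 w : 0 <= norm1 w.
Proof. by apply: sumr_ge0. Qed.

(* Subexponential growth, so that all Gaussian expectations below exist. *)
Definition tame f := measurable_fun setT f /\
  exists c K : R, [/\ 0 <= c, 0 <= K & forall w, `|f w| <= K * expR (c * \sum_k `|tnth w k|)].

Lemma tame_bounded f K : measurable_fun setT f -> (forall w, `|f w| <= K) -> tame f.
Proof.
move=> mf fK; split => //; exists 0, `|K|; split => // w.
by rewrite mul0r expR0 mulr1 (le_trans (fK w))// ler_norm.
Qed.

Lemma tame_cst (a : R) : tame (fun=> a).
Proof. by apply: (@tame_bounded _ `|a|). Qed.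

Lemma tame_le f g : measurable_fun setT f -> tame g ->
  (forall w, `|f w| <= `|g w|) -> tame f.
Proof.
move=> mf [mg [c [K [c0 K0 gK]]]] fg; split => //; exists c, K; split => // w.
exact: le_trans (fg w) (gK w).
Qed.

Lemma tameN f : tame f -> tame (fun w => - f w).
Proof.
move=> [mf [c [K [c0 K0 fK]]]]; split; first exact: measurableT_comp.
by exists c, K; split => // w; rewrite normrN.
Qed.

Lemma tame_norm f : tame f -> tame (fun w => `|f w|).
Proof.
move=> [mf [c [K [c0 K0 fK]]]]; split; first exact: measurableT_comp.
by exists c, K; split => // w; rewrite normr_id.
Qed.

Lemma tameD f g : tame f -> tame g -> tame (fun w => f w + g w).
Proof.
move=> [mf [c [K [c0 K0 fK]]]] [mg [d [L [d0 L0 gL]]]].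
split; first exact: measurable_funD.
exists (c + d), (K + L); split; [exact: addr_ge0|exact: addr_ge0|move=> w].
rewrite (le_trans (ler_normD _ _))// mulrDl lerD//.
  apply: (le_trans (fK w)); rewrite ler_wpM2l// ler_expR.
  by rewrite ler_wpM2r ?norm1_ge0// lerDl.
apply: (le_trans (gL w)); rewrite ler_wpM2l// ler_expR.
by rewrite ler_wpM2r ?norm1_ge0// lerDr.
Qed.

Lemma tameB f g : tame f -> tame g -> tame (fun w => f w - g w).
Proof. by move=> tf tg; apply: tameD => //; exact: tameN. Qed.

Lemma tameM f g : tame f -> tame g -> tame (fun w => f w * g w).
Proof.
move=> [mf [c [K [c0 K0 fK]]]] [mg [d [L [d0 L0 gL]]]].
split; first exact: measurable_funM.
exists (c + d), (K * L); split; [exact: addr_ge0|exact: mulr_ge0|move=> w].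
by rewrite normrM mulrDl expRD mulrACA ler_pM.
Qed.

Lemma tameZ (a : R) f : tame f -> tame (fun w => a * f w).
Proof. by move=> tf; apply: tameM => //; exact: tame_cst. Qed.

Lemma tameX f k : tame f -> tame (fun w => f w ^+ k).
Proof.
move=> tf; elim: k => [|k IHk].
  by under eq_fun do rewrite expr0; exact: tame_cst.
by under eq_fun do rewrite exprS; exact: tameM.
Qed.

Lemma tame_sum (I : Type) (r : seq I) (P : pred I) (F : I -> n.-tuple R -> R) :
  (forall i, tame (F i)) -> tame (fun w => \sum_(i <- r | P i) F i w).
Proof.
move=> tF; elim: r => [|i r IHr].
  by under eq_fun do rewrite big_nil; exact: tame_cst.
under eq_fun do rewrite big_cons.
by case: (P i) => //; exact: tameD.
Qed.

Lemma tame_expR_lin theta (a : R) :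
  tame (fun w => expR (\sum_k theta k * tnth w k - a)).
Proof.
split.
  by apply: measurableT_comp => //; apply: measurable_funB => //; exact: measurable_lin.
exists (\sum_k `|theta k|), (expR (- a)); split; [exact: sumr_ge0|exact: expR_ge0|].
move=> w; rewrite ger0_norm ?expR_ge0// addrC expRD ler_wpM2l ?expR_ge0//.
rewrite ler_expR mulr_suml; apply: ler_sum => k _.
rewrite (le_trans (ler_norm _))// normrM ler_wpM2l//.
by rewrite (bigD1 k)//= lerDl sumr_ge0.
Qed.

Lemma tame_wick theta : tame (wick theta).
Proof. exact: tame_expR_lin. Qed.

Lemma tame_lin theta : tame (fun w => \sum_k theta k * tnth w k).
Proof.
apply: tame_sum => k; apply: tameZ; split; first exact: measurable_tnth.
exists 1, 1; split => // w; rewrite !mul1r (le_trans _ (expR_ge1Dx _))//.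
by rewrite (bigD1 k)//= addrCA lerDl addr_ge0// sumr_ge0.
Qed.

(** The inverse of a Wick exponential is again the exponential of an affine form. This serves for
    the inverse of an average over spins, which is bounded below by any single summand. *)
Lemma tame_inv f (m : R) theta : measurable_fun setT f -> 0 < m ->
  (forall w, m * wick theta w <= f w) -> tame (fun w => (f w)^-1).
Proof.
move=> mf m0 fm.
have f0 w : 0 < f w by rewrite (lt_le_trans _ (fm w))// mulr_gt0// wick_gt0.
apply: (@tame_le _ (fun w => m^-1 * expR (\sum_k (- theta k) * tnth w k - - ((\sum_k theta k ^+
  2) / 2)))).
- rewrite (_ : (fun w => _) = (fun x => x `^ (-1)) \o f).
    apply: measurableT_comp => //; exact: measurable_powRr.
  by apply/funext => w /=; rewrite powR_inv1// ltW.
- by apply: tameZ; exact: tame_expR_lin.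
move=> w; rewrite !ger0_norm ?mulr_ge0 ?expR_ge0 ?invr_ge0 ?(ltW m0) ?(ltW (f0 w))//.
rewrite (_ : expR _ = (wick theta w)^-1); last first.
  rewrite /wick -expRN; congr expR; rewrite opprB opprK addrC; congr (_ + _).
  by rewrite -sumrN; apply: eq_bigr => k _; rewrite mulNr.
by rewrite -invfM lef_pV2// posrE ?mulr_gt0 ?wick_gt0.
Qed.

Let integrable_wick theta : gam.-integrable setT (EFin \o wick theta).
Proof.
apply/integrableP; split.
  by apply/measurable_EFinP; exact: measurable_wick.
under eq_integral => w _ do rewrite /= ger0_norm ?(ltW (wick_gt0 _ _))// -[X in X%:E]mul1r EFinM.
rewrite -(@cameron_martin _ _ gam gamE theta (cst 1%E))//.
by rewrite integral_cst// mul1e (le_lt_trans (probability_le1 gam measurableT))// ltry.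
Qed.

(** The bound exp(c |w_k|) <= exp(c w_k) + exp(- c w_k), multiplied out over k, dominates [f] by a
    sum over sign vectors of multiples of Wick exponentials, each of which is integrable by
    Cameron-Martin. *)
Lemma tame_integrable f : tame f -> gam.-integrable setT (EFin \o f).
Proof.
move=> [mf [c [K [c0 K0 fK]]]].
pose sgn (s : {ffun 'I_n -> bool}) k : R := (-1) ^+ s k * c.
pose G w := K * \sum_(s : {ffun 'I_n -> bool})
  expR ((\sum_k sgn s k ^+ 2) / 2) * wick (sgn s) w.
have iG : gam.-integrable setT (EFin \o G).
  rewrite /G (_ : _ \o _ = fun w => K%:E *
     (\sum_(s : {ffun 'I_n -> bool}) (expR ((\sum_k sgn s k ^+ 2) / 2))%:E * (wick (sgn s)
       w)%:E))%E.
    apply: integrableZl => //; apply: integrable_sum => // s _.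
    by apply: integrableZl => //; exact: integrable_wick.
  apply/funext => w /=; rewrite EFinM -sumEFin; congr (_ * _)%E.
apply: le_integrable iG => //; first exact/measurable_EFinP.
move=> w _ /=; rewrite lee_fin (le_trans (fK w))// (le_trans _ (ler_norm _))//.
rewrite /G ler_wpM2l// mulr_sumr expR_sum.
apply: (@le_trans _ _ (\prod_(k < n) \sum_(b : bool) expR ((-1) ^+ b * c * tnth w k))).
  apply: ler_prod => k _; rewrite expR_ge0/= big_bool/= expr0 expr1 mul1r mulN1r mulNr.
  by case: (ler0P (tnth w k)) => _; rewrite ?mulrN ?lerDl ?lerDr expR_ge0.
rewrite bigA_distr_bigA/=; apply: ler_sum => s _.
rewrite -expR_sum /wick -expRD ler_expR.
rewrite addrCA subrr addr0.
by apply: ler_sum => k _.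
Qed.

End tame.

Definition gexp {R : realType} n (gam : probability (n.-tuple R) R)
  (f : n.-tuple R -> R) : R := \int[gam]_w f w.

Section gaussian_expectation.
Context {R : realType} (n : nat) (gam : probability (n.-tuple R) R).
Hypothesis gamE : iid_normal gam.
Implicit Types (f g : n.-tuple R -> R) (theta : 'I_n -> R).
Local Notation EX := (gexp gam).
Let ti := tame_integrable gamE.

Lemma integral_tame f : tame f -> (\int[gam]_w (f w)%:E)%E = (EX f)%:E.
Proof.
move=> tf; rewrite /gexp /Rintegral fineK//.
exact: integrable_fin_num (tame_integrable gamE tf).
Qed.

Lemma gexp_cst (a : R) : EX (fun=> a) = a.
Proof.
rewrite /gexp Rintegral_cst// [X in fine X](_ : _ = 1%E) ?mulr1//.
exact: probability_setT.
Qed.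

Lemma gexpD f g : tame f -> tame g -> EX (fun w => f w + g w) = EX f + EX g.
Proof. by move=> tf tg; rewrite /gexp RintegralD//; exact: ti. Qed.

Lemma gexpB f g : tame f -> tame g -> EX (fun w => f w - g w) = EX f - EX g.
Proof. by move=> tf tg; rewrite /gexp RintegralB//; exact: ti. Qed.

Lemma gexpZ (a : R) f : tame f -> EX (fun w => a * f w) = a * EX f.
Proof. by move=> tf; rewrite /gexp RintegralZl//; exact: ti. Qed.

Lemma gexp_sum (I : Type) (r : seq I) (P : pred I) (F : I -> n.-tuple R -> R) :
  (forall i, tame (F i)) ->
  EX (fun w => \sum_(i <- r | P i) F i w) = \sum_(i <- r | P i) EX (F i).
Proof.
move=> tF; elim: r => [|i r IHr].
  by rewrite big_nil; under eq_fun do rewrite big_nil; exact: gexp_cst.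
rewrite big_cons; under eq_fun do rewrite big_cons.
case: (P i) => //; rewrite gexpD ?IHr//.
exact: tame_sum.
Qed.

Lemma gexp_ge0 f : (forall w, 0 <= f w) -> 0 <= EX f.
Proof. by move=> f0; apply: Rintegral_ge0. Qed.

Lemma le_gexp f g : tame f -> tame g -> (forall w, f w <= g w) -> EX f <= EX g.
Proof. by move=> tf tg fg; apply: le_Rintegral => //; exact: ti. Qed.

Lemma le_normr_gexp f : tame f -> `|EX f| <= EX (fun w => `|f w|).
Proof. by move=> tf; apply: le_normr_Rintegral => //; exact: ti. Qed.

(** The Cameron-Martin formula is available for nonnegative functions; [f] is the difference of |f|
    and |f| - f, both nonnegative and tame. *)
Lemma gexp_shift f theta : tame f ->
  EX (fun w => f (tshift theta w)) = EX (fun w => f w * wick theta w).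
Proof.
have ge0 g : tame g -> (forall w, 0 <= g w) ->
    EX (fun w => g (tshift theta w)) = EX (fun w => g w * wick theta w).
  move=> [mg _] g0; rewrite /gexp /Rintegral.
  have := @cameron_martin _ _ gam gamE theta (EFin \o g) => ->//.
  exact/measurable_EFinP.
have tame_shift g : tame g -> (forall w, 0 <= g w) -> gam.-integrable setT (EFin \o (fun w => g
  (tshift theta w))).
  move=> tg g0; apply/integrableP; split.
    apply/measurable_EFinP; apply: (measurableT_comp (proj1 tg)).
    exact: measurable_tshift.
  under eq_integral => w _ do rewrite /= ger0_norm//.
  have := @cameron_martin _ _ gam gamE theta (EFin \o g) => /= ->//; last first.
    by apply/measurable_EFinP; exact: (proj1 tg).
  under eq_integral => w _ do rewrite -EFinM.
  have /integrableP[_] := ti (tameM tg (tame_wick theta)).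
  apply: le_lt_trans; apply: ge0_le_integral => //=.
  - by move=> w _; rewrite lee_fin mulr_ge0// ltW// wick_gt0.
  - apply/measurable_EFinP; apply: measurable_funM; first exact: (proj1 tg).
    exact: measurable_wick.
  - apply/measurable_EFinP; apply: measurableT_comp => //.
    by apply: measurable_funM; [exact: (proj1 tg)|exact: measurable_wick].
  - by move=> w _; rewrite lee_fin ler_norm.
move=> tf.
have t1 := tame_norm tf.
have t2 : tame (fun w => `|f w| - f w) by exact: tameB.
have p2 w : 0 <= `|f w| - f w by rewrite subr_ge0 ler_norm.
transitivity (EX (fun w => `|f (tshift theta w)|) - EX (fun w => `|f (tshift theta w)| - f
  (tshift theta w))).
  rewrite /gexp -RintegralB//.
  - by apply: eq_Rintegral => w _; rewrite opprB addrCA subrr addr0.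
  - exact: (tame_shift (fun w => `|f w|)).
  - exact: (tame_shift (fun w => `|f w| - f w)).
rewrite (ge0 (fun w => `|f w|))// (ge0 (fun w => `|f w| - f w))//.
rewrite -gexpB; [|exact: (tameM _ (tame_wick _))|exact: (tameM _ (tame_wick _))].
by congr EX; apply/funext => w; ring.
Qed.

Lemma gexp_wick theta : EX (wick theta) = 1.
Proof.
have := @gexp_shift (fun=> 1) theta (tame_cst n 1).
by rewrite gexp_cst => ->; congr EX; apply/funext => w; rewrite mul1r.
Qed.

End gaussian_expectation.

(** * Averages over spins *)

Section exponential_inequalities.
Context {R : realType}.
Implicit Types x y : R.

Lemma ge0_derive_le (f f' : R -> R) : (forall x, is_derive x 1 f (f' x)) ->
  (forall x, 0 <= x -> 0 <= f' x) -> forall x, 0 <= x -> f 0 <= f x.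
Proof.
move=> df f'0 x x0.
apply: (@ger0_derive1_ndecry _ f 0) => //.
- move=> y; rewrite in_itv/= andbT => y0; rewrite derive1E.
  by have := df y => h; rewrite derive_val f'0// ltW.
- apply: derivable_within_continuous => y _ //.
Qed.

(** For y >= 0 the function exp(- y^2 / 2) (e^y + e^(- y)) is nonincreasing. The sign of its
    derivative is [h1], itself obtained by differentiating once more. *)
Lemma expR_cosh_le y : expR y + expR (- y) <= 2 * expR (y ^+ 2 / 2).
Proof.
wlog y0 : y / 0 <= y.
  move=> h; have [/h//|/ltW y0] := leP 0 y.
  by have := h (- y); rewrite sqrrN opprK addrC; apply; rewrite oppr_ge0.
have h1 x : 0 <= x -> 0 <= x * expR x + x * expR (- x) - expR x + expR (- x).
  move=> x0; pose f z : R := z * expR z + z * expR (- z) - expR z + expR (- z).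
  have f0 : f 0 = 0 by rewrite /f oppr0 !mul0r expR0; ring.
  rewrite -[leLHS]f0; apply: (@ge0_derive_le f (fun z => z * (expR z - expR (- z)))) => //.
    move=> z; apply: is_derive_eq.
    by rewrite /GRing.scale/=; ring.
  by move=> z z0; rewrite mulr_ge0// subr_ge0 ler_expR; lra.
pose g z : R := - (expR (- (z ^+ 2 / 2)) * (expR z + expR (- z))).
have g0 : g 0 = - 2 by rewrite /g expr0n/= mul0r oppr0 expR0; ring.
have : g 0 <= g y.
  apply: (@ge0_derive_le g (fun z => expR (- (z ^+ 2 / 2)) * (z * expR z + z * expR (- z) -
    expR z + expR (- z)))) => //.
    move=> z; apply: is_derive_eq.
    by rewrite /GRing.scale/=; field.
  by move=> z z0; rewrite mulr_ge0 ?expR_ge0// h1.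
rewrite g0 lerN2.
by rewrite /g (expRN (y ^+ 2 / 2)) ler_pdivrMl ?expR_gt0// mulrC.
Qed.

Lemma expR_sub1_le y : `|expR y - 1| <= `|y| * expR `|y|.
Proof.
have [y0|y0] := leP 0 y.
  rewrite (ger0_norm y0) ger0_norm; last by rewrite subr_ge0 -expR0 ler_expR.
  have := expR_ge1Dx (- y); rewrite expRN => h.
  have e0 := expR_gt0 y.
  have : (1 - y) * expR y <= 1 by rewrite -ler_pdivlMr// mul1r.
  by rewrite mulrBl mul1r; lra.
rewrite ler0_norm; last by rewrite subr_le0 expR_le1 ltW.
have h := expR_ge1Dx y.
have h2 : 1 <= expR `|y|.
  by apply: le_trans (expR_ge1Dx _); rewrite lerDl.
rewrite (ltr0_norm y0) in h2 *.
apply: (@le_trans _ _ (- y)); first by lra.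
by rewrite ler_peMr// oppr_ge0 ltW.
Qed.

(** Since (1 - y) e^y <= 1, the remainder lies between 0 and y (e^y - 1), to which the first-order
    bound applies. *)
Lemma expR_taylor2 y : `|expR y - 1 - y| <= y ^+ 2 * expR `|y|.
Proof.
rewrite ger0_norm; last by rewrite -addrA -opprD subr_ge0 expR_ge1Dx.
have e0 := expR_gt0 y.
have : (1 - y) * expR y <= 1.
  by have := expR_ge1Dx (- y); rewrite expRN -[leRHS]mul1r ler_pdivlMr.
move=> h; apply: (@le_trans _ _ (y * (expR y - 1))); first by lra.
rewrite (le_trans (ler_norm _))// normrM -real_normK ?num_real// expr2 -mulrA.
by rewrite ler_wpM2l// expR_sub1_le.
Qed.

End exponential_inequalities.

Definition spins (N : nat) := {ffun 'I_N -> bool}.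

Definition spin {R : realType} N (x : spins N) (i : 'I_N) : R := (-1) ^+ x i.

Definition flip N (o : 'I_N) (x : spins N) : spins N :=
  [ffun i => if i == o then ~~ x i else x i].

Definition savg {R : realType} N (f : spins N -> R) : R :=
  (2 ^+ N)^-1 * \sum_x f x.

Section spin_average.
Context {R : realType} (N : nat).
Implicit Types (f g : spins N -> R) (x : spins N) (o : 'I_N).

Lemma flipK o : involutive (@flip N o).
Proof.
move=> x; apply/ffunP => i; rewrite !ffunE.
by case: eqP => // _; rewrite negbK.
Qed.

Lemma spin_flip o x i : spin (flip o x) i = (if i == o then - spin x i else spin x i) :> R.
Proof. by rewrite /spin ffunE; case: eqP => // _; rewrite signrN. Qed.

Lemma sqr_spin x i : spin x i ^+ 2 = 1 :> R.
Proof. by rewrite /spin sqrr_sign. Qed.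

Lemma savg_const (a : R) : savg (fun _ : spins N => a) = a.
Proof.
rewrite /savg sumr_const card_ffun card_bool card_ord -[a *+ _]mulr_natl natrX.
by rewrite mulKf// expf_neq0.
Qed.

Lemma eq_savg f g : f =1 g -> savg f = savg g.
Proof. by move=> fg; congr (_ * _); apply: eq_bigr. Qed.

Lemma savgD f g : savg (fun x => f x + g x) = savg f + savg g.
Proof. by rewrite /savg big_split mulrDr. Qed.

Lemma savgZ (a : R) f : savg (fun x => a * f x) = a * savg f.
Proof. by rewrite /savg -mulr_sumr mulrCA. Qed.

Lemma savgZr (a : R) f : savg (fun x => f x * a) = savg f * a.
Proof. by rewrite /savg -mulr_suml mulrA. Qed.

Lemma savgN f : savg (fun x => - f x) = - savg f.
Proof. by rewrite /savg sumrN mulrN. Qed.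

Lemma savgB f g : savg (fun x => f x - g x) = savg f - savg g.
Proof. by rewrite savgD savgN. Qed.

Let c0 : 0 <= (2 ^+ N)^-1 :> R.
Proof. by rewrite invr_ge0 exprn_ge0. Qed.

Lemma le_savg f g : (forall x, f x <= g x) -> savg f <= savg g.
Proof. by move=> fg; rewrite /savg ler_wpM2l// ler_sum. Qed.

Lemma savg_ge0 f : (forall x, 0 <= f x) -> 0 <= savg f.
Proof. by move=> f0; rewrite /savg mulr_ge0// sumr_ge0. Qed.

Lemma savg_gt0 (f : spins N -> R) : (forall x, 0 < f x) -> 0 < savg f.
Proof.
move=> f0; rewrite mulr_gt0 ?invr_gt0 ?exprn_gt0//.
rewrite (bigD1 [ffun=> true])//= ltr_pwDl//.
by apply: sumr_ge0 => x _; exact: ltW.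
Qed.

Lemma ler_norm_savg f : `|savg f| <= savg (fun x => `|f x|).
Proof. by rewrite /savg normrM (ger0_norm c0) ler_wpM2l// ler_norm_sum. Qed.

Lemma savg_exchange (f : spins N -> spins N -> R) :
  savg (fun x => savg (f x)) = savg (fun y => savg (f^~ y)).
Proof.
rewrite /savg -!mulr_sumr; congr (_ * (_ * _)); exact: exchange_big.
Qed.

Lemma savg_sum (I : Type) (r : seq I) (P : pred I) (F : I -> spins N -> R) :
  savg (fun x => \sum_(i <- r | P i) F i x) = \sum_(i <- r | P i) savg (F i).
Proof. by rewrite /savg exchange_big mulr_sumr. Qed.

Lemma savg_flip o f : savg (fun x => f (flip o x)) = savg f.
Proof.
by rewrite /savg [in RHS](reindex_inj (inv_inj (flipK o))).
Qed.

(** All cancellations of the cavity argument are instances: a term that changes sign with the spin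
    at [o] averages to zero. *)
Lemma savg_odd o f : (forall x, f (flip o x) = - f x) -> savg f = 0.
Proof.
move=> fo; have := savg_flip o f; rewrite (eq_savg fo) savgN => h; lra.
Qed.

(* Subgaussianity with the sharp constant, peeling off one spin at a time: the
   exponent a becomes a / (1 - 2a). *)
Lemma savg_expR_sqr_le (e : 'I_N -> R) (s : seq 'I_N) (a c : R) :
  (forall i, e i ^+ 2 = 1) -> uniq s -> 0 <= a -> 2 * (size s)%:R * a < 1 ->
  savg (fun x => expR (a * (c + \sum_(i <- s) spin x i * e i) ^+ 2)) <=
  expR ((a * c ^+ 2 + (size s)%:R * a) / (1 - 2 * (size s)%:R * a)).
Proof.
move=> e1 + a0; elim: s c => [|j s IHs] c us /=.
  move=> _; rewrite mulr0 !mul0r subr0 divr1 addr0.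
  under eq_savg do rewrite big_nil addr0.
  by rewrite savg_const.
move: us => /= /andP[js us]; set m : R := (size s)%:R => lt1.
have m0 : 0 <= m by exact: ler0n.
have mS : (size s).+1%:R = m + 1 :> R by rewrite -natr1.
rewrite mS in lt1 *.
have lt1' : 2 * m * a < 1.
  by apply: le_lt_trans lt1; nra.
pose S x := \sum_(i <- s) spin x i * e i.
have Sflip x : S (flip j x) = S x.
  apply: eq_big_seq => i si; rewrite spin_flip; case: eqP => // ij.
  by rewrite -ij si in js.
pose F b x := expR (a * ((c + b) + S x) ^+ 2).
(* Conditioning on the spin at [j]: as e_j = 1 or -1, its contribution is a fair sign, which is
   absorbed into the constant [c]. *)
rewrite (_ : savg _ = 2^-1 * (savg (F 1) + savg (F (- 1)))); last first.
  rewrite -savgD -[LHS]mul1r -[X in X * _ = _](mulVf (_ : 2 != 0 :> R))// -mulrA; congr (_ * _).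
  rewrite mulr2n mulrDl !mul1r -{2}(savg_flip j) -savgD; apply: eq_savg => x.
  rewrite !big_cons -!/(S _) Sflip spin_flip eqxx.
  have : (spin x j * e j) ^+ 2 = 1 :> R by rewrite exprMn sqr_spin e1 mul1r.
  rewrite mulNr /F; move/eqP; rewrite sqrf_eq1 => /orP[]/eqP ->.
    by congr (expR (_ * _ ^+ 2) + expR (_ * _ ^+ 2)); ring.
  by rewrite addrC; congr (expR (_ * _ ^+ 2) + expR (_ * _ ^+ 2)); ring.
pose A := a / (1 - 2 * m * a).
have d0 : 0 < 1 - 2 * m * a by rewrite subr_gt0.
have d1 : 0 < 1 - 2 * (m + 1) * a by rewrite subr_gt0.
have A0 : 0 <= A by rewrite divr_ge0// ltW.
have step b : savg (F b) <= expR (A * ((c + b) ^+ 2 + m)).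
  apply: le_trans (IHs (c + b) us lt1') _.
  by rewrite ler_expR /A le_eqVlt; apply/orP; left; apply/eqP; field; rewrite gt_eqF.
rewrite ler_pdivrMl//.
apply: (le_trans (lerD (step 1) (step (-1)))).
rewrite (_ : A * ((c + 1) ^+ 2 + m) = A * (c ^+ 2 + 1 + m) + 2 * A * c); last by ring.
rewrite (_ : A * ((c - 1) ^+ 2 + m) = A * (c ^+ 2 + 1 + m) + - (2 * A * c)); last by ring.
rewrite !expRD -mulrDr.
apply: (le_trans (ler_wpM2l (expR_ge0 _) (expR_cosh_le _))).
rewrite mulrCA -expRD ler_pM2l// ler_expR.
pose A' := a / (1 - 2 * (m + 1) * a).
have -> : (a * c ^+ 2 + (m + 1) * a) / (1 - 2 * (m + 1) * a) = A' * (c ^+ 2 + (m + 1)).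
  by rewrite /A'; field; rewrite gt_eqF.
(* A' equals A / (1 - 2 A), and the hyperbolic cosine bound turns A into A (1 + 2 A), the beginning
   of its expansion. The nonnegative difference is what closes the induction. *)
have A'E : A' - A * (1 + 2 * A) = 4 * a * A ^+ 2 / (1 - 2 * (m + 1) * a).
  by rewrite /A' /A; field; rewrite !gt_eqF.
have h1 : A * (1 + 2 * A) <= A'.
  by rewrite -subr_ge0 A'E divr_ge0 ?(ltW d1)// mulr_ge0 ?sqr_ge0// mulr_ge0.
have h2 : A <= A'.
  by apply: le_trans h1; rewrite mulrDr mulr1 lerDl mulr_ge0// mulr_ge0.
have c2 : 0 <= c ^+ 2 by exact: sqr_ge0.
nra.
Qed.

End spin_average.

(** * Signal vectors and moments of the overlap *)

Section edges.
Context {R : realType} (N : nat).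
Local Notation n := #|{: upper_pair N}|.

Definition end1 (k : 'I_n) : 'I_N := (val (enum_val k)).1.
Definition end2 (k : 'I_n) : 'I_N := (val (enum_val k)).2.

Lemma sum_edges (h : 'I_N -> 'I_N -> R) :
  \sum_k h (end1 k) (end2 k) = \sum_(i < N) \sum_(j < N | (i < j)%N) h i j.
Proof.
rewrite (pair_big_dep xpredT (fun i j : 'I_N => i < j)%N h)/=.
rewrite /end1 /end2.
rewrite -(@reindex _ _ _ _ _ (fun k => enum_val k : upper_pair N) xpredT
  (fun p => h (val p).1 (val p).2)); last first.
  by exists enum_rank => k _; [exact: enum_valK|exact: enum_rankK].
rewrite (reindex_omap (fun p : upper_pair N => val p) insub)/=; last first.
  by move=> p pP; rewrite insubT.
by apply: eq_bigl => p; rewrite valK eqxx andbT (valP p).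
Qed.

Lemma sum_edges_prod (a : 'I_N -> R) :
  \sum_k a (end1 k) * a (end2 k) = ((\sum_i a i) ^+ 2 - \sum_i a i ^+ 2) / 2.
Proof.
rewrite (sum_edges (fun i j => a i * a j)).
have E : (\sum_i a i) ^+ 2 = \sum_i a i ^+ 2 + 2 * \sum_(i < N) \sum_(j < N | (i < j)%N) a i * a j.
  rewrite expr2 mulr_suml.
  under eq_bigr => i _ do rewrite mulr_sumr (bigID (fun j : 'I_N => i < j)%N)/=.
  rewrite big_split/=.
  suff -> : \sum_(i < N) \sum_(j < N | ~~ (i < j)%N) a i * a j =
    \sum_i a i ^+ 2 + \sum_(i < N) \sum_(j < N | (i < j)%N) a i * a j by ring.
  have -> : \sum_(i < N) \sum_(j < N | (i < j)%N) a i * a j = \sum_(i : 'I_N) \sum_(j < N | (j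
    < i)%N) a i * a j.
    rewrite (exchange_big_dep xpredT)//=; apply: eq_bigr => i _; apply: eq_bigr => j _.
    by rewrite mulrC.
  rewrite -big_split/=; apply: eq_bigr => i _.
  under eq_bigl => j do rewrite -leqNgt.
  rewrite (bigD1 i)//= -expr2; congr (_ + _).
  by apply: eq_bigl => j; rewrite [RHS]ltn_neqAle andbC.
by rewrite E; field.
Qed.

End edges.

(* The model is indexed by an abstract enumeration (e1 k, e2 k) of the pairs
   i < j, of which only this quadratic identity matters. *)
Definition enumerates_pairs {R : realType} (N n : nat) (e1 e2 : 'I_n -> 'I_N) :=
  forall a : 'I_N -> R,
  \sum_k a (e1 k) * a (e2 k) = ((\sum_i a i) ^+ 2 - \sum_i a i ^+ 2) / 2.

(** The weights [v] are arbitrary reals rather than signs, so that a vertex can be removed by giving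
    it weight zero. *)
Definition theta {R : realType} (N n : nat) (e1 e2 : 'I_n -> 'I_N)
  (kap : R) (v : 'I_N -> R) (k : 'I_n) : R := kap * v (e1 k) * v (e2 k).

Lemma theta_dot {R : realType} (N n : nat) (e1 e2 : 'I_n -> 'I_N) kap (v v' : 'I_N -> R) :
  enumerates_pairs (R := R) e1 e2 ->
  \sum_k theta e1 e2 kap v k * theta e1 e2 kap v' k =
  kap ^+ 2 * (((\sum_i v i * v' i) ^+ 2 - \sum_i (v i * v' i) ^+ 2) / 2).
Proof.
move=> eP; rewrite -(eP (fun i => v i * v' i)) mulr_sumr; apply: eq_bigr => k _.
by rewrite /theta; ring.
Qed.

Lemma wick_dot {R : realType} m (t1 t2 : 'I_m -> R) w :
  wick t1 w * wick t2 w =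
  expR (\sum_k t1 k * t2 k) * wick (fun k => t1 k + t2 k) w.
Proof.
rewrite /wick -!expRD; congr expR.
under [X in _ = _ + (X - _)]eq_bigr do rewrite mulrDl.
under [X in _ = _ + (_ - X / 2)]eq_bigr do rewrite sqrrD.
by rewrite !big_split/=; field.
Qed.

Lemma wick_shift {R : realType} m (t s : 'I_m -> R) w :
  wick t (tshift s w) = expR (\sum_k t k * s k) * wick t w.
Proof.
have E : \sum_k t k * tnth (tshift s w) k =
    \sum_k t k * s k + \sum_k t k * tnth w k.
  by rewrite -big_split/=; apply: eq_bigr => k _; rewrite tnth_mktuple; ring.
by rewrite /wick E -[RHS]expRD addrA.
Qed.

Section overlap.
Context {R : realType} (N : nat).

(** Not normalised, and restricted to the sites in [P]: the cavity argument leaves one vertex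
    out. *)
Definition overlap (P : pred 'I_N) (x y : spins N) : R :=
  \sum_(i | P i) spin x i * spin y i.

End overlap.

(** [savg_expR_sqr_le] still holds with [lam] raised to the midpoint [mu] of [lam, 1]; the spare
    exponent [dl] times overlap^2 / N absorbs the polynomial factor. The weight N^2 + overlap^4 is a
    common majorant for all polynomials in the overlap met below, and [C] depends on [lam] only. *)
Lemma overlap_moment {R : realType} (lam : R) : 0 <= lam -> lam < 1 ->
  exists C : R, 0 < C /\ forall (N : nat) (P : pred 'I_N) (k : R), (0 < N)%N ->
  0 <= k -> k * N%:R <= lam ->
  savg (fun x => savg (fun y =>
    (N%:R ^+ 2 + overlap P x y ^+ 4) * expR (k * overlap P x y ^+ 2 / 2))) <= C * N%:R ^+ 2.
Proof.
move=> lam0 lam1.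
pose mu := (1 + lam) / 2; pose dl := (mu - lam) / 2.
have dl0 : 0 < dl by rewrite /dl /mu; lra.
pose C0 := expR ((mu / 2) / (1 - mu)).
have C00 : 0 < C0 := expR_gt0 _.
exists ((1 + 2 / dl ^+ 2) * C0); split.
  by rewrite mulr_gt0// addr_gt0// divr_gt0// exprn_gt0.
move=> N P k N0 k0 kN.
have Np : 0 < N%:R :> R by rewrite ltr0n.
pose a := mu / (2 * N%:R).
have step x : savg (fun y => expR (a * overlap P x y ^+ 2)) <= C0.
  pose s := [seq i <- enum 'I_N | P i].
  have us : uniq s by rewrite filter_uniq// enum_uniq.
  have sN : (size s <= N)%N by rewrite size_filter (leq_trans (count_size _ _))// size_enum_ord.
  have sNR : (size s)%:R <= N%:R :> R by rewrite ler_nat.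
  have mu0 : 0 < mu by rewrite /mu; lra.
  have a0 : 0 <= a by apply: divr_ge0; [exact: ltW|rewrite mulr_ge0// ltW].
  have aN : 2 * N%:R * a = mu by rewrite /a; field; rewrite gt_eqF.
  have as1 : 2 * (size s)%:R * a <= mu.
    by rewrite -aN ler_wpM2r// ler_wpM2l.
  have mu1 : mu < 1 by rewrite /mu; lra.
  have := @savg_expR_sqr_le R N (spin x) s a 0 (fun i => sqr_spin x i) us a0 (le_lt_trans as1 mu1).
  rewrite expr0n mulr0 add0r => h.
  rewrite (_ : savg _ = savg (fun y => expR (a * (0 + \sum_(i <- s) spin y i * spin x i) ^+
    2))); last first.
    apply: eq_savg => y; rewrite add0r /overlap /s big_filter big_enum_cond/=.
    congr (expR (_ * _ ^+ 2)); apply: eq_big => // i _.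
    by rewrite mulrC.
  apply: (le_trans h); rewrite ler_expR; apply: ler_pM.
  - by rewrite mulr_ge0.
  - by rewrite invr_ge0 subr_ge0 ltW// (le_lt_trans as1).
  - by lra.
  - by rewrite lef_pV2 ?posrE; lra.
rewrite -[leRHS](savg_const N); apply: le_savg => x.
apply: (@le_trans _ _ (savg (fun y => (1 + 2 / dl ^+ 2) * N%:R ^+ 2 * expR (a * overlap P x y
  ^+ 2)))); last first.
  by rewrite savgZ mulrAC ler_wpM2r ?sqr_ge0// ler_wpM2l// addr_ge0// divr_ge0// sqr_ge0.
apply: le_savg => y; set r := overlap P x y.
pose t := r ^+ 2 / N%:R.
have t0 : 0 <= t by rewrite divr_ge0 ?sqr_ge0// ltW.
have rE : r ^+ 2 = t * N%:R by rewrite /t divfK// gt_eqF.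
have -> : r ^+ 4 = t ^+ 2 * N%:R ^+ 2 by rewrite -exprMn -rE -exprM.
have -> : a * r ^+ 2 = dl * t + lam * t / 2.
  by rewrite rE /a /dl; field; rewrite gt_eqF.
have kle : k * r ^+ 2 / 2 <= lam * t / 2.
  by rewrite ler_pM2r// rE mulrCA mulrC ler_wpM2r.
have -> : N%:R ^+ 2 + t ^+ 2 * N%:R ^+ 2 = (1 + t ^+ 2) * N%:R ^+ 2 by ring.
have -> u v : (1 + 2 / dl ^+ 2) * N%:R ^+ 2 * expR (u + v) =
    (1 + 2 / dl ^+ 2) * expR u * expR v * N%:R ^+ 2 by rewrite expRD; ring.
rewrite mulrAC ler_wpM2r ?sqr_ge0//.
apply: ler_pM; rewrite ?ler_expR ?expR_ge0 ?addr_ge0 ?sqr_ge0//.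
have dt0 : 0 <= dl * t by rewrite mulr_ge0// ltW.
have := expR_ge1Dxn 1 dt0; rewrite exprMn => h.
have dl2 : 0 < dl ^+ 2 by rewrite exprn_gt0.
have h1 : 1 <= expR (dl * t) by rewrite -expR0 ler_expR.
have h2 : t ^+ 2 <= 2 / dl ^+ 2 * expR (dl * t).
  rewrite mulrAC ler_pdivlMr//.
  have : t ^+ 2 * dl ^+ 2 / 2 <= expR (dl * t).
    by move: h; rewrite [2`!%:R](_ : _ = 2) //; lra.
  by lra.
by rewrite mulrDl mul1r lerD.
Qed.

(** * Expansion of a four-replica weight *)

Section four_replica.
Context {R : realType}.

Lemma sqr_sum6_le (a b c d e f : R) :
  (a + b + c + d + e + f) ^+ 2 <=
  6 * (a ^+ 2 + b ^+ 2 + c ^+ 2 + d ^+ 2 + e ^+ 2 + f ^+ 2).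
Proof.
rewrite -subr_ge0 (_ : _ - _ = (a - b) ^+ 2 + (a - c) ^+ 2 + (a - d) ^+ 2 +
  (a - e) ^+ 2 + (a - f) ^+ 2 + (b - c) ^+ 2 + (b - d) ^+ 2 + (b - e) ^+ 2 +
  (b - f) ^+ 2 + (c - d) ^+ 2 + (c - e) ^+ 2 + (c - f) ^+ 2 + (d - e) ^+ 2 +
  (d - f) ^+ 2 + (e - f) ^+ 2); last by ring.
by rewrite !addr_ge0// sqr_ge0.
Qed.

(* The subtracted terms are the monomials of order at most one in r that do
   not cancel; each is odd in s1 or in s2. *)
Lemma four_replica_taylor (s1 s2 s3 s4 r12 r34 r13 r14 r23 r24 : R) :
  s1 ^+ 2 = 1 -> s2 ^+ 2 = 1 -> s3 ^+ 2 = 1 -> s4 ^+ 2 = 1 ->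
  `|r12| <= 1 -> `|r34| <= 1 -> `|r13| <= 1 -> `|r14| <= 1 -> `|r23| <= 1 -> `|r24| <= 1 ->
  `|(s1 * s2 - r12) * (s3 * s4 - r34) *
    expR (s1 * s2 * r12 + s3 * s4 * r34 + s1 * s3 * r13 + s1 * s4 * r14 +
      s2 * s3 * r23 + s2 * s4 * r24) -
    (s1 * s2 * (s3 * s4) + r24 * (s1 * s3) + r23 * (s1 * s4) +
     (r13 * (s2 * s4) + r14 * (s2 * s3)))| <=
  11 * expR 6 * (r12 ^+ 2 + r34 ^+ 2 + r13 ^+ 2 + r14 ^+ 2 + r23 ^+ 2 + r24 ^+ 2).
Proof.
move=> h1 h2 h3 h4 b12 b34 b13 b14 b23 b24.
have sgn (a b : R) : a ^+ 2 = 1 -> b ^+ 2 = 1 -> `|a * b| = 1.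
  move=> a1 b1; apply/eqP; rewrite -sqrp_eq1 ?normr_ge0// real_normK ?num_real//.
  by rewrite exprMn a1 b1 mulr1.
have n12 := sgn _ _ h1 h2; have n34 := sgn _ _ h3 h4; have n13 := sgn _ _ h1 h3.
have n14 := sgn _ _ h1 h4; have n23 := sgn _ _ h2 h3; have n24 := sgn _ _ h2 h4.
have sq (a r : R) : `|a| = 1 -> (a * r) ^+ 2 = r ^+ 2.
  by move=> a1; rewrite exprMn -(real_normK (num_real a)) a1 expr1n mul1r.
set S := r12 ^+ 2 + _ + _ + _ + _ + _.
set Y := s1 * s2 * r12 + _ + _ + _ + _ + _.
have Y2 : Y ^+ 2 <= 6 * S.
  by apply: le_trans (sqr_sum6_le _ _ _ _ _ _) _; rewrite !sq.
have Y6 : `|Y| <= 6.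
  rewrite /Y.
  have n1 (a r : R) : `|a| = 1 -> `|r| <= 1 -> `|a * r| <= 1.
    by move=> a1; rewrite normrM a1 mul1r.
  have := n1 _ _ n12 b12; have := n1 _ _ n34 b34; have := n1 _ _ n13 b13.
  have := n1 _ _ n14 b14; have := n1 _ _ n23 b23; have := n1 _ _ n24 b24.
  move: (s1 * s2 * r12) (s3 * s4 * r34) (s1 * s3 * r13) (s1 * s4 * r14)
    (s2 * s3 * r23) (s2 * s4 * r24) => a b c d e f.
  have := ler_normD (a + b + c + d + e) f; have := ler_normD (a + b + c + d) e.
  have := ler_normD (a + b + c) d; have := ler_normD (a + b) c; have := ler_normD a b.
  lra.
have Sge : [/\ 0 <= S & r12 ^+ 2 + r34 ^+ 2 <= S].
  have := sqr_ge0 r12; have := sqr_ge0 r34; have := sqr_ge0 r13.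
  have := sqr_ge0 r14; have := sqr_ge0 r23; have := sqr_ge0 r24.
  by split; rewrite /S; lra.
case: Sge => S0 SS.
have e6 : expR `|Y| <= expR 6 by rewrite ler_expR.
set E := expR Y.
(* Since squares of signs are 1, s1 s2 s3 s4 Y is linear in the r's. Its r12 and r34 terms cancel
   those produced by the two factors s1 s2 - r12 and s3 s4 - r34; the other four are subtracted
   explicitly, and everything left is of second order. *)
rewrite (_ : _ - _ = s1 * s2 * (s3 * s4) * (E - 1 - Y)
  - (r12 * (s3 * s4) + r34 * (s1 * s2)) * (E - 1) + r12 * r34 * E); last first.
  have {n12 n34 n13 n14 n23 n24 sq} q (a b c d x : R) : a ^+ 2 = 1 -> b ^+ 2 = 1 ->
      a * b * (c * d) * (a * b * x) = x * (c * d).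
    by move=> a1 b1; rewrite (_ : _ * _ = a ^+ 2 * b ^+ 2 * (x * (c * d)));
      [rewrite a1 b1 !mul1r|ring].
  have q1 := q s1 s2 s3 s4 r12 h1 h2.
  have q2 := q s3 s4 s1 s2 r34 h3 h4.
  have q3 := q s1 s3 s2 s4 r13 h1 h3.
  have q4 := q s1 s4 s2 s3 r14 h1 h4.
  have q5 := q s2 s3 s1 s4 r23 h2 h3.
  have q6 := q s2 s4 s1 s3 r24 h2 h4.
  have : s1 * s2 * (s3 * s4) * Y = r12 * (s3 * s4) + r34 * (s1 * s2) + r13 * (s2 * s4)
      + r14 * (s2 * s3) + r23 * (s1 * s4) + r24 * (s1 * s3).
    by rewrite -q1 -q2 -q3 -q4 -q5 -q6 /Y; ring.
  move=> hY.
  have -> : s1 * s2 * (s3 * s4) * (E - 1 - Y) =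
    s1 * s2 * (s3 * s4) * E - s1 * s2 * (s3 * s4) - s1 * s2 * (s3 * s4) * Y by ring.
  by rewrite hY; ring.
have tE : `|E - 1 - Y| <= Y ^+ 2 * expR 6.
  by apply: (le_trans (expR_taylor2 Y)); rewrite ler_wpM2l ?sqr_ge0.
have tE1 : `|E - 1| <= `|Y| * expR 6.
  by apply: (le_trans (expR_sub1_le Y)); rewrite ler_wpM2l.
have tE0 : `|E| <= expR 6.
  by rewrite ger0_norm ?expR_ge0// ler_expR (le_trans (ler_norm _)).
have e0 : 0 <= expR 6 :> R by exact: expR_ge0.
clearbody E.
apply: (le_trans (ler_normD _ _)).
apply: (le_trans (lerD (ler_normB _ _) (lexx _))).
rewrite (normrM (s1 * s2 * (s3 * s4))) (normrM (s1 * s2)) n12 n34 !mul1r.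
rewrite (normrM _ (E - 1)) (normrM _ E) (normrM r12).
have t2 : `|r12 * (s3 * s4) + r34 * (s1 * s2)| <= `|r12| + `|r34|.
  by apply: (le_trans (ler_normD _ _)); rewrite (normrM r12) (normrM r34) n12 n34 !mulr1.
have u2 : `|r12 * (s3 * s4) + r34 * (s1 * s2)| * `|E - 1| <= (`|r12| + `|r34|) * (`|Y| * expR 6).
  by rewrite ler_pM.
have u3 : `|r12| * `|r34| * `|E| <= `|r12| * `|r34| * expR 6.
  by rewrite ler_wpM2l// mulr_ge0.
(* The three parts contribute 6, 4 and 1 times S e^6, hence the constant 11. *)
have u1 : `|E - 1 - Y| <= 6 * S * expR 6.
  by apply: (le_trans tE); rewrite ler_wpM2r.
have Yn : `|Y| ^+ 2 = Y ^+ 2 by rewrite real_normK ?num_real.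
have a12 : `|r12| ^+ 2 = r12 ^+ 2 by rewrite real_normK ?num_real.
have a34 : `|r34| ^+ 2 = r34 ^+ 2 by rewrite real_normK ?num_real.
have v2 : (`|r12| + `|r34|) * `|Y| <= 4 * S.
  by have := sqr_ge0 (`|r12| - `|r34|); have := sqr_ge0 (`|r12| + `|r34| - `|Y|); nra.
have v3 : `|r12| * `|r34| <= S.
  by have := sqr_ge0 (`|r12| - `|r34|); nra.
have w2 : (`|r12| + `|r34|) * (`|Y| * expR 6) <= 4 * S * expR 6.
  by rewrite mulrA ler_wpM2r.
have w3 : `|r12| * `|r34| * expR 6 <= S * expR 6 by rewrite ler_wpM2r.
lra.
Qed.

Lemma mul_sqr_sum6_le (a b c d e f : R) :
  `|a * b| * (a ^+ 2 + b ^+ 2 + c ^+ 2 + d ^+ 2 + e ^+ 2 + f ^+ 2) <=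
  3 * (a ^+ 4 + b ^+ 4 + c ^+ 4 + d ^+ 4 + e ^+ 4 + f ^+ 4).
Proof.
have := sqr_sum6_le (a ^+ 2) (b ^+ 2) (c ^+ 2) (d ^+ 2) (e ^+ 2) (f ^+ 2).
rewrite -!exprM !mulnE/=; set T := a ^+ 2 + _ + _ + _ + _ + _ => h.
have T0 : 0 <= T by rewrite !addr_ge0// sqr_ge0.
have ab : `|a * b| <= T / 2.
  have : 2 * `|a * b| <= a ^+ 2 + b ^+ 2.
    have := sqr_ge0 (`|a| - `|b|); rewrite sqrrB !real_normK ?num_real// normrM; lra.
  have := sqr_ge0 c; have := sqr_ge0 d; have := sqr_ge0 e; have := sqr_ge0 f.
  by rewrite /T; lra.
have : `|a * b| * T <= T / 2 * T by rewrite ler_wpM2r.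
move: h; rewrite expr2; lra.
Qed.

End four_replica.

(** * The complementary error function and the Black-Scholes function *)

Section erfc_theory.
Context {R : realType}.
Implicit Types x y a : R.
Local Notation mu := (@lebesgue_measure R).
Local Notation sqrtpi := (Num.sqrt pi : R).

Let sqrtpi_gt0 : 0 < sqrtpi. Proof. by rewrite sqrtr_gt0 pi_gt0. Qed.

Lemma sqrtpi_ge1 : 1 <= sqrtpi.
Proof.
rewrite -[leLHS]sqrtr1 ler_sqrt ?pi_ge0//.
by apply: le_trans (pi_ge2 R); rewrite ler1n.
Qed.

(** Moves the variable to the upper end of the integral, where the fundamental theorem of calculus
    gives the derivative. *)
Lemma erfcE x : erfc x = 2 - 2 / sqrtpi * \int[mu]_(t in `]-oo, x]) gauss_fun t.
Proof.
have iG := @integrableT_gauss R.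
rewrite [X in _ = X - _](_ : 2 = 2 / sqrtpi * sqrtpi); last by rewrite divfK// gt_eqF.
rewrite -mulrBr /erfc; congr (_ * _).
rewrite -[X in X - _](_ : \int[mu]_(t in [set` Interval -oo%O +oo%O]) gauss_fun t = _); last first.
  by rewrite set_itvNyy /Rintegral integralT_gauss.
rewrite Rintegral_itvB//; last by rewrite set_itvNyy.
rewrite Rintegral_itv_obnd_cbnd//.
by apply: integrableS iG.
Qed.

Lemma is_derive_erfc x : is_derive x 1 (@erfc R) (- (2 / sqrtpi) * expR (- x ^+ 2)).
Proof.
have iG := @integrableT_gauss R.
pose G y : R := \int[mu]_(t in `]-oo, y]) gauss_fun t.
have [dG G'] : derivable G x 1 /\ derive1 G x = gauss_fun x.
  apply: (@continuous_FTC1 _ gauss_fun -oo%O x (x + 1)); rewrite ?ltrDl//.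
  - by apply: integrableS iG.
  - by rewrite ltNyr.
  - exact: continuous_gauss_fun.
have idG : is_derive x 1 G (gauss_fun x) by apply: (DeriveDef dG); rewrite -derive1E G'.
rewrite (_ : @erfc R = fun y => 2 - 2 / sqrtpi * G y); last first.
  by apply/funext => y; rewrite erfcE.
apply: is_derive_eq.
by rewrite /GRing.scale/= /gauss_fun; ring.
Qed.

Lemma erfc_ge0 x : 0 <= erfc x.
Proof.
rewrite mulr_ge0 ?divr_ge0 ?(ltW sqrtpi_gt0)//.
by apply: Rintegral_ge0 => t _; exact: expR_ge0.
Qed.

Lemma erfc_opp x : erfc (- x) = 2 - erfc x.
Proof.
pose f y : R := erfc y + erfc (- y).
have df y : is_derive y 1 f 0.
  have d1 := is_derive_erfc y; have d2 := is_derive_erfc (- y).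
  have : is_derive y 1 (fun z => erfc (- z) : R) (2 / sqrtpi * expR (- y ^+ 2)).
    apply: (@is_derive_eq _ _ _ _ _ _ _ _ (is_derive1_comp d2 _)).
    rewrite sqrrN; ring.
  move=> d3; apply: is_derive_eq.
  ring.
have -> : erfc (- x) = f x - erfc x by rewrite /f; ring.
congr (_ - _).
have -> : f x = f 0 by exact: is_derive_0_is_cst.
have -> : f 0 = 2 * erfc 0 by rewrite /f oppr0; ring.
rewrite /erfc /Rintegral integral0y_gauss/=; field.
by rewrite gt_eqF.
Qed.

Lemma erfc_le2 x : erfc x <= 2.
Proof. by have := erfc_opp x; have := erfc_ge0 (- x); lra. Qed.

Lemma erfc_lip x y : x <= y -> erfc x - erfc y <= 2 * (y - x).
Proof.
rewrite le_eqVlt => /predU1P[->|xy]; first by rewrite !subrr mulr0.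
have [|c cxy] := @MVT _ (@erfc R) (fun z => - (2 / sqrtpi) * expR (- z ^+ 2)) x y xy (fun z _
  => is_derive_erfc z).
  apply: derivable_within_continuous => z _.
  by have := is_derive_erfc z => h.
move=> E; have -> : erfc x - erfc y = 2 / sqrtpi * expR (- c ^+ 2) * (y - x).
  by rewrite -opprB E; ring.
rewrite ler_wpM2r ?subr_ge0 ?(ltW xy)//.
rewrite -[leRHS]mulr1 ler_pM ?divr_ge0 ?expR_ge0 ?(ltW sqrtpi_gt0)//.
  by rewrite ler_pdivrMr// ler_peMr// sqrtpi_ge1.
by rewrite -expR0 ler_expR lerNl oppr0 sqr_ge0.
Qed.

(** On [a, +oo[ one has a exp(- t^2) <= t exp(- t^2), and the latter has the primitive - exp(- t^2)
    / 2. *)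
Lemma mul_erfc_le1 a : 0 <= a -> a * erfc a <= 1.
Proof.
move=> a0.
pose f t : R := t * gauss_fun t.
pose F t : R := - 2^-1 * gauss_fun t.
have dg (t : R) : is_derive t 1 (@gauss_fun R) (- 2 * t * gauss_fun t).
  rewrite /gauss_fun; apply: is_derive_eq.
  by rewrite /GRing.scale/=; ring.
have dF (t : R) : is_derive t 1 F (f t).
  have := dg t => h; apply: is_derive_eq.
  by rewrite /GRing.scale/= /f; field.
have cf : continuous f.
  by move=> t; apply: cvgM; [exact: cvg_id|exact: continuous_gauss_fun].
have IF : (\int[mu]_(t in `[a, +oo[) (f t)%:E = (0 - F a)%:E)%E.
  rewrite EFinB; apply: ge0_continuous_FTC2y.
  - by move=> t at_; rewrite mulr_ge0 ?gauss_fun_ge0// (le_trans a0).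
  - exact: continuous_subspaceT.
  - rewrite -[X in _ --> X](mulr0 (- 2^-1)).
    by apply: cvgM; [exact: cvg_cst|exact: cvg_gauss_fun].
  - by move=> t _; have := dF t => h.
  - apply: cvg_at_right_filter.
    by apply: cvgM; [exact: cvg_cst|exact: continuous_gauss_fun].
  - by move=> t _; have := dF t => h; rewrite derive1E derive_val.
have mf : measurable_fun (`[a, +oo[ : set R) f.
  by apply: measurable_funTS; exact: continuous_measurable_fun.
have iff : mu.-integrable `[a, +oo[ (EFin \o f).
  apply/integrableP; split; first exact/measurable_EFinP.
  rewrite (_ : (\int[mu]_(t in `[a, +oo[) _)%E = (\int[mu]_(t in `[a, +oo[) (f t)%:E)%E).
    by rewrite IF ltry.
  apply: eq_integral => t; rewrite inE/= in_itv/= andbT => at_; rewrite ger0_norm//.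
  by rewrite mulr_ge0 ?gauss_fun_ge0// (le_trans a0).
have iG : mu.-integrable `[a, +oo[ (EFin \o @gauss_fun R).
  exact: integrableS (@integrableT_gauss R).
have : \int[mu]_(t in `[a, +oo[) (a * gauss_fun t) <= \int[mu]_(t in `[a, +oo[) f t.
  apply: le_Rintegral => //.
  - rewrite (_ : _ \o _ = fun t => a%:E * (gauss_fun t)%:E)%E; last by [].
    exact: integrableZl.
  - by move=> t /=; rewrite in_itv/= andbT => at_; rewrite ler_wpM2r ?gauss_fun_ge0.
rewrite RintegralZl// [X in _ <= X -> _](_ : _ = gauss_fun a / 2); last first.
  by rewrite /Rintegral IF /F/=; ring.
rewrite /erfc => h; rewrite mulrCA.
apply: (@le_trans _ _ (2 / sqrtpi * (gauss_fun a / 2))).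
  by rewrite ler_wpM2l// divr_ge0// ltW.
have g1 := gauss_fun_le1 a; have s1 := sqrtpi_ge1.
rewrite [leLHS](_ : _ = gauss_fun a / sqrtpi); last by field; rewrite gt_eqF.
by rewrite ler_pdivrMr// mul1r (le_trans g1).
Qed.

End erfc_theory.

Section black_scholes.
Context {R : realType}.
Implicit Types t l x y : R.

(** The quantity d_1 of the Black-Scholes formula divided by sqrt 2, for spot l, strike 1 and total
    volatility sqrt 2 t. *)
Definition bs_p t l : R := ln l / (2 * t) + t / 2.

(* The Black-Scholes price E min(1, l e^(sZ - s^2/2)), Z standard normal, with
   t = s / sqrt 2. *)
Definition bs t l : R := 2^-1 * (l * erfc (bs_p t l) + erfc (t - bs_p t l)).

(** The second derivative of [bs t] in l. It also governs the derivative in t, which is 2 t l^2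
    times [bs_gamma t l]. *)
Definition bs_gamma t l : R :=
  - (expR (- bs_p t l ^+ 2 - ln l) / (2 * Num.sqrt pi * t)).

(** The identity behind the Greeks: the two terms that come from differentiating [bs_p] inside [bs]
    cancel. *)
Lemma bs_p_expR t l : 0 < t -> 0 < l ->
  l * expR (- bs_p t l ^+ 2) = expR (- (t - bs_p t l) ^+ 2).
Proof.
move=> t0 l0; rewrite -{1}(lnK l0) -expRD; congr expR.
by rewrite /bs_p; field; rewrite gt_eqF.
Qed.

Lemma bs1 t : 0 < t -> bs t 1 = erfc (t / 2).
Proof.
move=> t0; rewrite /bs /bs_p ln1 mul0r add0r mul1r.
by rewrite (_ : t - t / 2 = t / 2); field.
Qed.

(** The function min(1, l) has the same symmetry, so its approximation by [bs] needs proof only for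
    l <= 1. *)
Lemma bs_inv t l : 0 < t -> 0 < l -> bs t l = l * bs t l^-1.
Proof.
move=> t0 l0; rewrite /bs; have -> : bs_p t l^-1 = t - bs_p t l.
  by rewrite /bs_p lnV//; field; rewrite gt_eqF.
by rewrite subKr; field; rewrite gt_eqF.
Qed.

Lemma erfc_nincr x y : x <= y -> erfc y <= erfc x.
Proof.
rewrite le_eqVlt => /predU1P[->//|xy].
have [|c cxy] := @MVT _ (@erfc R) (fun z => - (2 / Num.sqrt pi) * expR (- z ^+ 2)) x y xy (fun
  z _ => is_derive_erfc z).
  apply: derivable_within_continuous => z _.
  by have := is_derive_erfc z => h.
move=> E; rewrite -subr_le0 E mulNr mulNr oppr_le0 !mulr_ge0 ?expR_ge0 ?invr_ge0 ?sqrtr_ge0//.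
by rewrite subr_ge0 ltW.
Qed.

(** Up to the Lipschitz bound for [erfc] the difference is (1 - l) erfc(a + t / 2) / 2. Here 1 - l
    <= - ln l = 2 t a, and a erfc(a) <= 1 removes the factor a, which is unbounded as l tends to
    0. *)
Let bs_approx1 t l : 0 < t -> 0 < l -> l <= 1 -> `|bs t l - l| <= t.
Proof.
move=> t0 l0 l1; pose a := - ln l / (2 * t).
have a0 : 0 <= a by rewrite divr_ge0 ?oppr_ge0 ?ln_le0// mulr_ge0// ltW.
have pE : bs_p t l = - (a - t / 2) by rewrite /bs_p /a; ring.
have tpE : t - bs_p t l = a + t / 2 by rewrite pE; field.
have -> : bs t l - l = 2^-1 * (erfc (a + t / 2) - l * erfc (a - t / 2)).
  by rewrite /bs tpE pE erfc_opp; field.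
have h1 : erfc (a + t / 2) <= erfc (a - t / 2) by apply: erfc_nincr; lra.
have h2 : erfc (a - t / 2) - erfc (a + t / 2) <= 2 * t.
  have := @erfc_lip R (a - t / 2) (a + t / 2); rewrite (_ : _ - (a - t / 2) = t); last by field.
  by apply; lra.
have e0 := erfc_ge0 (a - t / 2); have e1 := erfc_ge0 (a + t / 2).
have h3 : 1 - l <= 2 * t * a.
  have := le_ln1Dx (_ : -1 < l - 1); rewrite addrCA subrr addr0 => h.
  rewrite /a (_ : 2 * t * _ = - ln l); last by field; rewrite gt_eqF.
  by have := h ltac:(lra); lra.
have h4 : a * erfc (a + t / 2) <= 1.
  apply: le_trans (mul_erfc_le1 a0); rewrite ler_wpM2l// erfc_nincr//; lra.
have h5 : l * erfc (a - t / 2) <= erfc (a - t / 2) by rewrite ler_piMl.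
have h6 : l * erfc (a + t / 2) <= l * erfc (a - t / 2) by rewrite ler_wpM2l// ltW.
have h7 : (1 - l) * erfc (a + t / 2) <= 2 * t.
  apply: (@le_trans _ _ (2 * t * a * erfc (a + t / 2))); first by rewrite ler_wpM2r.
  by rewrite -mulrA ler_piMr// mulr_ge0// ltW.
by rewrite ler_norml; apply/andP; split; lra.
Qed.

Lemma bs_approx t l : 0 < t -> 0 < l -> `|bs t l - Num.min 1 l| <= t * (1 + l).
Proof.
move=> t0 l0; have [l1|l1] := leP 1 l.
  have li1 : l^-1 <= 1 by rewrite invf_le1.
  rewrite bs_inv// (_ : _ - 1 = l * (bs t l^-1 - l^-1)); last first.
    by field; rewrite gt_eqF.
  rewrite normrM gtr0_norm// (le_trans (ler_wpM2l (ltW l0) (bs_approx1 t0 _ li1))) ?invr_gt0//.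
  by rewrite mulrDr mulr1 mulrC lerDr ltW.
by rewrite (le_trans (bs_approx1 t0 l0 (ltW l1)))// mulrDr mulr1 lerDl mulr_ge0// ltW.
Qed.

Lemma expR_sqr_lip x y : `|expR (- x ^+ 2) - expR (- y ^+ 2)| <= 2 * `|x - y|.
Proof.
wlog xy : x y / `|x| <= `|y|.
  move=> h; have [/h//|/ltW/h] := leP `|x| `|y|.
  by rewrite distrC (distrC y).
have y2 : x ^+ 2 <= y ^+ 2.
  by rewrite -(real_normK (num_real x)) -(real_normK (num_real y)) ler_pXn2r ?nnegrE.
rewrite ger0_norm ?subr_ge0 ?ler_expR ?lerN2//.
have d1 : `|y| - `|x| <= `|x - y| by rewrite distrC lerB_dist.
set d := `|y| - `|x| in d1; have d0 : 0 <= d by rewrite subr_ge0.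
apply: (@le_trans _ _ (2 * d)); last by rewrite ler_wpM2l.
have ex1 : expR (- x ^+ 2) <= 1 by rewrite -expR0 ler_expR lerNl oppr0 sqr_ge0.
have [d_ge1|d_lt1] := leP 1 d.
  by have := expR_ge0 (- y ^+ 2); lra.
have -> : expR (- y ^+ 2) = expR (- x ^+ 2) * expR (- (y ^+ 2 - x ^+ 2)).
  by rewrite -expRD; congr expR; ring.
have h1 := expR_ge1Dx (- (y ^+ 2 - x ^+ 2)).
have h2 : y ^+ 2 - x ^+ 2 = d * (2 * `|x| + d).
  by rewrite -(real_normK (num_real x)) -(real_normK (num_real y)) /d; ring.
have h3 : 2 * `|x| * expR (- x ^+ 2) <= 1.
  rewrite expRN ler_pdivrMr ?expR_gt0// mul1r (le_trans _ (expR_ge1Dx _))//.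
  by rewrite -(real_normK (num_real x)); have := sqr_ge0 (`|x| - 1); lra.
apply: (@le_trans _ _ (expR (- x ^+ 2) * (y ^+ 2 - x ^+ 2))).
  rewrite -[X in X - _]mulr1 -mulrBr ler_wpM2l ?expR_ge0//; lra.
rewrite h2 mulrCA mulrC ler_wpM2r//.
rewrite mulrDr; have : expR (- x ^+ 2) * d <= 1 by rewrite mulr_ile1 ?expR_ge0// ltW.
lra.
Qed.

(** Completing the square absorbs the factor 1 / l. What remains is a Gaussian function of ln l,
    which gives bounds uniform in l. *)
Lemma bs_gammaE t l : 0 < t -> bs_gamma t l =
  - (expR (2 * t ^+ 2) / (2 * Num.sqrt pi * t)) *
  expR (- (ln l / (2 * t) + 3 * t / 2) ^+ 2).
Proof.
move=> t0; rewrite /bs_gamma.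
have -> : - bs_p t l ^+ 2 - ln l = 2 * t ^+ 2 - (ln l / (2 * t) + 3 * t / 2) ^+ 2.
  by rewrite /bs_p; field; rewrite gt_eqF.
by rewrite expRD; ring.
Qed.

Definition bs_gamma_bound t : R := expR (2 * t ^+ 2) / t.

Let gamma_const t : R := expR (2 * t ^+ 2) / (2 * Num.sqrt pi * t).

Let gamma_const_ge0 t : 0 < t -> 0 <= gamma_const t.
Proof.
by move=> t0; rewrite divr_ge0 ?expR_ge0// !mulr_ge0 ?sqrtr_ge0// ltW.
Qed.

Let gamma_const_le t : 0 < t -> gamma_const t <= bs_gamma_bound t.
Proof.
move=> t0; have s1 := @sqrtpi_ge1 R.
rewrite ler_wpM2l ?expR_ge0// lef_pV2 ?posrE ?mulr_gt0//; last lra.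
by rewrite ler_peMl ?(ltW t0)//; lra.
Qed.

Lemma bs_gamma_le t l : 0 < t -> 0 < l -> `|bs_gamma t l| <= bs_gamma_bound t.
Proof.
move=> t0 l0; rewrite bs_gammaE// normrM normrN.
rewrite (ger0_norm (gamma_const_ge0 t0)) (ger0_norm (expR_ge0 _)).
apply: le_trans (gamma_const_le t0).
by rewrite ler_piMr ?gamma_const_ge0// -expR0 ler_expR lerNl oppr0 sqr_ge0.
Qed.

(** [bs_gamma] is Lipschitz in ln l, and |ln l' - ln l| <= 2 |l' / l - 1| as long as l' / l > 1/2.
    For smaller ratios |l' / l - 1| >= 1/2, and the summand 4 covers twice the supremum. *)
Lemma bs_gamma_lip t l l' : 0 < t -> 0 < l -> 0 < l' ->
  `|bs_gamma t l' - bs_gamma t l| <= bs_gamma_bound t * (4 + 2 / t) * `|l' / l - 1|.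
Proof.
move=> t0 l0 l'0; set D := l' / l - 1.
have B0 : 0 <= bs_gamma_bound t by rewrite divr_ge0 ?expR_ge0// ltW.
have t20 : 0 <= 2 / t by rewrite divr_ge0// ltW.
have [D2|D2] := leP D (- 2^-1).
  have nD : 2^-1 <= `|D| by rewrite ler0_norm; lra.
  apply: (@le_trans _ _ (2 * bs_gamma_bound t)).
    rewrite (le_trans (ler_normB _ _))//.
    by have := bs_gamma_le t0 l0; have := bs_gamma_le t0 l'0; lra.
  rewrite (mulrC 2) -mulrA ler_wpM2l//.
  have : 0 <= 2 / t * `|D| by rewrite mulr_ge0.
  lra.
have lnD : `|ln l' - ln l| <= 2 * `|D|.
  have lE : l' = l * (1 + D) by rewrite /D; field; rewrite gt_eqF.
  have D1 : 0 < 1 + D by lra.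
  rewrite lE lnM ?posrE// addrAC subrr add0r.
  have u1 : ln (1 + D) <= D by apply: le_ln1Dx; lra.
  have u2 : - ln (1 + D) <= - D / (1 + D).
    rewrite -lnV ?posrE// [X in ln X](_ : _ = 1 + (- D / (1 + D))); last by field; rewrite gt_eqF.
    apply: le_ln1Dx; rewrite ltr_pdivlMr//; lra.
  have nD : D <= `|D| by exact: ler_norm.
  have nD' : - D <= `|D| by rewrite -normrN ler_norm.
  have [d0|d0] := leP 0 D.
    rewrite ger0_norm; first by rewrite (le_trans u1)//; lra.
    by apply: ln_ge0; lra.
  rewrite ltr0_norm; last by apply: ln_lt0; lra.
  rewrite (le_trans u2)// ler_pdivrMr//.
  have : 2^-1 * `|D| <= (1 + D) * `|D| by rewrite ler_wpM2r//; lra.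
  by lra.
rewrite !bs_gammaE// -mulrBr normrM normrN (ger0_norm (gamma_const_ge0 t0)).
rewrite -(mulrA (bs_gamma_bound t)).
apply: ler_pM; [exact: gamma_const_ge0|by []|exact: gamma_const_le|].
apply: (le_trans (expR_sqr_lip _ _)).
rewrite (_ : _ - _ = (ln l' - ln l) / (2 * t)); last by field; rewrite gt_eqF.
rewrite normrM (gtr0_norm (_ : 0 < (2 * t)^-1)) ?invr_gt0 ?mulr_gt0//.
have h : `|ln l' - ln l| * (2 * t)^-1 <= 2 * `|D| * (2 * t)^-1.
  by rewrite ler_wpM2r// invr_ge0 mulr_ge0// ltW.
apply: (le_trans (ler_wpM2l _ h)) => //.
rewrite [leLHS](_ : _ = 2 / t * `|D|); last by field; rewrite gt_eqF.
by rewrite ler_wpM2r// lerDr.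
Qed.

End black_scholes.
Section black_scholes_derivatives.
Context {R : realType}.
Implicit Types t l x y : R.

Local Notation sp := (Num.sqrt pi : R).
Let sp_gt0 : 0 < sp. Proof. by rewrite sqrtr_gt0 pi_gt0. Qed.

Lemma is_derive_bs (t l : R -> R) (dt dl u : R) : 0 < t u -> 0 < l u ->
  is_derive u 1 t dt -> is_derive u 1 l dl ->
  is_derive u 1 (fun u => bs (t u) (l u))
    (2^-1 * erfc (bs_p (t u) (l u)) * dl -
     sp^-1 * expR (- (t u - bs_p (t u) (l u)) ^+ 2) * dt).
Proof.
move=> t0 l0 dt' dl'.
(* The value of [pd] is left open because its two contributions cancel by [bs_p_expR]. *)
have [pd dp] : exists pd, is_derive u 1 (fun u => bs_p (t u) (l u)) pd.
  have dln := is_derive1_comp (is_derive1_ln l0) dl'.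
  have dZ : is_derive u 1 (fun u => 2 * t u) (2 *: dt) by exact: (is_deriveZ 2 dt').
  have n0 : 2 * t u != 0 by rewrite gt_eqF// mulr_gt0.
  have dV := @is_deriveV _ (fun u => 2 * t u) u _ _ n0 dZ.
  have dM := is_deriveM dln dV.
  have dZ2 := is_deriveZ 2^-1 dt'.
  have dD := is_deriveD dM dZ2.
  eexists; rewrite (_ : (fun u => bs_p (t u) (l u)) =
    (fun z => ln (l z) * (2 * t z)^-1 + 2^-1 * t z)); first exact: dD.
  by apply/funext => z; rewrite /bs_p (mulrC 2^-1).
have dq : is_derive u 1 (fun u => t u - bs_p (t u) (l u)) (dt - pd) by apply: is_deriveB.
have de1 := @is_derive1_comp _ (@erfc R) (fun u => bs_p (t u) (l u)) u _ _ (is_derive_erfc _) dp.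
have de2 := @is_derive1_comp _ (@erfc R) (fun u => t u - bs_p (t u) (l u)) u _ _
  (is_derive_erfc _) dq.
have dm := is_deriveM dl' de1.
have dD := is_deriveD dm de2.
have := is_deriveZ 2^-1 dD => dZ.
change (is_derive u 1 (fun u => bs (t u) (l u))) with (is_derive u 1 (fun z => 2^-1 *
  (l z * erfc (bs_p (t z) (l z)) + erfc (t z - bs_p (t z) (l z))))).
apply: is_derive_eq; rewrite /GRing.scale/= -(bs_p_expR t0 l0).
by field; rewrite gt_eqF.
Qed.

Lemma is_derive_bs_delta t l : 0 < t -> 0 < l ->
  is_derive l 1 (fun l => 2^-1 * erfc (bs_p t l)) (bs_gamma t l).
Proof.
move=> t0 l0.
have dp : is_derive l 1 (fun l => bs_p t l) (l^-1 / (2 * t)).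
  have dln := is_derive1_ln l0; rewrite /bs_p; apply: is_derive_eq.
  by rewrite /GRing.scale/=; field; rewrite !gt_eqF.
have de := @is_derive1_comp _ (@erfc R) (bs_p t) l _ _ (is_derive_erfc _) dp.
rewrite (_ : (fun _ => _) = (fun z => 2^-1 * (@erfc R \o bs_p t) z)); last by [].
apply: is_derive_eq; rewrite /GRing.scale/= /bs_gamma expRD (expRN (ln l)) lnK ?posrE//.
by field; rewrite !gt_eqF.
Qed.

Lemma measurable_erfc : measurable_fun setT (@erfc R).
Proof.
apply: continuous_measurable_fun => x.
apply: differentiable_continuous; apply/derivable1_diffP.
by have := is_derive_erfc x => h.
Qed.

Lemma measurable_bs_p t : measurable_fun setT (bs_p t : R -> R).
Proof.
by apply: measurable_funD => //; apply: measurable_funM.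
Qed.

Lemma measurable_bs t : measurable_fun setT (bs t : R -> R).
Proof.
apply: measurable_funM => //; apply: measurable_funD.
  apply: measurable_funM => //.
  by apply: (measurableT_comp measurable_erfc); exact: measurable_bs_p.
apply: (measurableT_comp measurable_erfc).
by apply: measurable_funB => //; exact: measurable_bs_p.
Qed.

Lemma measurable_bs_delta t : measurable_fun setT (fun l : R => 2^-1 * erfc (bs_p t l)).
Proof.
apply: measurable_funM => //.
by apply: (measurableT_comp measurable_erfc); exact: measurable_bs_p.
Qed.

Lemma measurable_bs_gamma t : measurable_fun setT (bs_gamma t : R -> R).
Proof.
apply: measurableT_comp => //; apply: measurable_funM => //.
apply: measurableT_comp => //; apply: measurable_funB; last exact: measurable_ln.
apply: measurableT_comp => //.
by apply: measurable_funX; exact: measurable_bs_p.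
Qed.

Lemma bs_le t l : 0 < l -> `|bs t l| <= l + 1.
Proof.
move=> l0.
have e1 := erfc_ge0 (bs_p t l); have e2 := erfc_le2 (bs_p t l).
have e3 := erfc_ge0 (t - bs_p t l); have e4 := erfc_le2 (t - bs_p t l).
have h1 : 0 <= l * erfc (bs_p t l) by rewrite mulr_ge0// ltW.
have h2 : l * erfc (bs_p t l) <= l * 2 by rewrite ler_wpM2l// ltW.
by rewrite /bs ger0_norm; lra.
Qed.

End black_scholes_derivatives.

(** * The cavity estimate *)

Section spin_average_expectation.
Local Opaque gexp wick expR.
Context {R : realType} (N n : nat) (gam : probability (n.-tuple R) R).
Hypothesis gamE : iid_normal gam.
Local Notation EX := (gexp gam).

Lemma tame_savg (F : spins N -> n.-tuple R -> R) : (forall x, tame (F x)) ->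
  tame (fun w => savg (fun x => F x w)).
Proof. by move=> tF; apply: tameZ; exact: tame_sum. Qed.

Lemma gexp_savg (F : spins N -> n.-tuple R -> R) : (forall x, tame (F x)) ->
  EX (fun w => savg (fun x => F x w)) = savg (fun x => EX (F x)).
Proof.
move=> tF; rewrite gexpZ//; last exact: tame_sum.
by rewrite gexp_sum.
Qed.

End spin_average_expectation.

(** The likelihood ratio L_u with kap = u / sqrt N. *)
Definition lr {R : realType} (N n : nat) (e1 e2 : 'I_n -> 'I_N) (kap : R)
  (w : n.-tuple R) : R := savg (fun x => wick (theta e1 e2 kap (spin x)) w).

Section cavity.
Context {R : realType} (N n : nat) (e1 e2 : 'I_n -> 'I_N).
Hypothesis eP : enumerates_pairs (R := R) e1 e2.
Variables (gam : probability (n.-tuple R) R) (kap : R) (o : 'I_N).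
Hypothesis gamE : iid_normal gam.
Local Notation EX := (gexp gam).
Implicit Types (x y z : spins N) (w : n.-tuple R).

(** Removal of the vertex [o]. Below, [tho], [Wo], [Lo] and [rho] are the signal, Wick exponential,
    likelihood ratio and overlap without [o]. By [dotE], restoring [o] adds kap^2 eta rho to the
    inner product of two replicas. *)
Let off (v : 'I_N -> R) (i : 'I_N) : R := if i == o then 0 else v i.
Let th x : 'I_n -> R := theta e1 e2 kap (spin x).
Let tho x : 'I_n -> R := theta e1 e2 kap (off (spin x)).
Let W x w : R := wick (th x) w.
Let Wo x w : R := wick (tho x) w.
Let Lo w : R := savg (fun x => Wo x w).
Let L w : R := lr e1 e2 kap w.
Let rho x y : R := overlap (fun i => i != o) x y.
Let eta x y : R := spin x o * spin y o.

Let etaC x y : eta x y = eta y x. Proof. exact: mulrC. Qed.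
Let rhoC x y : rho x y = rho y x.
Proof. by apply: eq_bigr => i _; rewrite mulrC. Qed.

Let overlapE x y : overlap xpredT x y = eta x y + rho x y.
Proof. by rewrite /overlap (bigD1 o). Qed.

Let eta_sq x y : eta x y ^+ 2 = 1.
Proof. by rewrite /eta exprMn !sqr_spin mulr1. Qed.

Let off_flip x : off (spin (flip o x)) = off (spin x).
Proof. by apply/funext => i; rewrite /off spin_flip; case: eqP. Qed.

Let Wo_flip x : Wo (flip o x) = Wo x.
Proof. by rewrite /Wo /tho off_flip. Qed.

Let rho_flip x y : rho (flip o x) y = rho x y.
Proof. by apply: eq_bigr => i /negbTE io; rewrite spin_flip io. Qed.

Let eta_flip x y : eta (flip o x) y = - eta x y.
Proof. by rewrite /eta spin_flip eqxx mulNr. Qed.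

Let dot_full x y : \sum_k th x k * th y k = kap ^+ 2 * (overlap xpredT x y ^+ 2 - N%:R) / 2.
Proof.
rewrite theta_dot// mulrA; congr (_ * (_ ^+ 2 - _) / 2).
under eq_bigr => i _ do rewrite exprMn !sqr_spin mulr1.
by rewrite sumr_const card_ord.
Qed.

Let sum_off x y : \sum_i (off (spin x) i * off (spin y) i) ^+ 2 = N%:R - 1.
Proof.
rewrite (bigD1 o)//= /off eqxx mul0r expr0n add0r.
under eq_bigr => i /negbTE io do rewrite io exprMn !sqr_spin mulr1.
rewrite sumr_const cardC1 card_ord -subn1 natrB//.
exact: leq_ltn_trans (ltn_ord o).
Qed.

Let sum_off1 x y : \sum_i off (spin x) i * off (spin y) i = rho x y.
Proof.
rewrite (bigD1 o)//= /off eqxx mul0r add0r.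
by apply: eq_bigr => i /negbTE ->.
Qed.

Let dot_off x y : \sum_k tho x k * tho y k = kap ^+ 2 * (rho x y ^+ 2 - (N%:R - 1)) / 2.
Proof. by rewrite theta_dot// sum_off sum_off1 mulrA. Qed.

Let agree (t t' : 'I_n -> R) := forall k, e1 k != o -> e2 k != o -> t k = t' k.

Let tho_agree x : agree (th x) (tho x).
Proof. by move=> k /negbTE h1 /negbTE h2; rewrite /th /tho /theta /off h1 h2. Qed.

Let tho_mul x (t t' : 'I_n -> R) : agree t t' -> forall k, tho x k * t k = tho x k * t' k.
Proof.
move=> tt k; have := tt k; rewrite /tho /theta /off.
case: eqP => [_ _|_]; first by rewrite mulr0 !mul0r.
by case: eqP => [_ _|_ /(_ isT isT) ->//]; rewrite mulr0 !mul0r.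
Qed.

Let dot_half x y : \sum_k th x k * tho y k = kap ^+ 2 * (rho x y ^+ 2 - (N%:R - 1)) / 2.
Proof.
rewrite -dot_off; apply: eq_bigr => k _.
by rewrite mulrC (tho_mul y (tho_agree x)) mulrC.
Qed.

Let dotE x y : \sum_k th x k * th y k = \sum_k tho x k * tho y k + kap ^+ 2 * eta x y * rho x y.
Proof.
rewrite dot_full dot_off overlapE sqrrD eta_sq -mulr_natr.
by field.
Qed.

(** Expresses, without conditional expectations, that [f] ignores the noise on the edges at [o].
    Through Cameron-Martin, [gexp_row] then allows any change of a Wick exponential on these edges,
    which amounts to integrating them out. *)
Let row_inv (f : n.-tuple R -> R) := forall t t' w, agree t t' -> f (tshift t w) = f (tshift t' w).

Let Lo_row_inv (g : R -> R) : row_inv (fun w => g (Lo w)).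
Proof.
move=> t t' w tt.
have WoE x : Wo x (tshift t w) = Wo x (tshift t' w).
  rewrite /Wo !wick_shift; congr (expR _ * _).
  by apply: eq_bigr => k _; exact: tho_mul.
by rewrite (_ : Lo (tshift t w) = Lo (tshift t' w))//; exact: eq_savg.
Qed.

Let gexp_row f t t' : tame f -> row_inv f -> agree t t' ->
  EX (fun w => f w * wick t w) = EX (fun w => f w * wick t' w).
Proof.
move=> tf rf tt; rewrite -!(gexp_shift gamE)//.
by congr EX; apply/funext => w; exact: rf.
Qed.

(** Integrating out the edges at [o] removes the vertex from both replicas and leaves the
    exponential of its share of their inner product. *)
Let gexp_off2 f x y : tame f -> row_inv f ->
  EX (fun w => f w * (W x w * W y w)) =
  expR (kap ^+ 2 * eta x y * rho x y) * EX (fun w => f w * (Wo x w * Wo y w)).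
Proof.
move=> tf rf.
have dot2 (t1 t2 : 'I_n -> R) : EX (fun w => f w * (wick t1 w * wick t2 w)) =
    expR (\sum_k t1 k * t2 k) * EX (fun w => f w * wick (fun k => t1 k + t2 k) w).
  rewrite -(gexpZ gamE _ (tameM tf (tame_wick _))).
  by congr EX; apply/funext => w; rewrite wick_dot mulrCA.
rewrite (dot2 (th x) (th y)) (dot2 (tho x) (tho y)) dotE expRD -mulrA mulrCA; congr (_ * (_ * _)).
by apply: gexp_row => // k h1 h2; congr (_ + _); exact: tho_agree.
Qed.

Let wick4 m (t1 t2 t3 t4 : 'I_m -> R) (w : m.-tuple R) :
  wick t1 w * wick t2 w * (wick t3 w * wick t4 w) =
  expR (\sum_k t1 k * t2 k + \sum_k t3 k * t4 k + \sum_k t1 k * t3 k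
      + \sum_k t1 k * t4 k + \sum_k t2 k * t3 k + \sum_k t2 k * t4 k) *
  wick (fun k => t1 k + t2 k + (t3 k + t4 k)) w.
Proof.
rewrite (wick_dot t1 t2) (wick_dot t3 t4) mulrACA (wick_dot (fun k => t1 k + t2 k)) mulrA.
congr (_ * _); rewrite -!expRD; congr expR; rewrite -!addrA; congr (_ + (_ + _)).
rewrite -!big_split/=; apply: eq_bigr => k _; ring.
Qed.

Let gexp_off4 f x1 x2 x3 x4 : tame f -> row_inv f ->
  EX (fun w => f w * (W x1 w * W x2 w * (W x3 w * W x4 w))) =
  expR (kap ^+ 2 * (eta x1 x2 * rho x1 x2 + eta x3 x4 * rho x3 x4 + eta x1 x3 * rho x1 x3
      + eta x1 x4 * rho x1 x4 + eta x2 x3 * rho x2 x3 + eta x2 x4 * rho x2 x4)) *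
  EX (fun w => f w * (Wo x1 w * Wo x2 w * (Wo x3 w * Wo x4 w))).
Proof.
move=> tf rf.
have dot4 (t1 t2 t3 t4 : 'I_n -> R) :
    EX (fun w => f w * (wick t1 w * wick t2 w * (wick t3 w * wick t4 w))) =
    expR (\sum_k t1 k * t2 k + \sum_k t3 k * t4 k + \sum_k t1 k * t3 k
      + \sum_k t1 k * t4 k + \sum_k t2 k * t3 k + \sum_k t2 k * t4 k) *
    EX (fun w => f w * wick (fun k => t1 k + t2 k + (t3 k + t4 k)) w).
  rewrite -(gexpZ gamE _ (tameM tf (tame_wick _))).
  by congr EX; apply/funext => w; rewrite wick4 mulrCA.
rewrite (dot4 (th x1) (th x2) (th x3) (th x4)) (dot4 (tho x1) (tho x2) (tho x3) (tho x4)) mulrA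
  -expRD; congr (expR _ * _).
  by rewrite !dotE; ring.
by apply: gexp_row => // k h1 h2; congr (_ + _ + (_ + _)); exact: tho_agree.
Qed.

Let tW x : tame (W x). Proof. exact: tame_wick. Qed.
Let tWo x : tame (Wo x). Proof. exact: tame_wick. Qed.
Let tL : tame L. Proof. exact: tame_savg. Qed.
Let tLo : tame Lo. Proof. exact: tame_savg. Qed.

Let L_gt0 w : 0 < L w. Proof. by apply: savg_gt0 => x; exact: wick_gt0. Qed.
Let Lo_gt0 w : 0 < Lo w. Proof. by apply: savg_gt0 => x; exact: wick_gt0. Qed.

Let tLoV : tame (fun w => (Lo w)^-1).
Proof.
apply: (@tame_inv _ _ Lo (2 ^+ N)^-1 (tho [ffun=> true])) => //.
- by case: tLo.
move=> w; rewrite /Lo /savg ler_wpM2l ?invr_ge0 ?exprn_ge0//.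
rewrite (bigD1 [ffun=> true])//= lerDl sumr_ge0// => x _.
exact/ltW/wick_gt0.
Qed.

Variable C : R.
Hypothesis C0 : 0 < C.
Hypothesis momC : forall P : pred 'I_N,
  savg (fun x => savg (fun y => (N%:R ^+ 2 + overlap P x y ^+ 4) *
    expR (kap ^+ 2 * overlap P x y ^+ 2 / 2))) <= C * N%:R ^+ 2.
Hypothesis kapN : kap ^+ 2 * N%:R <= 1.

(** Averaged over the vertices [o], this is (1 - u^2) B - L^2 with u^2 = kap^2 N, up to a term whose
    contribution is of order 1 / N. *)
Let X w : R := savg (fun x => savg (fun y =>
  rho x y * (eta x y - kap ^+ 2 * rho x y) * (W x w * W y w))).

Let tX : tame X.
Proof.
by apply: tame_savg => x; apply: tame_savg => y; apply: tameZ; exact: tameM.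
Qed.

Let N_gt0 : 0 < N%:R :> R.
Proof. by rewrite ltr0n (leq_ltn_trans _ (ltn_ord o)). Qed.

Let sN : R := Num.sqrt N%:R.
Let sN_gt0 : 0 < sN. Proof. by rewrite sqrtr_gt0. Qed.
Let sN_sq : sN ^+ 2 = N%:R. Proof. by rewrite sqr_sqrtr// ltW. Qed.

Let kap2_ge0 : 0 <= kap ^+ 2. Proof. exact: sqr_ge0. Qed.

Let kap4 : kap ^+ 4 * N%:R ^+ 2 <= 1.
Proof.
rewrite (_ : kap ^+ 4 = (kap ^+ 2) ^+ 2); last by rewrite -exprM.
by rewrite -exprMn exprn_ile1// mulr_ge0.
Qed.

Let rho_le x y : `|rho x y| <= N%:R.
Proof.
rewrite (le_trans (ler_norm_sum _ _ _))//.
apply: (@le_trans _ _ (\sum_(i < N | i != o) 1)).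
  by apply: ler_sum => i _; rewrite normrM /spin !normr_sign mulr1.
by rewrite sumr_const ler_nat cardC1 card_ord leq_pred.
Qed.

Let r x y : R := kap ^+ 2 * rho x y.
Let r_le x y : `|r x y| <= 1.
Proof.
rewrite normrM ger0_norm// (le_trans _ kapN)//.
by rewrite ler_wpM2l// rho_le.
Qed.

Let norm_eta x y : `|eta x y| = 1.
Proof. by rewrite normrM /spin !normr_sign mulr1. Qed.

Let mom x y : R := (N%:R ^+ 2 + rho x y ^+ 4) * expR (kap ^+ 2 * rho x y ^+ 2 / 2).

Let gexp_WoWo x y : EX (fun w => Wo x w * Wo y w) = expR (\sum_k tho x k * tho y k).
Proof.
transitivity (EX (fun w => expR (\sum_k tho x k * tho y k) * wick (fun k => tho x k + tho y k) w)).
  by congr EX; apply/funext => w; rewrite -wick_dot.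
rewrite gexpZ//; last exact: tame_wick.
by rewrite gexp_wick// mulr1.
Qed.

Let dot_off_le x y : expR (\sum_k tho x k * tho y k) <= expR (kap ^+ 2 * rho x y ^+ 2 / 2).
Proof.
rewrite dot_off ler_expR ler_pM2r// ler_wpM2l// gerBl subr_ge0.
by rewrite -[1]/(1%:R) ler_nat (leq_ltn_trans _ (ltn_ord o)).
Qed.

Let savg2_mom (f : spins N -> spins N -> R) (a : R) : 0 <= a ->
  (forall x y, f x y <= a * mom x y) -> savg (fun x => savg (f x)) <= a * C * N%:R ^+ 2.
Proof.
move=> a0 fm; apply: (@le_trans _ _ (savg (fun x => savg (fun y => a * mom x y)))).
  by apply: le_savg => x; exact: le_savg.
under eq_savg do rewrite savgZ.
by rewrite savgZ -mulrA ler_wpM2l// momC.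
Qed.

(** Integrating out the edges at [o] leaves rho eta (1 - v) e^v with v = eta r, because eta^2 = 1.
    The leading term rho eta is odd in the spin at [o], and (1 - v) e^v has no linear term, so the
    rest is cubic in the overlap. *)
Let cavity_main (g : R -> R) (c0 : R) : measurable_fun setT g ->
  (forall l, 0 < l -> `|g l| <= c0) ->
  `|EX (fun w => g (Lo w) * X w)| <= 2 * expR 1 * c0 * C / sN.
Proof.
move=> mg gc.
have c00 : 0 <= c0 by apply: le_trans (gc 1 ltr01).
have tg : tame (fun w => g (Lo w)).
  apply: (@tame_bounded _ _ _ c0); last by move=> w; exact: gc.
  by apply: (measurableT_comp mg); case: tLo.
pose G x y := EX (fun w => g (Lo w) * (Wo x w * Wo y w)).
have GE x y : `|G x y| <= c0 * expR (kap ^+ 2 * rho x y ^+ 2 / 2).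
  have tWW := tameM (tWo x) (tWo y).
  rewrite (le_trans (le_normr_gexp gamE (tameM tg tWW)))//.
  apply: (@le_trans _ _ (EX (fun w => c0 * (Wo x w * Wo y w)))).
    apply: le_gexp => //; [exact/tame_norm/tameM|exact: tameZ|move=> w].
    rewrite normrM (ger0_norm (mulr_ge0 (ltW (wick_gt0 _ _)) (ltW (wick_gt0 _ _)))).
    by rewrite ler_wpM2r ?gc// mulr_ge0// ltW// wick_gt0.
  by rewrite gexpZ// gexp_WoWo ler_wpM2l// dot_off_le.
have Gflip x y : G (flip o x) y = G x y by rewrite /G Wo_flip.
have -> : EX (fun w => g (Lo w) * X w) = savg (fun x => savg (fun y =>
    rho x y * (eta x y - kap ^+ 2 * rho x y) * (expR (eta x y * r x y) * G x y))).
  transitivity (EX (fun w => savg (fun x => savg (fun y =>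
     rho x y * (eta x y - kap ^+ 2 * rho x y) * (g (Lo w) * (W x w * W y w)))))).
    congr EX; apply/funext => w; rewrite /X -savgZ; apply: eq_savg => x.
    by rewrite -savgZ; apply: eq_savg => y; rewrite mulrCA.
  rewrite (gexp_savg gamE); last first.
    by move=> x; apply: tame_savg => y; apply: tameZ; apply: tameM => //; exact: tameM.
  apply: eq_savg => x; rewrite (gexp_savg gamE); last first.
    by move=> y; apply: tameZ; apply: tameM => //; exact: tameM.
  apply: eq_savg => y; rewrite gexpZ//; last by apply: tameM => //; exact: tameM.
  rewrite (gexp_off2 x y tg (Lo_row_inv g)).
  by congr (_ * (expR _ * _)); rewrite /r; ring.
pose h x y := rho x y * eta x y * ((1 - eta x y * r x y) * expR (eta x y * r x y) - 1) * G x y.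
rewrite (_ : savg _ = savg (fun x => savg (h x))); last first.
  rewrite -[LHS]subr0 -[X in _ - X](_ : savg (fun x => savg (fun y => rho x y * eta x y * G x
    y)) = 0); last first.
    apply: (@savg_odd _ _ o) => x; rewrite -savgN; apply: eq_savg => y.
    by rewrite rho_flip eta_flip Gflip mulrN mulNr.
  rewrite -savgB; apply: eq_savg => x; rewrite -savgB; apply: eq_savg => y.
  have eta2 := eta_sq x y; rewrite /h /r.
  rewrite (_ : rho x y * (eta x y - kap ^+ 2 * rho x y) =
     rho x y * (eta x y - eta x y ^+ 2 * kap ^+ 2 * rho x y)); last by rewrite eta2 mul1r.
  by ring.
apply: (@le_trans _ _ (savg (fun x => savg (fun y => `|h x y|)))).
  apply: (le_trans (ler_norm_savg _)); apply: le_savg => x; exact: ler_norm_savg.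
pose a := 2 * expR 1 * c0 * kap ^+ 4 / sN.
have a0 : 0 <= a.
  have k40 : 0 <= kap ^+ 4 by rewrite exprn_even_ge0.
  apply: divr_ge0; last exact: ltW.
  by apply: mulr_ge0 => //; apply: mulr_ge0 => //; rewrite mulr_ge0// expR_ge0.
apply: (@le_trans _ _ (a * C * N%:R ^+ 2)).
  apply: savg2_mom => // x y; rewrite /h; set u := eta x y * r x y.
  have nu : `|u| = `|r x y| by rewrite normrM norm_eta mul1r.
  have u1 : `|u| <= 1 by rewrite nu.
  have u2 : u ^+ 2 = kap ^+ 4 * rho x y ^+ 2.
    by rewrite /u exprMn eta_sq mul1r /r exprMn -exprM.
  clearbody u.
  have eu : expR `|u| <= expR 1 by rewrite ler_expR.
  have hu : `|(1 - u) * expR u - 1| <= 2 * expR 1 * u ^+ 2.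
    rewrite (_ : _ - 1 = (expR u - 1 - u) - u * (expR u - 1)); last by ring.
    rewrite (le_trans (ler_normB _ _))//.
    have := expR_taylor2 u; have := expR_sub1_le u; rewrite (normrM u) => h1 h2.
    have h3 : `|u| * `|expR u - 1| <= u ^+ 2 * expR 1.
      rewrite -(real_normK (num_real u)) expr2 -mulrA ler_wpM2l//.
      by apply: le_trans h1 _; rewrite ler_wpM2l.
    have h4 : u ^+ 2 * expR `|u| <= u ^+ 2 * expR 1 by rewrite ler_wpM2l// sqr_ge0.
    by lra.
  rewrite (normrM _ (G x y)) (normrM _ (_ - 1)) (normrM (rho x y)) norm_eta mulr1.
  (* The overlap lives on the scale sqrt N. Compared with the moment weight, a cubic term has a
     factor sqrt N to spare, which is the rate of the whole estimate. *)
  have r3 : `|rho x y| * rho x y ^+ 2 * sN <= N%:R ^+ 2 + rho x y ^+ 4.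
    rewrite -sN_sq -exprM.
    rewrite -[rho x y ^+ 2](real_normK (num_real _)).
    rewrite (_ : rho x y ^+ 4 = `|rho x y| ^+ 4); last first.
      by rewrite (exprM _ 2 2) -[rho x y ^+ 2](real_normK (num_real _)) -exprM.
    have := normr_ge0 (rho x y); move: `|rho x y| => b b0.
    have [bs|/ltW sb] := leP b sN.
      have : b * b ^+ 2 * sN <= sN * sN ^+ 2 * sN.
        rewrite ler_wpM2r ?(ltW sN_gt0)// ler_pM ?exprn_ge0//.
        by rewrite ler_pXn2r ?nnegrE// ltW.
      have : 0 <= b ^+ 4 by rewrite exprn_ge0.
      by rewrite (_ : sN * sN ^+ 2 * sN = sN ^+ 4); [lra|ring].
    have : b * b ^+ 2 * sN <= b * b ^+ 2 * b by rewrite ler_wpM2l ?mulr_ge0 ?exprn_ge0.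
    have : 0 <= sN ^+ 4 by rewrite exprn_ge0// ltW.
    by rewrite (_ : b * b ^+ 2 * b = b ^+ 4); [lra|ring].
  apply: (@le_trans _ _ (`|rho x y| * (2 * expR 1 * u ^+ 2) * (c0 * expR (kap ^+ 2 * rho x y ^+
    2 / 2)))).
    by rewrite ler_pM ?mulr_ge0 ?ler_wpM2l.
  rewrite u2 /a /mom.
  rewrite [leLHS](_ : _ = (2 * expR 1 * c0 * kap ^+ 4 / sN * expR (kap ^+ 2 * rho x y ^+ 2 /
    2)) * (`|rho x y| * rho x y ^+ 2 * sN)); last by field; rewrite gt_eqF.
  rewrite [leRHS](_ : _ = (2 * expR 1 * c0 * kap ^+ 4 / sN * expR (kap ^+ 2 * rho x y ^+ 2 /
    2)) * (N%:R ^+ 2 + rho x y ^+ 4)); last by ring.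
  by rewrite ler_wpM2l// mulr_ge0// expR_ge0.
rewrite /a (_ : _ * _ * _ = 2 * expR 1 * c0 * C / sN * (kap ^+ 4 * N%:R ^+ 2)); last by ring.
by rewrite ler_piMr// !mulr_ge0 ?invr_ge0 ?expR_ge0// ltW.
Qed.

Let sq_savg (f : spins N -> R) : savg f ^+ 2 = savg (fun x => savg (fun y => f x * f y)).
Proof.
by rewrite expr2 -savgZr; apply: eq_savg => x; rewrite savgZ.
Qed.

(** By [dot_half] a product of [W] and [Wo] has the same mean as a product of two [Wo], so e^(eta r)
    - 1 factors out. Its linear term is odd in the spin at [o]; the remainder kap^4 rho^2 is of
    order 1 / N. *)
Let cavity_sq_diff : EX (fun w => (L w - Lo w) ^+ 2) <= expR 1 * C / N%:R.
Proof.
have tD x : tame (fun w => W x w - Wo x w) by exact: tameB.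
have -> : EX (fun w => (L w - Lo w) ^+ 2) = savg (fun x => savg (fun y =>
   expR (\sum_k tho x k * tho y k) * (expR (eta x y * r x y) - 1))).
  transitivity (EX (fun w => savg (fun x => savg (fun y =>
     (W x w - Wo x w) * (W y w - Wo y w))))).
    by congr EX; apply/funext => w; rewrite -sq_savg savgB.
  rewrite (gexp_savg gamE); last by move=> x; apply: tame_savg => y; exact: tameM.
  apply: eq_savg => x; rewrite (gexp_savg gamE); last by move=> y; exact: tameM.
  apply: eq_savg => y.
  have EW (t1 t2 : 'I_n -> R) : EX (fun w => wick t1 w * wick t2 w) = expR (\sum_k t1 k * t2 k).
    transitivity (EX (fun w => expR (\sum_k t1 k * t2 k) * wick (fun k => t1 k + t2 k) w)).
      by congr EX; apply/funext => w; rewrite -wick_dot.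
    by rewrite gexpZ ?gexp_wick ?mulr1//; exact: tame_wick.
  transitivity (EX (fun w => (W x w * W y w - W x w * Wo y w) - (Wo x w * W y w - Wo x w * Wo y
    w))).
    by congr EX; apply/funext => w; ring.
  have tWW (t1 t2 : 'I_n -> R) : tame (fun w => wick t1 w * wick t2 w).
    by apply: tameM; exact: tame_wick.
  rewrite (gexpB gamE (tameB (tWW _ _) (tWW _ _)) (tameB (tWW _ _) (tWW _ _))).
  rewrite !(gexpB gamE (tWW _ _) (tWW _ _)).
  rewrite !EW dotE dot_half (_ : \sum_k tho x k * th y k = \sum_k th y k * tho x k); last first.
    by apply: eq_bigr => k _; rewrite mulrC.
  rewrite dot_half (rhoC y x) dot_off expRD /r.
  rewrite (_ : kap ^+ 2 * eta x y * rho x y = eta x y * (kap ^+ 2 * rho x y)); last by ring.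
  by ring.
pose h x y := expR (\sum_k tho x k * tho y k) * (expR (eta x y * r x y) - 1 - eta x y * r x y).
rewrite (_ : savg _ = savg (fun x => savg (h x))); last first.
  rewrite -[LHS]subr0 -[X in _ - X](_ : savg (fun x => savg (fun y => expR (\sum_k tho x k *
    tho y k) * (eta x y * r x y))) = 0); last first.
    apply: (@savg_odd _ _ o) => x; rewrite -savgN; apply: eq_savg => y.
    by rewrite /r rho_flip eta_flip /tho off_flip mulNr mulrN.
  rewrite -savgB; apply: eq_savg => x; rewrite -savgB; apply: eq_savg => y.
  by rewrite /h; ring.
pose a := expR 1 * kap ^+ 4 / N%:R.
have k40 : 0 <= kap ^+ 4 by rewrite exprn_even_ge0.
have a0 : 0 <= a.
  by apply: divr_ge0; [apply: mulr_ge0 => //; exact: expR_ge0|exact: ltW].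
apply: (@le_trans _ _ (a * C * N%:R ^+ 2)).
  apply: savg2_mom => // x y; rewrite /h.
  have u1 : `|eta x y * r x y| <= 1 by rewrite normrM norm_eta mul1r.
  have u2 : (eta x y * r x y) ^+ 2 = kap ^+ 4 * rho x y ^+ 2.
    by rewrite exprMn eta_sq mul1r /r exprMn -exprM.
  move: (eta x y * r x y) u1 u2 => u u1 u2.
  have hu : expR u - 1 - u <= kap ^+ 4 * rho x y ^+ 2 * expR 1.
    apply: le_trans (ler_norm _) _; apply: (le_trans (expR_taylor2 u)).
    by rewrite u2 ler_wpM2l ?ler_expR// mulr_ge0// sqr_ge0.
  apply: (@le_trans _ _ (expR (kap ^+ 2 * rho x y ^+ 2 / 2) * (kap ^+ 4 * rho x y ^+ 2 * expR 1))).
    apply: (le_trans (ler_wpM2l (expR_ge0 _) hu)).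
    by rewrite ler_wpM2r ?dot_off_le// mulr_ge0 ?expR_ge0// mulr_ge0 ?sqr_ge0.
  have r2 : rho x y ^+ 2 * N%:R <= N%:R ^+ 2 + rho x y ^+ 4.
    rewrite (exprM _ 2 2); nra.
  rewrite /a /mom [leLHS](_ : _ = expR (kap ^+ 2 * rho x y ^+ 2 / 2) * (kap ^+ 4 * expR 1 /
    N%:R) * (rho x y ^+ 2 * N%:R)); last by field; rewrite gt_eqF.
  rewrite [leRHS](_ : _ = expR (kap ^+ 2 * rho x y ^+ 2 / 2) * (kap ^+ 4 * expR 1 / N%:R) *
    (N%:R ^+ 2 + rho x y ^+ 4)); last by ring.
  rewrite ler_wpM2l// mulr_ge0 ?expR_ge0// divr_ge0 ?(ltW N_gt0)//.
  by apply: mulr_ge0; rewrite ?expR_ge0.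
rewrite /a (_ : _ * _ * _ = expR 1 * C / N%:R * (kap ^+ 4 * N%:R ^+ 2)); last by ring.
rewrite ler_piMr// divr_ge0 ?(ltW N_gt0)// mulr_ge0 ?expR_ge0//.
exact: ltW.
Qed.

Let savg4 (F : spins N -> spins N -> spins N -> spins N -> R) : R :=
  savg (fun x1 => savg (fun x2 => savg (fun x3 => savg (fun x4 => F x1 x2 x3 x4)))).

Let eq_savg4 F G : (forall x1 x2 x3 x4, F x1 x2 x3 x4 = G x1 x2 x3 x4) -> savg4 F = savg4 G.
Proof.
move=> FG; apply: eq_savg => x1; apply: eq_savg => x2; apply: eq_savg => x3.
by apply: eq_savg => x4.
Qed.

Let savg4_swap12 F : savg4 F = savg4 (fun x1 x2 x3 x4 => F x2 x1 x3 x4).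
Proof. exact: savg_exchange. Qed.

Let savg4_swap23 F : savg4 F = savg4 (fun x1 x2 x3 x4 => F x1 x3 x2 x4).
Proof. by apply: eq_savg => x1; exact: savg_exchange. Qed.

Let savg4_swap34 F : savg4 F = savg4 (fun x1 x2 x3 x4 => F x1 x2 x4 x3).
Proof. by apply: eq_savg => x1; apply: eq_savg => x2; exact: savg_exchange. Qed.

Let tLoV2 : tame (fun w => (Lo w)^-1 ^+ 2). Proof. exact: tameX. Qed.

(** The four-replica weight without [o]. Thanks to the division by the square of [Lo], averaging out
    any two replicas leaves the plain two-replica weight. *)
Let H x1 x2 x3 x4 : R :=
  EX (fun w => (Lo w)^-1 ^+ 2 * (Wo x1 w * Wo x2 w * (Wo x3 w * Wo x4 w))).

Let H_ge0 x1 x2 x3 x4 : 0 <= H x1 x2 x3 x4.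
Proof.
apply: gexp_ge0 => w; rewrite mulr_ge0 ?sqr_ge0//.
by rewrite !mulr_ge0// ltW// wick_gt0.
Qed.

Let H12 x1 x2 x3 x4 : H x2 x1 x3 x4 = H x1 x2 x3 x4.
Proof. by congr EX; apply/funext => w; ring. Qed.
Let H23 x1 x2 x3 x4 : H x1 x3 x2 x4 = H x1 x2 x3 x4.
Proof. by congr EX; apply/funext => w; ring. Qed.
Let H34 x1 x2 x3 x4 : H x1 x2 x4 x3 = H x1 x2 x3 x4.
Proof. by congr EX; apply/funext => w; ring. Qed.

Let tW4 x1 x2 x3 x4 : tame (fun w => Wo x1 w * Wo x2 w * (Wo x3 w * Wo x4 w)).
Proof. by apply: tameM; exact: tameM. Qed.

(** Averaging over x3 and x4 produces the square of [Lo], which cancels the weight; only a second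
    moment remains. The other five pairs follow by permuting the replicas. *)
Let rho4_12 : savg4 (fun x1 x2 x3 x4 => rho x1 x2 ^+ 4 * H x1 x2 x3 x4) <= C * N%:R ^+ 2.
Proof.
rewrite -[C]mul1r; apply: savg2_mom => // x y.
have -> : savg (fun x3 => savg (fun x4 => rho x y ^+ 4 * H x y x3 x4)) =
  rho x y ^+ 4 * EX (fun w => Wo x w * Wo y w).
  under eq_savg do rewrite savgZ.
  rewrite savgZ; congr (_ * _).
  transitivity (EX (fun w => savg (fun x3 => savg (fun x4 =>
     (Lo w)^-1 ^+ 2 * (Wo x w * Wo y w * (Wo x3 w * Wo x4 w)))))).
    rewrite (gexp_savg gamE); last by move=> z; apply: tame_savg => z'; exact: tameM.
    apply: eq_savg => z; rewrite (gexp_savg gamE); last by move=> z'; exact: tameM.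
    by [].
  congr EX; apply/funext => w.
  under eq_savg do rewrite savgZ savgZ.
  rewrite savgZ savgZ -sq_savg -/(Lo w); field.
  by rewrite gt_eqF.
rewrite gexp_WoWo mul1r /mom.
apply: (@le_trans _ _ (rho x y ^+ 4 * expR (kap ^+ 2 * rho x y ^+ 2 / 2))).
  by rewrite ler_wpM2l ?dot_off_le// exprn_even_ge0.
by rewrite ler_wpM2r ?expR_ge0// lerDr sqr_ge0.
Qed.

Let rho4_23 : savg4 (fun x1 x2 x3 x4 => rho x2 x3 ^+ 4 * H x1 x2 x3 x4) <= C * N%:R ^+ 2.
Proof.
rewrite savg4_swap12 savg4_swap23; apply: le_trans rho4_12; rewrite le_eqVlt.
by apply/orP; left; apply/eqP/eq_savg4 => x1 x2 x3 x4; rewrite H12 H23.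
Qed.

Let rho4_13 : savg4 (fun x1 x2 x3 x4 => rho x1 x3 ^+ 4 * H x1 x2 x3 x4) <= C * N%:R ^+ 2.
Proof.
rewrite savg4_swap23; apply: le_trans rho4_12; rewrite le_eqVlt.
by apply/orP; left; apply/eqP/eq_savg4 => x1 x2 x3 x4; rewrite H23.
Qed.

Let rho4_14 : savg4 (fun x1 x2 x3 x4 => rho x1 x4 ^+ 4 * H x1 x2 x3 x4) <= C * N%:R ^+ 2.
Proof.
rewrite savg4_swap34; apply: le_trans rho4_13; rewrite le_eqVlt.
by apply/orP; left; apply/eqP/eq_savg4 => x1 x2 x3 x4; rewrite H34.
Qed.

Let rho4_24 : savg4 (fun x1 x2 x3 x4 => rho x2 x4 ^+ 4 * H x1 x2 x3 x4) <= C * N%:R ^+ 2.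
Proof.
rewrite savg4_swap34; apply: le_trans rho4_23; rewrite le_eqVlt.
by apply/orP; left; apply/eqP/eq_savg4 => x1 x2 x3 x4; rewrite H34.
Qed.

Let rho4_34 : savg4 (fun x1 x2 x3 x4 => rho x3 x4 ^+ 4 * H x1 x2 x3 x4) <= C * N%:R ^+ 2.
Proof.
rewrite savg4_swap23; apply: le_trans rho4_24; rewrite le_eqVlt.
by apply/orP; left; apply/eqP/eq_savg4 => x1 x2 x3 x4; rewrite H23.
Qed.

(** The terms of order at most one vanish by parity, those in [A1] through the spin of x1 at [o],
    those in [A2] through that of x2. The rest is kap^4 times a quartic in the overlaps, hence
    bounded. The constant 33 is 3 from [mul_sqr_sum6_le] times 11 from [four_replica_taylor], and
    198 counts the six pairs. *)
Let cavity_sq_ratio : EX (fun w => X w ^+ 2 * (Lo w)^-1 ^+ 2) <= 198 * expR 6 * C.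
Proof.
pose c x y := rho x y * (eta x y - kap ^+ 2 * rho x y).
pose Y x1 x2 x3 x4 := eta x1 x2 * r x1 x2 + eta x3 x4 * r x3 x4 + eta x1 x3 * r x1 x3
  + eta x1 x4 * r x1 x4 + eta x2 x3 * r x2 x3 + eta x2 x4 * r x2 x4.
have tWW x y : tame (fun w => W x w * W y w) by exact: tameM.
have -> : EX (fun w => X w ^+ 2 * (Lo w)^-1 ^+ 2) =
    savg4 (fun x1 x2 x3 x4 => c x1 x2 * c x3 x4 * (expR (Y x1 x2 x3 x4) * H x1 x2 x3 x4)).
  have tF x1 x2 x3 x4 : tame (fun w => (Lo w)^-1 ^+ 2 * (W x1 w * W x2 w * (W x3 w * W x4 w))).
    by apply: tameM => //; exact: tameM.
  transitivity (EX (fun w => savg4 (fun x1 x2 x3 x4 => c x1 x2 * c x3 x4 *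
      ((Lo w)^-1 ^+ 2 * (W x1 w * W x2 w * (W x3 w * W x4 w)))))).
    congr EX; apply/funext => w.
    have XE : X w = savg (fun x => savg (fun y => c x y * (W x w * W y w))) by [].
    rewrite expr2 -mulrA {1}XE -savgZr.
    apply: eq_savg => x1; rewrite -savgZr; apply: eq_savg => x2.
    rewrite XE -savgZr -savgZ; apply: eq_savg => x3.
    rewrite -savgZr -savgZ; apply: eq_savg => x4.
    by ring.
  rewrite (gexp_savg gamE); last first.
    by move=> x1; do 3 (apply: tame_savg => ?); exact: tameZ.
  apply: eq_savg => x1; rewrite (gexp_savg gamE); last first.
    by move=> x2; do 2 (apply: tame_savg => ?); exact: tameZ.
  apply: eq_savg => x2; rewrite (gexp_savg gamE); last first.
    by move=> x3; apply: tame_savg => ?; exact: tameZ.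
  apply: eq_savg => x3; rewrite (gexp_savg gamE); last by move=> x4; exact: tameZ.
  apply: eq_savg => x4; rewrite gexpZ//.
  rewrite (gexp_off4 x1 x2 x3 x4 tLoV2 (Lo_row_inv (fun l => l^-1 ^+ 2))).
  congr (_ * (expR _ * _)); rewrite /Y /r; ring.
pose A1 x1 x2 x3 x4 := eta x1 x2 * eta x3 x4 + r x2 x4 * eta x1 x3 + r x2 x3 * eta x1 x4.
pose A2 x1 x2 x3 x4 := r x1 x3 * eta x2 x4 + r x1 x4 * eta x2 x3.
pose q x1 x2 x3 x4 := rho x1 x2 * rho x3 x4 * H x1 x2 x3 x4.
have Hflip1 x1 x2 x3 x4 : H (flip o x1) x2 x3 x4 = H x1 x2 x3 x4 by rewrite /H Wo_flip.
have Hflip2 x1 x2 x3 x4 : H x1 (flip o x2) x3 x4 = H x1 x2 x3 x4 by rewrite /H Wo_flip.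
have r_flip x y : r (flip o x) y = r x y by rewrite /r rho_flip.
have rho_flipr x y : rho x (flip o y) = rho x y by rewrite rhoC rho_flip rhoC.
have r_flipr x y : r x (flip o y) = r x y by rewrite /r rho_flipr.
have eta_flipr x y : eta x (flip o y) = - eta x y by rewrite etaC eta_flip etaC.
have A1_0 : savg4 (fun x1 x2 x3 x4 => q x1 x2 x3 x4 * A1 x1 x2 x3 x4) = 0.
  apply: (@savg_odd _ _ o) => x1; do 3 (rewrite -savgN; apply: eq_savg => ?).
  by rewrite /q /A1 rho_flip Hflip1 !eta_flip; ring.
have A2_0 : savg4 (fun x1 x2 x3 x4 => q x1 x2 x3 x4 * A2 x1 x2 x3 x4) = 0.
  rewrite -[RHS](savg_const N); apply: eq_savg => x1.
  apply: (@savg_odd _ _ o) => x2; do 2 (rewrite -savgN; apply: eq_savg => ?).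
  by rewrite /q /A2 rho_flipr Hflip2 !eta_flip; ring.
pose Q x1 x2 x3 x4 := (eta x1 x2 - r x1 x2) * (eta x3 x4 - r x3 x4) * expR (Y x1 x2 x3 x4)
  - (A1 x1 x2 x3 x4 + A2 x1 x2 x3 x4).
have -> : savg4 (fun x1 x2 x3 x4 => c x1 x2 * c x3 x4 * (expR (Y x1 x2 x3 x4) * H x1 x2 x3 x4))
    = savg4 (fun x1 x2 x3 x4 => q x1 x2 x3 x4 * Q x1 x2 x3 x4).
  rewrite -[LHS]subr0 -A1_0 -[LHS]subr0 -A2_0.
  do 4 (rewrite -!savgB; apply: eq_savg => ?).
  by rewrite /q /Q /c /r; ring.
pose rho4 x1 x2 x3 x4 := rho x1 x2 ^+ 4 + rho x3 x4 ^+ 4 + rho x1 x3 ^+ 4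
  + rho x1 x4 ^+ 4 + rho x2 x3 ^+ 4 + rho x2 x4 ^+ 4.
have k40 : 0 <= kap ^+ 4 by rewrite exprn_even_ge0.
have e60 : 0 <= expR 6 :> R by exact: expR_ge0.
have QE x1 x2 x3 x4 : q x1 x2 x3 x4 * Q x1 x2 x3 x4 <=
    33 * expR 6 * kap ^+ 4 * (rho4 x1 x2 x3 x4 * H x1 x2 x3 x4).
  have hQ : `|Q x1 x2 x3 x4| <= 11 * expR 6 * (r x1 x2 ^+ 2 + r x3 x4 ^+ 2 + r x1 x3 ^+ 2
      + r x1 x4 ^+ 2 + r x2 x3 ^+ 2 + r x2 x4 ^+ 2).
    by apply: four_replica_taylor; rewrite ?sqr_spin.
  apply: (le_trans (ler_norm _)); rewrite /q normrM (normrM _ (H _ _ _ _)) (ger0_norm (H_ge0 _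
    _ _ _)).
  rewrite mulrAC mulrA ler_wpM2r//.
  apply: (le_trans (ler_wpM2l (normr_ge0 _) hQ)).
  have := mul_sqr_sum6_le (rho x1 x2) (rho x3 x4) (rho x1 x3) (rho x1 x4) (rho x2 x3) (rho x2 x4).
  rewrite -/(rho4 x1 x2 x3 x4) => hm.
  rewrite [leLHS](_ : _ = 11 * expR 6 * kap ^+ 4 * (`|rho x1 x2 * rho x3 x4| *
    (rho x1 x2 ^+ 2 + rho x3 x4 ^+ 2 + rho x1 x3 ^+ 2
      + rho x1 x4 ^+ 2 + rho x2 x3 ^+ 2 + rho x2 x4 ^+ 2))); last by rewrite /r; ring.
  rewrite [leRHS](_ : _ = 11 * expR 6 * kap ^+ 4 * (3 * rho4 x1 x2 x3 x4)); last by ring.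
  by rewrite ler_wpM2l// mulr_ge0// mulr_ge0.
apply: (@le_trans _ _ (savg4 (fun x1 x2 x3 x4 =>
    33 * expR 6 * kap ^+ 4 * (rho4 x1 x2 x3 x4 * H x1 x2 x3 x4)))).
  by do 4 (apply: le_savg => ?).
have -> : savg4 (fun x1 x2 x3 x4 => 33 * expR 6 * kap ^+ 4 * (rho4 x1 x2 x3 x4 * H x1 x2 x3 x4)) =
    33 * expR 6 * kap ^+ 4 *
    (savg4 (fun x1 x2 x3 x4 => rho x1 x2 ^+ 4 * H x1 x2 x3 x4)
    + savg4 (fun x1 x2 x3 x4 => rho x3 x4 ^+ 4 * H x1 x2 x3 x4)
    + savg4 (fun x1 x2 x3 x4 => rho x1 x3 ^+ 4 * H x1 x2 x3 x4)
    + savg4 (fun x1 x2 x3 x4 => rho x1 x4 ^+ 4 * H x1 x2 x3 x4)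
    + savg4 (fun x1 x2 x3 x4 => rho x2 x3 ^+ 4 * H x1 x2 x3 x4)
    + savg4 (fun x1 x2 x3 x4 => rho x2 x4 ^+ 4 * H x1 x2 x3 x4)).
  rewrite /savg4 -!savgD -savgZ; apply: eq_savg => x1.
  rewrite -!savgD -savgZ; apply: eq_savg => x2.
  rewrite -!savgD -savgZ; apply: eq_savg => x3.
  rewrite -!savgD -savgZ; apply: eq_savg => x4.
  by rewrite /rho4; ring.
apply: (@le_trans _ _ (33 * expR 6 * kap ^+ 4 * (6 * (C * N%:R ^+ 2)))).
  rewrite ler_wpM2l//; first by rewrite mulr_ge0// mulr_ge0.
  have := rho4_12; have := rho4_34; have := rho4_13; have := rho4_14.
  have := rho4_23; have := rho4_24; lra.
rewrite [leLHS](_ : _ = 198 * expR 6 * C * (kap ^+ 4 * N%:R ^+ 2)); last by ring.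
by rewrite ler_piMr// mulr_ge0 ?(ltW C0)// mulr_ge0.
Qed.

(* The vertex o is decoupled: L is compared with Lo by AM-GM, and the
   fluctuation X of the cavity field is orthogonal to functions of Lo. *)
Lemma cavity_vertex (g : R -> R) (c0 c1 : R) : measurable_fun setT g ->
  (forall l, 0 < l -> `|g l| <= c0) -> 0 <= c1 ->
  (forall l l', 0 < l -> 0 < l' -> `|g l' - g l| <= c1 * `|l' / l - 1|) ->
  `|EX (fun w => g (lr e1 e2 kap w) * savg (fun x => savg (fun y =>
     overlap (fun i => i != o) x y *
     (spin x o * spin y o - kap ^+ 2 * overlap (fun i => i != o) x y) *
     (wick (theta e1 e2 kap (spin x)) w * wick (theta e1 e2 kap (spin y)) w))))|
  <= (2 * expR 1 * c0 + 100 * c1 * expR 6) * C / Num.sqrt N%:R.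
Proof.
move=> mg gc c10 gL; rewrite -/(L _) -/sN.
rewrite -[X in `|EX X|]/(fun w => g (L w) * X w).
have tg (l : n.-tuple R -> R) : tame l -> (forall w, 0 < l w) -> tame (fun w => g (l w)).
  move=> tl l0; apply: (@tame_bounded _ _ _ c0); last by move=> w; exact: gc.
  by apply: (measurableT_comp mg); case: tl.
have tgL := tg _ tL L_gt0; have tgLo := tg _ tLo Lo_gt0.
pose D w := (g (L w) - g (Lo w)) * X w.
have tD : tame D by apply: tameM => //; exact: tameB.
have -> : EX (fun w => g (L w) * X w) = EX (fun w => g (Lo w) * X w) + EX D.
  rewrite -gexpD//; last exact: tameM.
  by congr EX; apply/funext => w; rewrite /D; ring.
apply: (le_trans (ler_normD _ _)).
rewrite [leRHS](_ : _ = 2 * expR 1 * c0 * C / sN + 100 * c1 * expR 6 * C / sN); last by ring.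
apply: lerD; first exact: (cavity_main mg gc).
apply: (le_trans (le_normr_gexp gamE tD)).
(* The weights sqrt N and its inverse balance the two expectations, which are of order 1 / N and
   1. *)
pose U w := c1 / 2 * (sN * (L w - Lo w) ^+ 2 + sN^-1 * (X w ^+ 2 * (Lo w)^-1 ^+ 2)).
have t1 : tame (fun w => (L w - Lo w) ^+ 2) by apply: tameX; exact: tameB.
have t2 : tame (fun w => X w ^+ 2 * (Lo w)^-1 ^+ 2) by apply: tameM => //; exact: tameX.
have tU : tame U by apply: tameZ; apply: tameD; exact: tameZ.
apply: (@le_trans _ _ (EX U)).
  apply: le_gexp => //; first exact: tame_norm.
  move=> w; rewrite /D normrM.
  have h := gL _ _ (Lo_gt0 w) (L_gt0 w).
  apply: (le_trans (ler_wpM2r (normr_ge0 _) h)).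
  rewrite /U (_ : L w / Lo w - 1 = (L w - Lo w) * (Lo w)^-1); last first.
    by field; rewrite gt_eqF.
  have -> : c1 * `|(L w - Lo w) * (Lo w)^-1| * `|X w| =
      c1 * (`|L w - Lo w| * `|X w * (Lo w)^-1|) by rewrite !normrM; ring.
  rewrite -(mulrA c1) ler_wpM2l//.
  rewrite -(real_normK (num_real (L w - Lo w))) -exprMn -(real_normK (num_real (X w * _))).
  move: `|L w - Lo w| `|X w * (Lo w)^-1| => a b.
  have : 0 <= (sN * a - b) ^+ 2 / sN by rewrite divr_ge0 ?sqr_ge0// ltW.
  rewrite (_ : (sN * a - b) ^+ 2 / sN = sN * a ^+ 2 - 2 * (a * b) + sN^-1 * b ^+ 2); last first.
    by field; rewrite gt_eqF.
  lra.
rewrite gexpZ; [|by []|by apply: tameD; exact: tameZ].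
rewrite gexpD; [|by []|exact: tameZ|exact: tameZ].
rewrite !gexpZ//.
have h1 : sN * EX (fun w => (L w - Lo w) ^+ 2) <= expR 6 * C / sN.
  rewrite mulrC -ler_pdivlMr// (le_trans cavity_sq_diff)//.
  rewrite [leRHS](_ : _ = expR 6 * C / N%:R); last first.
    by rewrite -sN_sq; field; rewrite gt_eqF.
  rewrite ler_wpM2r ?invr_ge0 ?ler0n//.
  by rewrite ler_wpM2r ?(ltW C0)// ler_expR; lra.
have h2 : sN^-1 * EX (fun w => X w ^+ 2 * (Lo w)^-1 ^+ 2) <= 198 * expR 6 * C / sN.
  by rewrite mulrC ler_wpM2r ?invr_ge0 ?(ltW sN_gt0)// cavity_sq_ratio.
have h3 : 0 <= expR 6 * C / sN :> R.
  by rewrite divr_ge0 ?(ltW sN_gt0)// mulr_ge0 ?expR_ge0// ltW.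
(* The sum 1 + 198 is rounded up to 200; half of it is the 100 in the bound. *)
apply: (@le_trans _ _ (c1 / 2 * (expR 6 * C / sN + 198 * expR 6 * C / sN))).
  by rewrite ler_wpM2l ?divr_ge0// lerD.
rewrite [leRHS](_ : _ = c1 / 2 * (200 * (expR 6 * C / sN))); last by field; rewrite gt_eqF.
by rewrite ler_wpM2l ?divr_ge0//; lra.
Qed.

End cavity.

Section cavity_estimate.
Local Opaque gexp wick expR.
Context {R : realType} (N n : nat) (e1 e2 : 'I_n -> 'I_N).
Hypothesis eP : enumerates_pairs (R := R) e1 e2.
Variables (gam : probability (n.-tuple R) R) (kap : R).
Hypothesis gamE : iid_normal gam.
Local Notation EX := (gexp gam).
Implicit Types (x y : spins N) (w : n.-tuple R).

Let W x w : R := wick (theta e1 e2 kap (spin x)) w.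
Let M x y : R := overlap xpredT x y.

Lemma gexp_wick_wick (t1 t2 : 'I_n -> R) :
  EX (fun w => wick t1 w * wick t2 w) = expR (\sum_k t1 k * t2 k).
Proof.
transitivity (EX (fun w => expR (\sum_k t1 k * t2 k) * wick (fun k => t1 k + t2 k) w)).
  by congr EX; apply/funext => w; rewrite -wick_dot.
by rewrite gexpZ ?gexp_wick ?mulr1//; exact: tame_wick.
Qed.

Lemma lr_gt0 w : 0 < lr e1 e2 kap w.
Proof. by apply: savg_gt0 => x; exact: wick_gt0. Qed.

Lemma tame_lr : tame (lr (R := R) e1 e2 kap).
Proof. by apply: tame_savg => x; exact: tame_wick. Qed.

(** The two-replica average B_u. It is not normalised by the square of [lr], and is therefore
    compared with a multiple of that square. *)
Definition lr_overlap w : R :=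
  savg (fun x => savg (fun y => M x y ^+ 2 / N%:R * (W x w * W y w))).

Lemma tame_lr_overlap : tame lr_overlap.
Proof.
apply: tame_savg => x; apply: tame_savg => y; apply: tameZ.
by apply: tameM; exact: tame_wick.
Qed.

Lemma lr_sq w : lr e1 e2 kap w ^+ 2 = savg (fun x => savg (fun y => W x w * W y w)).
Proof. by rewrite expr2 -savgZr; apply: eq_savg => x; rewrite savgZ. Qed.

Hypothesis N0 : (0 < N)%N.
Variable C : R.
Hypothesis C0 : 0 < C.
Hypothesis momC : forall P : pred 'I_N,
  savg (fun x => savg (fun y => (N%:R ^+ 2 + overlap P x y ^+ 4) *
    expR (kap ^+ 2 * overlap P x y ^+ 2 / 2))) <= C * N%:R ^+ 2.
Hypothesis kapN : kap ^+ 2 * N%:R < 1.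

Let Np : 0 < N%:R :> R. Proof. by rewrite ltr0n. Qed.

Let dotE x y : \sum_k theta e1 e2 kap (spin x) k * theta e1 e2 kap (spin y) k =
  kap ^+ 2 * (M x y ^+ 2 - N%:R) / 2.
Proof.
rewrite theta_dot// mulrA; congr (_ * (_ ^+ 2 - _) / 2).
under eq_bigr => i _ do rewrite exprMn !sqr_spin mulr1.
by rewrite sumr_const card_ord.
Qed.

Let savg2_le (f : spins N -> spins N -> R) : (forall x y, 0 <= f x y) ->
  (forall x y, f x y * N%:R ^+ 2 <= N%:R ^+ 2 + M x y ^+ 4) ->
  EX (fun w => savg (fun x => savg (fun y => f x y * (W x w * W y w)))) <= C.
Proof.
move=> f0 fM; have tWW x y : tame (fun w => W x w * W y w).
  by apply: tameM; exact: tame_wick.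
rewrite (gexp_savg gamE); last by move=> x; apply: tame_savg => y; exact: tameZ.
rewrite -(ler_pM2r (exprn_gt0 2 Np)).
apply: le_trans (momC xpredT); rewrite -savgZr; apply: le_savg => x.
rewrite (gexp_savg gamE); last by move=> y; exact: tameZ.
rewrite -savgZr; apply: le_savg => y.
rewrite gexpZ// gexp_wick_wick dotE mulrAC.
apply: ler_pM; rewrite ?mulr_ge0 ?expR_ge0 ?sqr_ge0//.
by rewrite ler_expR ler_pM2r// ler_wpM2l ?sqr_ge0// gerBl ltW.
Qed.

(** The overlap without [o] is M minus the product of the two spins at [o]. Summing the cavity terms
    over [o] gives the identity [key]: up to kap^2 V, which contributes order 1 / N, the bracket is
    an average of the terms bounded in [cavity_vertex], divided by 1 - u^2. *)
Lemma cavity_estimate (g : R -> R) (c0 c1 : R) : measurable_fun setT g ->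
  (forall l, 0 < l -> `|g l| <= c0) -> 0 <= c1 ->
  (forall l l', 0 < l -> 0 < l' -> `|g l' - g l| <= c1 * `|l' / l - 1|) ->
  `|EX (fun w => g (lr e1 e2 kap w) *
     (lr_overlap w - lr e1 e2 kap w ^+ 2 / (1 - kap ^+ 2 * N%:R)))| <=
  (2 * expR 1 * c0 + 100 * c1 * expR 6 + 3 * c0) * C /
    (1 - kap ^+ 2 * N%:R) / Num.sqrt N%:R.
Proof.
move=> mg gc c10 gL.
have c00 : 0 <= c0 by apply: le_trans (gc 1 ltr01).
set u2 := kap ^+ 2 * N%:R; have d0 : 0 < 1 - u2 by rewrite subr_gt0.
have s0 : 0 < Num.sqrt N%:R :> R by rewrite sqrtr_gt0.
pose X o w := savg (fun x => savg (fun y =>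
     overlap (fun i => i != o) x y *
     (spin x o * spin y o - kap ^+ 2 * overlap (fun i => i != o) x y) *
     (W x w * W y w))).
have tWW x y : tame (fun w => W x w * W y w) by apply: tameM; exact: tame_wick.
have tX o : tame (X o).
  by apply: tame_savg => x; apply: tame_savg => y; exact: tameZ.
pose gl w := g (lr e1 e2 kap w).
have tg : tame gl.
  apply: (@tame_bounded _ _ _ c0); last by move=> w; apply: gc; exact: lr_gt0.
  by apply: (measurableT_comp mg); case: tame_lr.
have tA : tame (fun w => lr e1 e2 kap w ^+ 2) by apply: tameX; exact: tame_lr.
have tB := tame_lr_overlap.
pose V w := 2 * lr_overlap w - lr e1 e2 kap w ^+ 2.
have tV : tame V by apply: tameB => //; exact: tameZ.
have key w : (1 - u2) * (lr_overlap w - lr e1 e2 kap w ^+ 2 / (1 - u2)) =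
    N%:R^-1 * (\sum_o X o w) - kap ^+ 2 * V w.
  rewrite [LHS](_ : _ = (1 - u2) * lr_overlap w - lr e1 e2 kap w ^+ 2); last first.
    by field; rewrite gt_eqF.
  rewrite /V lr_sq /lr_overlap /X.
  rewrite -savg_sum -!savgZ -!savgB -!savgZ -!savgB; apply: eq_savg => x.
  rewrite -savg_sum -!savgZ -!savgB -!savgZ -!savgB; apply: eq_savg => y.
  rewrite -mulr_suml.
  have -> : \sum_o overlap (fun i => i != o) x y *
       (spin x o * spin y o - kap ^+ 2 * overlap (fun i => i != o) x y) =
     M x y ^+ 2 - N%:R - kap ^+ 2 * (N%:R * M x y ^+ 2 - 2 * M x y ^+ 2 + N%:R).
    have oE o : overlap (fun i => i != o) x y = M x y - spin x o * spin y o.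
      by rewrite /M /overlap [in RHS](bigD1 o)//=; ring.
    transitivity (\sum_o (M x y * (spin x o * spin y o) - 1 -
        kap ^+ 2 * (M x y ^+ 2 - 2 * M x y * (spin x o * spin y o) + 1))).
      apply: eq_bigr => o _; rewrite oE.
      have : (spin x o * spin y o) ^+ 2 = 1 :> R by rewrite exprMn !sqr_spin mulr1.
      move: (spin x o * spin y o) => e ee.
      rewrite (_ : _ * _ = M x y * e - e ^+ 2 - kap ^+ 2 * (M x y ^+ 2 - 2 * M x y * e + e ^+ 2)).
        by rewrite ee.
      by ring.
    rewrite !sumrB -!mulr_sumr big_split/= sumrB -!mulr_sumr !sumr_const card_ord.
    rewrite -/(overlap xpredT x y) -/(M x y) -mulr_natr -[1 *+ N]/(N%:R).
    by ring.
  by rewrite /u2; field; rewrite gt_eqF.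
have dE : EX (fun w => gl w * (lr_overlap w - lr e1 e2 kap w ^+ 2 / (1 - u2))) =
   (1 - u2)^-1 * (N%:R^-1 * (\sum_o EX (fun w => gl w * X o w)) - kap ^+ 2 * EX (fun w => gl w
     * V w)).
  have tgX o : tame (fun w => gl w * X o w) by exact: tameM.
  have tS : tame (fun w => \sum_o gl w * X o w) by apply: tame_sum.
  have tgV := tameM tg tV.
  rewrite -(gexp_sum gamE _ _ tgX) -(gexpZ gamE _ tS) -(gexpZ gamE _ tgV).
  rewrite -(gexpB gamE (tameZ _ tS) (tameZ _ tgV)).
  rewrite -(gexpZ gamE _ (tameB (tameZ _ tS) (tameZ _ tgV))).
  congr EX; apply/funext => w; rewrite -mulr_sumr.
  rewrite [RHS](_ : _ = (1 - u2)^-1 * (gl w * (N%:R^-1 * (\sum_o X o w) - kap ^+ 2 * V w)));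
    last by ring.
  by rewrite -key mulrCA mulKf// gt_eqF.
rewrite -/(gl _) dE normrM ger0_norm ?invr_ge0 ?(ltW d0)//.
rewrite [leRHS](_ : _ = (1 - u2)^-1 * ((2 * expR 1 * c0 + 100 * c1 * expR 6) * C / Num.sqrt
  N%:R + 3 * c0 * C / Num.sqrt N%:R)); last first.
  by field; rewrite !gt_eqF.
rewrite ler_wpM2l ?invr_ge0 ?(ltW d0)//.
apply: (le_trans (ler_normB _ _)); apply: lerD.
  rewrite normrM ger0_norm ?invr_ge0 ?ler0n// ler_pdivrMl//.
  apply: (le_trans (ler_norm_sum _ _ _)).
  rewrite [leRHS]mulr_natl -[X in _ *+ X](card_ord N) -sumr_const.
  apply: ler_sum => o _; apply: cavity_vertex => //.
  exact: ltW.
have EA : EX (fun w => lr e1 e2 kap w ^+ 2) <= C.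
  rewrite (_ : (fun w => _) = (fun w => savg (fun x => savg (fun y => 1 * (W x w * W y w)))));
    last first.
    apply/funext => w; rewrite lr_sq; apply: eq_savg => x; apply: eq_savg => y.
    by rewrite mul1r.
  apply: savg2_le => // x y; rewrite mul1r lerDl.
  by rewrite exprn_even_ge0.
have EB : EX lr_overlap <= C.
  apply: savg2_le => x y; first by rewrite divr_ge0 ?sqr_ge0// ltW.
  rewrite expr2 mulrA divfK ?gt_eqF// (exprM _ 2 2).
  have := sqr_ge0 (M x y); have := ltW Np; nra.
have EV : `|EX (fun w => gl w * V w)| <= 3 * c0 * C.
  apply: (le_trans (le_normr_gexp gamE (tameM tg tV))).
  apply: (@le_trans _ _ (EX (fun w => c0 * (2 * lr_overlap w + lr e1 e2 kap w ^+ 2)))).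
    apply: le_gexp => //.
    - by apply: tame_norm; exact: tameM.
    - by apply: tameZ; apply: tameD => //; exact: tameZ.
    move=> w; rewrite normrM; apply: ler_pM => //.
      by apply: gc; exact: lr_gt0.
    apply: (le_trans (ler_normB _ _)); rewrite normrM ger0_norm//.
    have B0 : 0 <= lr_overlap w.
      apply: savg_ge0 => x; apply: savg_ge0 => y.
      rewrite mulr_ge0 ?divr_ge0 ?sqr_ge0 ?(ltW Np)// mulr_ge0//;
        exact/ltW/wick_gt0.
    by rewrite (ger0_norm B0) (ger0_norm (sqr_ge0 _)).
  rewrite gexpZ//; last by apply: tameD => //; exact: tameZ.
  rewrite gexpD//; last exact: tameZ.
  by rewrite gexpZ// (mulrC 3) -(mulrA c0) ler_wpM2l//; lra.
rewrite normrM ger0_norm ?sqr_ge0//.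
apply: (@le_trans _ _ (N%:R^-1 * (3 * c0 * C))).
  apply: ler_pM => //; first exact: sqr_ge0.
  by rewrite -[leRHS]mul1r ler_pdivlMr// ltW.
rewrite mulrC ler_wpM2l//; first by rewrite !mulr_ge0// ltW.
rewrite lef_pV2 ?posrE//.
have s1 : 1 <= Num.sqrt N%:R :> R by rewrite -[leLHS]sqrtr1 ler_sqrt ?ler1n.
by rewrite -[leRHS]sqr_sqrtr ?(ltW Np)// expr2 ler_peMl// ltW.
Qed.

End cavity_estimate.

(** * Interpolation in the signal strength *)

Section derivative_under_expectation.
Context {R : realType} (n : nat) (gam : probability (n.-tuple R) R).
Hypothesis gamE : iid_normal gam.
Local Notation EX := (gexp gam).

Lemma is_derive_gexp (f f' : R -> n.-tuple R -> R) (G : n.-tuple R -> R) (lo hi a : R) :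
  lo < a < hi -> (forall u, lo < u < hi -> tame (f u)) -> tame G ->
  (forall u w, lo < u < hi -> is_derive u 1 (f^~ w) (f' u w)) ->
  (forall u w, lo < u < hi -> `|f' u w| <= G w) ->
  is_derive a 1 (fun u => EX (f u)) (EX (f' a)).
Proof.
move=> aI tf tG df f'G.
have inI u : `]lo, hi[%classic u -> lo < u < hi by rewrite /= in_itv.
have Ia : `]lo, hi[%classic a by rewrite /= in_itv.
have H1 : forall u, `]lo, hi[%classic u -> gam.-integrable setT (EFin \o f u).
  by move=> u /inI uI; apply: (tame_integrable gamE); exact: tf.
have H2 : forall u w, `]lo, hi[%classic u -> setT w -> derivable (f^~ w) u 1.
  by move=> u w /inI uI _; have := df u w uI => h.
have G0 w : 0 <= G w by apply: le_trans (f'G a w aI).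
have H3 := tame_integrable gamE tG.
have pE u w : lo < u < hi -> partial1of2 f u w = f' u w.
  by move=> uI; rewrite partial1of2E; have := df u w uI => h; rewrite derive_val.
have H4 : forall u w, `]lo, hi[%classic u -> setT w -> `|partial1of2 f u w| <= G w.
  by move=> u w /inI uI _; rewrite pE// f'G.
apply: DeriveDef.
  exact: (derivable_under_integral measurableT Ia H1 H2 G0 H3 H4).
rewrite -derive1E /gexp (differentiation_under_integral measurableT Ia H1 H2 G0 H3 H4).
by apply: eq_Rintegral => w _; exact: pE.
Qed.

Lemma is_derive_savg N (F : spins N -> R -> R) (dF : spins N -> R) (a : R) :
  (forall x, is_derive a 1 (F x) (dF x)) ->
  is_derive a 1 (fun u => savg (fun x => F x u)) (savg dF).
Proof.
move=> dFx; rewrite /savg.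
have dsum (s : seq (spins N)) : is_derive a 1 (fun u => \sum_(x <- s) F x u) (\sum_(x <- s) dF x).
  elim: s => [|x s IHs].
    rewrite big_nil; under eq_fun do rewrite big_nil; exact: is_derive_cst.
  rewrite big_cons; under eq_fun do rewrite big_cons.
  have := dFx x => h; exact: is_deriveD.
have := dsum (index_enum _) => h; exact: is_derive_eq.
Qed.

End derivative_under_expectation.

Definition lr_mu {R : realType} (l : R) : R := 4^-1 * (- ln (1 - l) - l).

Lemma lr_mu_le {R : realType} (a b : R) : 0 <= a -> a <= b -> b < 1 -> lr_mu a <= lr_mu b.
Proof.
move=> a0 ab b1; have a1 : 0 < 1 - a by lra.
have b1' : 0 < 1 - b by lra.
have q0 : 0 < (1 - b) / (1 - a) by rewrite divr_gt0.
have h : ln ((1 - b) / (1 - a)) <= (1 - b) / (1 - a) - 1.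
  by rewrite -[X in ln X](addrNK 1) addrC le_ln1Dx//; lra.
rewrite ln_div ?posrE// in h.
have hq : (1 - b) / (1 - a) - 1 = - (b - a) / (1 - a) by field; rewrite gt_eqF.
have hb : b - a <= (b - a) / (1 - a).
  by rewrite ler_pdivlMr// ler_piMr//; lra.
rewrite /lr_mu ler_wpM2l ?invr_ge0//.
move: h hb; rewrite hq mulNr; lra.
Qed.

Section flow.
Context {R : realType} (N n : nat) (e1 e2 : 'I_n -> 'I_N).
Hypothesis eP : enumerates_pairs (R := R) e1 e2.
Variable gam : probability (n.-tuple R) R.
Hypothesis gamE : iid_normal gam.
Hypothesis N0 : (0 < N)%N.
Local Notation EX := (gexp gam).
Implicit Types (x y : spins N) (w : n.-tuple R) (u h : R).

Let s : R := (Num.sqrt N%:R)^-1.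
Let t x : 'I_n -> R := theta e1 e2 s (spin x).
Let S x w : R := \sum_k t x k * tnth w k.
Let v x : R := \sum_k t x k ^+ 2.
Let wk x u w : R := wick (fun k => u * t x k) w.
Let Z u w : R := lr e1 e2 (u * s) w.
Let D u w : R := savg (fun x => (S x w - u * v x) * wk x u w).
Let dot x y : R := \sum_k t x k * t y k.

Let wkE x u w : wk x u w = expR (u * S x w - u ^+ 2 * v x / 2).
Proof.
rewrite /wk /wick; congr expR; rewrite /S /v !mulr_sumr; congr (_ - _).
  by apply: eq_bigr => k _; rewrite mulrA.
by congr (_ / 2); apply: eq_bigr => k _; rewrite exprMn.
Qed.

Let ZE u w : Z u w = savg (fun x => wk x u w).
Proof.
apply: eq_savg => x; congr (wick _ w); apply/funext => k.
by rewrite /t /theta !mulrA.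
Qed.

Let v_ge0 x : 0 <= v x.
Proof. by apply: sumr_ge0 => k _; exact: sqr_ge0. Qed.

Let wk_gt0 x u w : 0 < wk x u w. Proof. exact: wick_gt0. Qed.
Let Z_gt0 u w : 0 < Z u w. Proof. exact: lr_gt0. Qed.
Let twk x u : tame (wk x u). Proof. exact: tame_wick. Qed.
Let tZ u : tame (Z u). Proof. exact: tame_lr. Qed.
Let tS x : tame (S x). Proof. exact: tame_lin. Qed.

Let tDx x u : tame (fun w => (S x w - u * v x) * wk x u w).
Proof. by apply: tameM => //; apply: tameB => //; exact: tame_cst. Qed.

Let tD u : tame (D u). Proof. by apply: tame_savg => x; exact: tDx. Qed.

Let is_derive_wk x w u :
  is_derive u 1 (fun u => wk x u w) ((S x w - u * v x) * wk x u w).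
Proof.
rewrite (_ : (fun u => wk x u w) = fun u => expR (u * S x w - u ^+ 2 * v x / 2)); last first.
  by apply/funext => z; rewrite wkE.
apply: is_derive_eq; rewrite wkE /GRing.scale/=.
by field.
Qed.

Let is_derive_Z w u : is_derive u 1 (fun u => Z u w) (D u w).
Proof.
rewrite (_ : (fun u => Z u w) = fun u => savg (fun x => wk x u w)); last first.
  by apply/funext => z; rewrite ZE.
by apply: is_derive_savg => x; exact: is_derive_wk.
Qed.

(* Bounds the derivative of wick (u t_x) uniformly in |u| <= H. *)
Let dom H x w : R := (`|S x w| + H * v x) * (expR (H * S x w) + expR (- H * S x w)).

Let tdom H x : tame (dom H x).
Proof.
have texp c : tame (fun w => expR (c * S x w)).
  rewrite (_ : (fun w => _) = fun w => expR (\sum_k (c * t x k) * tnth w k - 0)).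
    exact: tame_expR_lin.
  apply/funext => w; rewrite subr0 mulr_sumr; congr expR.
  by apply: eq_bigr => k _; rewrite mulrA.
apply: tameM; last exact: tameD.
by apply: tameD; [exact: tame_norm|exact: tame_cst].
Qed.

Let dom_le H x u w : `|u| <= H -> `|(S x w - u * v x) * wk x u w| <= dom H x w.
Proof.
move=> uH; rewrite normrM; apply: ler_pM => //.
  rewrite (le_trans (ler_normB _ _))// lerD2l normrM (ger0_norm (v_ge0 x)).
  by rewrite ler_wpM2r.
rewrite ger0_norm ?(ltW (wk_gt0 _ _ _))// wkE.
apply: (@le_trans _ _ (expR (u * S x w))).
  by rewrite ler_expR gerBl divr_ge0// mulr_ge0// sqr_ge0.
have us : u * S x w <= H * `|S x w|.
  by rewrite (le_trans (ler_norm _))// normrM ler_wpM2r.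
have [s0|s0] := leP 0 (S x w).
  rewrite ger0_norm// in us.
  by rewrite (le_trans (_ : _ <= expR (H * S x w))) ?ler_expR// lerDl expR_ge0.
rewrite ltr0_norm// mulrN -mulNr in us.
by rewrite (le_trans (_ : _ <= expR (- H * S x w))) ?ler_expR// lerDr expR_ge0.
Qed.

Let is_derive_unique (f : R -> R) (a d1 d2 : R) : is_derive a 1 f d1 -> is_derive a 1 f d2 ->
  d1 = d2.
Proof. by move=> [_ <-] [_ <-]. Qed.

Section integration_by_parts.
Variables (phi f : R -> R) (c c0 : R).
Hypothesis mphi : measurable_fun setT phi.
Hypothesis mf : measurable_fun setT f.
Hypothesis phi_le : forall l, 0 < l -> `|phi l| <= c.
Hypothesis f_le : forall l, 0 < l -> `|f l| <= c0.
Hypothesis dphi : forall l : R, 0 < l -> is_derive l 1 phi (f l).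

Let tphi (g : n.-tuple R -> R) : tame g -> (forall w, 0 < g w) -> tame (fun w => phi (g w)).
Proof.
move=> tg g0; apply: (@tame_bounded _ _ _ c); last by move=> w; exact: phi_le.
by apply: (measurableT_comp mphi); case: tg.
Qed.

Let tf (g : n.-tuple R -> R) : tame g -> (forall w, 0 < g w) -> tame (fun w => f (g w)).
Proof.
move=> tg g0; apply: (@tame_bounded _ _ _ c0); last by move=> w; exact: f_le.
by apply: (measurableT_comp mf); case: tg.
Qed.

Let Zs u x h w : R := savg (fun y => expR (u * h * dot y x) * wk y u w).

Let ZsE u x h w : Z u (tshift (fun k => h * t x k) w) = Zs u x h w.
Proof.
rewrite ZE; apply: eq_savg => y; rewrite /wk wick_shift; congr (expR _ * _).
by rewrite mulr_sumr; apply: eq_bigr => k _; ring.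
Qed.

(** E phi(Z_u) wick(h t_x) is differentiated at h = u in two ways: directly, and after
    Cameron-Martin has turned the Wick factor into a shift of the argument of [Z]. Equating the
    results is the integration by parts. *)
Let ibp x u : EX (fun w => phi (Z u w) * ((S x w - u * v x) * wk x u w)) =
  u * savg (fun y => dot y x * EX (fun w => f (Z u w) * (wk y u w * wk x u w))).
Proof.
have Zs_gt0 h w : 0 < Zs u x h w by rewrite -ZsE.
have tZs h : tame (Zs u x h) by apply: tame_savg => y; exact: tameZ.
have c00 : 0 <= c0 by apply: le_trans (f_le ltr01).
(* Only the strength of the Wick factor varies; [Z] stays at [u]. *)
pose J h := EX (fun w => phi (Z u w) * wk x h w).
have uI : u - 1 < u < u + 1 by rewrite ltrBlDr ltrDl ltr01.
have hI h : u - 1 < h < u + 1 -> `|h| <= `|u| + 1.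
  move=> /andP[h1 h2]; have := ler_norm u; have := ler_norm (- u); rewrite normrN.
  by move=> ? ?; rewrite ler_norml; apply/andP; split; lra.
have H0 : 0 <= `|u| + 1 by rewrite addr_ge0.
have dJ1 : is_derive u 1 J (EX (fun w => phi (Z u w) * ((S x w - u * v x) * wk x u w))).
  apply: (@is_derive_gexp _ _ _ gamE (fun h w => phi (Z u w) * wk x h w)
    (fun h w => phi (Z u w) * ((S x w - h * v x) * wk x h w)) (fun w => c * dom (`|u| + 1) x w)
      _ _ _ uI).
  - by move=> h _; apply: tameM => //; exact: tphi.
  - by apply: tameZ; exact: tdom.
  - move=> h w _; have := is_derive_wk x w h => dh; apply: is_derive_eq.
    by [].  
  - move=> h w /hI hu; rewrite normrM ler_pM// ?phi_le//.
    exact: dom_le.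
have JE h : J h = EX (fun w => phi (Zs u x h w)).
  rewrite /J -(gexp_shift gamE _ (tphi (tZ u) (Z_gt0 u))).
  by congr EX; apply/funext => w; rewrite ZsE.
pose dZs h w := savg (fun y => u * dot y x * (expR (u * h * dot y x) * wk y u w)).
have dJ2 : is_derive u 1 J (EX (fun w => f (Zs u x u w) * dZs u w)).
  rewrite (_ : J = fun h => EX (fun w => phi (Zs u x h w))); last by apply/funext => h; exact: JE.
  apply: (@is_derive_gexp _ _ _ gamE (fun h w => phi (Zs u x h w))
    (fun h w => f (Zs u x h w) * dZs h w)
    (fun w => c0 * savg (fun y => `|u * dot y x| * (expR (`|u * dot y x| * (`|u| + 1)) * wk y u
      w))) _ _ _ uI).
  - by move=> h _; exact: tphi.
  - by apply: tameZ; apply: tame_savg => y; apply: tameZ; exact: tameZ.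
  - move=> h w _.
    have d1 : is_derive h 1 (fun h => Zs u x h w) (dZs h w).
      apply: is_derive_savg => y; apply: is_derive_eq.
      by rewrite /GRing.scale/=; ring.
    have d2 := dphi (Zs_gt0 h w).
    have := @is_derive1_comp _ phi (fun h => Zs u x h w) h _ _ d2 d1.
    by [].
  - move=> h w /hI hu; rewrite normrM ler_pM// ?f_le//.
    apply: (le_trans (ler_norm_savg _)); apply: le_savg => y.
    rewrite normrM ler_wpM2l// normrM (ger0_norm (expR_ge0 _)) (ger0_norm (ltW (wk_gt0 _ _ _))).
    rewrite ler_wpM2r ?(ltW (wk_gt0 _ _ _))// ler_expR.
    rewrite (le_trans (ler_norm _))// mulrAC normrM ler_wpM2l//.
rewrite (is_derive_unique dJ1 dJ2).
(* At h = u the integrand is a shifted function again, so Cameron-Martin brings the Wick factor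
   back. *)
pose psi w := f (Z u w) * savg (fun y => u * dot y x * wk y u w).
have tpsi : tame psi.
  by apply: tameM; [exact: tf|apply: tame_savg => y; exact: tameZ].
have -> : (fun w => f (Zs u x u w) * dZs u w) = fun w => psi (tshift (fun k => u * t x k) w).
  apply/funext => w; rewrite /psi ZsE; congr (_ * _); apply: eq_savg => y.
  rewrite /wk wick_shift; congr (_ * (expR _ * _)).
  by rewrite mulr_sumr; apply: eq_bigr => k _; ring.
rewrite (gexp_shift gamE _ tpsi) -savgZ.
have tff y : tame (fun w => f (Z u w) * (wk y u w * wk x u w)).
  by apply: tameM; [exact: tf|exact: tameM].
transitivity (EX (fun w => savg (fun y => u * dot y x * (f (Z u w) * (wk y u w * wk x u w))))).
  congr EX; apply/funext => w; rewrite /psi -/(wk x u w) -savgZ -savgZr.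
  by apply: eq_savg => y; ring.
rewrite gexp_savg//; last by move=> y; exact: tameZ.
by apply: eq_savg => y; rewrite gexpZ// mulrA.
Qed.

Let dotE x y : dot x y = (overlap xpredT x y ^+ 2 / N%:R - 1) / 2.
Proof.
have Np : 0 < N%:R :> R by rewrite ltr0n.
rewrite /dot /t theta_dot// exprVn sqr_sqrtr ?ler0n//.
under [X in _ - X]eq_bigr => i _ do rewrite exprMn !sqr_spin mulr1.
rewrite sumr_const card_ord -[X in X *+ _]/1 -/(N%:R) -/(overlap xpredT x y).
by field; rewrite gt_eqF.
Qed.

(** The inner product of two signals is (M^2 / N - 1) / 2, so the replica average of [ibp] becomes
    half of B - L^2. *)
Lemma gexp_ibp u : EX (fun w => phi (Z u w) * D u w) =
  u / 2 * EX (fun w => f (Z u w) * (lr_overlap e1 e2 (u * s) w - Z u w ^+ 2)).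
Proof.
have tff x y : tame (fun w => f (Z u w) * (wk y u w * wk x u w)).
  by apply: tameM; [exact: tf|exact: tameM].
transitivity (savg (fun x => EX (fun w => phi (Z u w) * ((S x w - u * v x) * wk x u w)))).
  rewrite -gexp_savg//.
    by congr EX; apply/funext => w; rewrite savgZ.
  by move=> x; apply: tameM; [exact: tphi|exact: tDx].
under eq_savg do rewrite ibp.
rewrite savgZ -mulrA; congr (_ * _).
transitivity (EX (fun w => savg (fun x => savg (fun y => dot y x * (f (Z u w) * (wk y u w * wk
  x u w)))))).
  rewrite gexp_savg//; last by move=> x; apply: tame_savg => y; exact: tameZ.
  apply: eq_savg => x; rewrite gexp_savg//; last by move=> y; exact: tameZ.
  by apply: eq_savg => y; rewrite gexpZ//.
rewrite -gexpZ//; last first.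
  apply: tameM; first exact: tf.
  by apply: tameB; [exact: tame_lr_overlap|exact: tameX].
congr EX; apply/funext => w.
rewrite /lr_overlap lr_sq -savgB mulrCA -savgZ -savgZ; apply: eq_savg => x.
rewrite -savgB -savgZ -savgZ; apply: eq_savg => y.
have wkth z : wick (theta e1 e2 (u * s) (spin z)) w = wk z u w.
  congr (wick _ w); apply/funext => k.
  by rewrite /t /theta !mulrA.
rewrite !wkth (_ : dot y x = dot x y); last by apply: eq_bigr => k _; rewrite mulrC.
by rewrite dotE; ring.
Qed.

End integration_by_parts.

Variables lam eta : R.
Hypothesis lam_ge0 : 0 <= lam.
Hypothesis lam_lt1 : lam < 1.
Hypothesis eta_gt0 : 0 < eta.

Let T u : R := lr_mu lam - lr_mu (u ^+ 2) + eta.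
Let tau u : R := Num.sqrt (T u).
(** Chosen such that mu(lam') - mu(lam) <= eta / 2. On the open interval |u| < sqrt lam', which
    contains [0, sqrt lam], [T] stays above eta / 2, so the flow is differentiable at both end
    points too. *)
Let lam' : R := 1 - (1 - lam) * expR (- (2 * eta)).

Let lam'_lt1 : lam' < 1.
Proof. by rewrite gtrBl mulr_gt0 ?expR_gt0// subr_gt0. Qed.

Let lam_le' : lam < lam'.
Proof.
have h : (1 - lam) * expR (- (2 * eta)) < (1 - lam) * 1.
  by rewrite ltr_pM2l ?subr_gt0// expR_lt1 oppr_lt0 mulr_gt0.
by rewrite /lam'; lra.
Qed.

Let sq_lt u : - Num.sqrt lam' < u < Num.sqrt lam' -> u ^+ 2 < lam'.
Proof.
have l0 : 0 <= lam' by apply: ltW; apply: le_lt_trans lam_le'.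
move=> ul; rewrite -(sqr_sqrtr l0) -(real_normK (num_real u)).
by rewrite ltr_pXn2r ?nnegrE ?sqrtr_ge0// ltr_norml.
Qed.

Let T_ge u : - Num.sqrt lam' < u < Num.sqrt lam' -> eta / 2 <= T u.
Proof.
move=> /sq_lt ul; have m1 : lr_mu (u ^+ 2) <= lr_mu lam'.
  by apply: lr_mu_le; rewrite ?sqr_ge0// ltW.
have m2 : lr_mu lam' - lr_mu lam <= eta / 2.
  rewrite /lr_mu /lam' subKr lnM ?posrE ?expR_gt0 ?subr_gt0// expRK.
  by have := ltW lam_le'; rewrite /lam'; lra.
by rewrite /T; lra.
Qed.

Let T_gt0 u : - Num.sqrt lam' < u < Num.sqrt lam' -> 0 < T u.
Proof. by move=> /T_ge; apply: lt_le_trans; rewrite divr_gt0. Qed.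

Let dT u : R := - (u / 2) * ((1 - u ^+ 2)^-1 - 1).
Let dtau u : R := dT u / (2 * tau u).

Let is_derive_tau u : - Num.sqrt lam' < u < Num.sqrt lam' -> is_derive u 1 tau (dtau u).
Proof.
move=> ul; have u1 : 0 < 1 - u ^+ 2.
  by rewrite subr_gt0; apply: lt_trans lam'_lt1; exact: sq_lt.
have dln : is_derive u 1 (fun u => ln (1 - u ^+ 2)) ((1 - u ^+ 2)^-1 * (- (2 * u))).
  have d1 : is_derive u 1 (fun u => 1 - u ^+ 2) (- (2 * u)).
    by apply: is_derive_eq; rewrite /GRing.scale/=; ring.
  exact: (@is_derive1_comp _ (@ln R) (fun u => 1 - u ^+ 2) u _ _ (is_derive1_ln u1) d1).
have dTu : is_derive u 1 T (dT u).
  rewrite /T /lr_mu; apply: is_derive_eq; rewrite /GRing.scale/= /dT.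
  by field; rewrite gt_eqF.
have := @is_derive1_comp _ (@Num.sqrt R) T u _ _ (is_derive1_sqrt (T_gt0 ul)) dTu.
by rewrite mulrC.
Qed.

Let half_erfc_le (p : R) : `|2^-1 * erfc p| <= 1.
Proof.
have h0 := erfc_ge0 p; have h2 := erfc_le2 p.
by rewrite ger0_norm; lra.
Qed.

Let Phi u : R := EX (fun w => bs (tau u) (Z u w)).

(** The derivative of [bs] in l multiplies [D], and [gexp_ibp] turns this into (u / 2) bs_gamma (B -
    Z^2). The derivative in t adds dT bs_gamma Z^2, which changes the coefficient of Z^2 to 1 / (1 -
    u^2). *)
Let is_derive_Phi u : - Num.sqrt lam' < u < Num.sqrt lam' ->
  is_derive u 1 Phi (u / 2 * EX (fun w => bs_gamma (tau u) (Z u w) *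
    (lr_overlap e1 e2 (u * s) w - Z u w ^+ 2 / (1 - u ^+ 2)))).
Proof.
move=> uI.
pose r := Num.sqrt lam'.
have tau_gt0 h : - r < h < r -> 0 < tau h by move=> hI; rewrite sqrtr_gt0 T_gt0.
have tau_ge h : - r < h < r -> Num.sqrt (eta / 2) <= tau h.
  by move=> hI; rewrite ler_sqrt ?T_ge// ltW// T_gt0.
have se0 : 0 < Num.sqrt (eta / 2) by rewrite sqrtr_gt0 divr_gt0.
have spi := @sqrtpi_ge1 R.
have r0 : 0 <= r by rewrite sqrtr_ge0.
have r1 : r <= 1 by rewrite -[leRHS]sqrtr1 ler_sqrt// ltW.
have hr h : - r < h < r -> `|h| <= r by move=> hI; rewrite ltW// ltr_norml.
pose K := ((1 - lam')^-1 + 1) / Num.sqrt (eta / 2).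
have dtau_le h : - r < h < r -> `|dtau h| <= K.
  move=> hI; rewrite /dtau /dT normrM ler_pM//.
    have h2 := sq_lt hI; have h20 := sqr_ge0 h; have lam1 := lam'_lt1.
    have i1 : (1 - h ^+ 2)^-1 <= (1 - lam')^-1.
      by rewrite lef_pV2 ?posrE; lra.
    have i0 : 0 <= (1 - h ^+ 2)^-1 by rewrite invr_ge0; lra.
    rewrite normrM; apply: (@le_trans _ _ (1 * ((1 - lam')^-1 + 1))); last by rewrite mul1r.
    apply: ler_pM => //.
      rewrite normrN normrM (ger0_norm (_ : 0 <= 2^-1)) ?invr_ge0//.
      by have := hr h hI; lra.
    by rewrite (le_trans (ler_normB _ _))// normr1 (ger0_norm i0) lerD2r.
  rewrite ger0_norm; last by rewrite invr_ge0 mulr_ge0// ltW// tau_gt0.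
  rewrite lef_pV2 ?posrE ?mulr_gt0 ?tau_gt0//.
  by have := tau_ge h hI; lra.
pose P h w := 2^-1 * erfc (bs_p (tau h) (Z h w)) * D h w.
pose Q h w := (Num.sqrt pi)^-1 * expR (- (tau h - bs_p (tau h) (Z h w)) ^+ 2) * dtau h.
pose G w := savg (fun x => dom r x w) + K.
have tG : tame G by apply: tameD; [exact: tame_savg|exact: tame_cst].
have tbs h : tame (fun w => bs (tau h) (Z h w)).
  apply: (@tame_le _ _ _ (fun w => Z h w + 1)).
  - apply: (measurableT_comp (measurable_bs _)); by case: (tZ h).
  - by apply: tameD => //; exact: tame_cst.
  - move=> w; rewrite [leRHS]ger0_norm; first exact: bs_le.
    by rewrite addr_ge0// ltW.
have d1 : is_derive u 1 Phi (EX (fun w => P u w - Q u w)).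
  apply: (@is_derive_gexp _ _ _ gamE (fun h w => bs (tau h) (Z h w))
    (fun h w => P h w - Q h w) G _ _ _ uI) => //.
  - move=> h w hI; apply: is_derive_bs => //; first exact: tau_gt0.
    exact: is_derive_tau.
  - move=> h w hI; rewrite (le_trans (ler_normB _ _))// lerD//.
      rewrite /P normrM -[leRHS]mul1r ler_pM ?half_erfc_le//.
      apply: (le_trans (ler_norm_savg _)); apply: le_savg => x.
      by apply: dom_le; exact: hr.
    rewrite /Q normrM -[leRHS]mul1r ler_pM ?dtau_le//.
    rewrite ger0_norm ?mulr_ge0 ?invr_ge0 ?expR_ge0 ?sqrtr_ge0//.
    rewrite mulr_ile1 ?invr_ge0 ?expR_ge0 ?sqrtr_ge0//.
      by rewrite invf_le1// (lt_le_trans ltr01).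
    by rewrite -expR0 ler_expR lerNl oppr0 sqr_ge0.
apply: (is_derive_eq d1).
have t0 := tau_gt0 u uI.
have tP : tame (P u).
  apply: tameM => //; apply: (@tame_bounded _ _ _ 1).
    apply: (measurableT_comp (measurable_bs_delta _)); by case: (tZ u).
  by move=> w; exact: half_erfc_le.
have tgam : tame (fun w => bs_gamma (tau u) (Z u w)).
  apply: (@tame_bounded _ _ _ (bs_gamma_bound (tau u))).
    apply: (measurableT_comp (measurable_bs_gamma _)); by case: (tZ u).
  by move=> w; exact: bs_gamma_le.
(* The heat equation of [bs]: its derivative in t is 2 t l^2 bs_gamma, and 2 tau dtau = dT. *)
have QE w : Q u w = - (dT u * (bs_gamma (tau u) (Z u w) * Z u w ^+ 2)).
  rewrite /Q -bs_p_expR// /bs_gamma expRD (expRN (ln _)) lnK ?posrE// /dtau.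
  field; rewrite !gt_eqF//.
  by rewrite (lt_le_trans ltr01).
have tgZ : tame (fun w => bs_gamma (tau u) (Z u w) * Z u w ^+ 2).
  by apply: tameM => //; exact: tameX.
have tgB : tame (fun w => bs_gamma (tau u) (Z u w) * (lr_overlap e1 e2 (u * s) w - Z u w ^+ 2)).
  by apply: tameM => //; apply: tameB; [exact: tame_lr_overlap|exact: tameX].
transitivity (EX (P u) + dT u * EX (fun w => bs_gamma (tau u) (Z u w) * Z u w ^+ 2)).
  rewrite -(gexpZ gamE _ tgZ) -gexpD//; last exact: tameZ.
  by congr EX; apply/funext => w; rewrite QE opprK.
have IB := @gexp_ibp (fun l => 2^-1 * erfc (bs_p (tau u) l)) (bs_gamma (tau u)) 1
  (bs_gamma_bound (tau u)) (measurable_bs_delta _) (measurable_bs_gamma _)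
  (fun l _ => half_erfc_le _) (fun l l0 => bs_gamma_le t0 l0)
  (fun l l0 => is_derive_bs_delta t0 l0) u.
rewrite [EX (P u)]IB /dT -(gexpZ gamE _ tgB) -(gexpZ gamE _ tgZ).
rewrite -gexpD; [|by []|exact: tameZ|exact: tameZ].
rewrite -gexpZ//; last first.
  apply: tameM => //; apply: tameB; first exact: tame_lr_overlap.
  by apply: tameM; [exact: tameX|exact: tame_cst].
by congr EX; apply/funext => w; ring.
Qed.

Local Opaque gexp expR bs erfc.

(** Along the flow tau^2 lies between eta / 2 and mu(lam) + eta, so [b] bounds [bs_gamma] and [b1]
    is its Lipschitz constant in the relative increment. The rest is the constant of
    [cavity_estimate] at u^2 = lam. *)
Definition flow_const (C : R) : R :=
  let b := expR (2 * (lr_mu lam + eta)) / Num.sqrt (eta / 2) in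
  let b1 := b * (4 + 2 / Num.sqrt (eta / 2)) in
  (2 * expR 1 * b + 100 * b1 * expR 6 + 3 * b) * C / (1 - lam).

Lemma flow_estimate (C : R) : 0 < C ->
  (forall (P : pred 'I_N) (k : R), 0 <= k -> k * N%:R <= lam ->
    savg (fun x => savg (fun y => (N%:R ^+ 2 + overlap P x y ^+ 4) *
      expR (k * overlap P x y ^+ 2 / 2))) <= C * N%:R ^+ 2) ->
  `|EX (fun w => bs (Num.sqrt eta) (lr e1 e2 (Num.sqrt (lam / N%:R)) w)) -
    erfc (Num.sqrt (lr_mu lam + eta) / 2)| <= flow_const C / Num.sqrt N%:R.
Proof.
move=> C0 mom.
have Np : 0 < N%:R :> R by rewrite ltr0n.
have s2 : s ^+ 2 * N%:R = 1.
  by rewrite /s exprVn sqr_sqrtr ?(ltW Np)// mulVf// gt_eqF.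
have mu0 : lr_mu 0 = 0 :> R by rewrite /lr_mu !subr0 ln1; ring.
have mu_ge0 : 0 <= lr_mu lam by rewrite -mu0 lr_mu_le.
pose a := Num.sqrt lam; have a0 : 0 <= a by exact: sqrtr_ge0.
have a2 : a ^+ 2 = lam by rewrite sqr_sqrtr.
have ar : a < Num.sqrt lam' by rewrite ltr_sqrt// (le_lt_trans lam_ge0 lam_le').
have r0 : - Num.sqrt lam' < 0 by rewrite oppr_lt0; exact: le_lt_trans ar.
have inI u : 0 <= u <= a -> - Num.sqrt lam' < u < Num.sqrt lam'.
  by move=> /andP[u0 ua]; rewrite (lt_le_trans r0)//= (le_lt_trans ua).
have Phi_a : Phi a = EX (fun w => bs (Num.sqrt eta) (lr e1 e2 (Num.sqrt (lam / N%:R)) w)).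
  have tau_a : tau a = Num.sqrt eta by rewrite /tau /T a2 subrr add0r.
  have as_ : a * s = Num.sqrt (lam / N%:R) by rewrite /s sqrtrM// sqrtrV// ler0n.
  by rewrite /Phi tau_a /Z as_.
have Phi_0 : Phi 0 = erfc (Num.sqrt (lr_mu lam + eta) / 2).
  have tau_0 : tau 0 = Num.sqrt (lr_mu lam + eta) by rewrite /tau /T expr0n/= mu0 subr0.
  have Z_0 w : Z 0 w = 1.
    rewrite ZE -[RHS](savg_const N); apply: eq_savg => x.
    by rewrite wkE !mul0r expr0n/= !mul0r subrr expR0.
  rewrite /Phi tau_0 (_ : (fun w => bs _ _) = fun _ => bs (Num.sqrt (lr_mu lam + eta)) 1).
    rewrite (gexp_cst gam) bs1; first by [].
    by rewrite sqrtr_gt0; exact: ltr_wpDl.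
  by apply/funext => w; rewrite Z_0.
rewrite -Phi_a -Phi_0 {Phi_a Phi_0}.
pose d u := u / 2 * EX (fun w => bs_gamma (tau u) (Z u w) *
    (lr_overlap e1 e2 (u * s) w - Z u w ^+ 2 / (1 - u ^+ 2))).
have cP : {within `[0, a], continuous Phi}.
  apply: derivable_within_continuous => u; rewrite in_itv/= => uI.
  by have := is_derive_Phi (inI u uI) => h.
have dP u : u \in `]0, a[ -> is_derive u 1 Phi (d u).
  rewrite in_itv/= => /andP[u0 ua]; apply: is_derive_Phi; apply: inI.
  by rewrite !ltW.
(* The length sqrt lam of the interval and the factor u / 2 are at most 1, so the cavity bound at
   the intermediate point bounds the whole increment. *)
have [u] := MVT_segment a0 dP cP; rewrite in_itv/= => uI ->.
have /andP[u0 ua] := uI; have uI' := inI u uI.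
have u2 : u ^+ 2 <= lam by rewrite -a2 ler_pXn2r.
have kap2 : (u * s) ^+ 2 * N%:R = u ^+ 2 by rewrite exprMn -mulrA s2 mulr1.
have t0 : 0 < tau u by rewrite sqrtr_gt0 T_gt0.
pose e := Num.sqrt (eta / 2); have e0 : 0 < e by rewrite sqrtr_gt0 divr_gt0.
have te : e <= tau u by rewrite ler_sqrt ?T_ge// ltW// T_gt0.
have t2 : tau u ^+ 2 <= lr_mu lam + eta.
  rewrite sqr_sqrtr; last by rewrite ltW// T_gt0.
  have : lr_mu 0 <= lr_mu (u ^+ 2).
    by rewrite lr_mu_le ?sqr_ge0// (le_lt_trans u2).
  by rewrite /T mu0; lra.
pose b := expR (2 * (lr_mu lam + eta)) / e.
have be : bs_gamma_bound (tau u) <= b.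
  by rewrite ler_pM ?expR_ge0 ?invr_ge0 ?(ltW t0)// ?ler_expR ?ler_pM2l// lef_pV2.
have b0 : 0 <= b by rewrite divr_ge0 ?expR_ge0// ltW.
have te1 : 4 + 2 / tau u <= 4 + 2 / e by rewrite lerD2l ler_pM2l// lef_pV2.
have te0 : 0 <= 4 + 2 / tau u by rewrite addr_ge0// divr_ge0// ltW.
have g0 : 0 <= bs_gamma_bound (tau u) by rewrite divr_ge0 ?expR_ge0// ltW.
have momk P : savg (fun x => savg (fun y => (N%:R ^+ 2 + overlap P x y ^+ 4) *
    expR ((u * s) ^+ 2 * overlap P x y ^+ 2 / 2))) <= C * N%:R ^+ 2.
  by apply: mom; rewrite ?sqr_ge0// kap2.
have := @cavity_estimate R N n e1 e2 eP gam (u * s) gamE N0 C C0 momk _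
  (bs_gamma (tau u)) b (b * (4 + 2 / e)) (measurable_bs_gamma _) _ _ _.
rewrite !kap2 => est.
have {}est : `|EX (fun w => bs_gamma (tau u) (Z u w) *
    (lr_overlap e1 e2 (u * s) w - Z u w ^+ 2 / (1 - u ^+ 2)))| <= flow_const C / Num.sqrt N%:R.
  apply: le_trans (est _ _ _ _) _.
  - exact: le_lt_trans u2 lam_lt1.
  - by move=> l l0; apply: le_trans (bs_gamma_le t0 l0) be.
  - by rewrite mulr_ge0// addr_ge0// divr_ge0// ltW.
  - move=> l l' l0 l'0; apply: (le_trans (bs_gamma_lip t0 l0 l'0)).
    by rewrite ler_wpM2r// ler_pM.
  rewrite ler_wpM2r ?invr_ge0 ?sqrtr_ge0// /flow_const -/e -/b.
  rewrite ler_wpM2l//; last first.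
    by rewrite lef_pV2 ?posrE; have := lam_lt1; lra.
  have x0 : 0 <= 4 + 2 / e by rewrite addr_ge0// divr_ge0// ltW.
  have x1 : 0 <= 100 * (b * (4 + 2 / e)) * expR 6.
    by rewrite mulr_ge0 ?expR_ge0// mulr_ge0// mulr_ge0.
  have x2 : 0 <= 2 * expR 1 * b by rewrite mulr_ge0// mulr_ge0// expR_ge0.
  apply: mulr_ge0; last exact: ltW.
  by apply: addr_ge0; [exact: addr_ge0|exact: mulr_ge0].
have a1 : a <= 1 by rewrite -[leRHS]sqrtr1 ler_sqrt// ltW.
have h1 : `|u / 2| <= 1 by rewrite ger0_norm; lra.
have h2 : `|a| <= 1 by rewrite ger0_norm.
rewrite subr0 normrM /d normrM -[leRHS]mulr1 -[X in _ <= X * _]mul1r.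
by apply: ler_pM => //; apply: ler_pM.
Qed.

End flow.

(** * Risk and total variation of a likelihood ratio *)

Section risk_of_likelihood_ratio.
Context {R : realType} d (T : measurableType d) (P0 P1 : probability T R) (L : T -> R).
Hypothesis mL : measurable_fun setT L.
Hypothesis L0 : forall x, 0 <= L x.
Hypothesis P1E : forall A, measurable A -> (P1 A = \int[P0]_(x in A) (L x)%:E)%E.

Local Open Scope ereal_scope.

Let m (x : T) : R := Num.min 1%R (L x).

Let mm : measurable_fun setT m.
Proof. exact: measurable_minr. Qed.

Let m0 x : (0 <= m x)%R. Proof. by rewrite le_min ler01 L0. Qed.

Let mU A : measurable A ->
  \int[P0]_x (m x)%:E = \int[P0]_(x in A) (m x)%:E + \int[P0]_(x in ~` A) (m x)%:E.
Proof.
move=> mA; rewrite -(setUv A) ge0_integral_setU//.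
- exact: measurableC.
- by apply/measurable_EFinP; rewrite setUv.
- by move=> x _; rewrite lee_fin.
- by rewrite disj_set2E setICr.
Qed.

Let int1 A : measurable A -> \int[P0]_(x in A) (1%R)%:E = P0 A.
Proof. by move=> mA; rewrite integral_cst// mul1e. Qed.

(** min(1, L) is at most 1 on [A] and at most L off [A]; for A = {L > 1} both become equalities,
    which is [risk_eq]. *)
Let risk_ge A : measurable A -> \int[P0]_x (m x)%:E <= P1 (~` A) + P0 A.
Proof.
move=> mA; have mA' := measurableC mA; rewrite (mU mA) addeC leeD//.
  rewrite P1E//; apply: ge0_le_integral => //.
  - by move=> x _; rewrite lee_fin.
  - by apply/measurable_EFinP; exact: measurable_funTS.
  - by apply/measurable_EFinP; exact: measurable_funTS.
  - by move=> x _; rewrite lee_fin ge_min lexx orbT.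
rewrite -int1//; apply: ge0_le_integral => //.
- by move=> x _; rewrite lee_fin.
- by apply/measurable_EFinP; exact: measurable_funTS.
- by move=> x _; rewrite lee_fin ge_min lexx.
Qed.

Let A0 : set T := [set x | (1 < L x)%R].

Let mA0 : measurable A0.
Proof.
rewrite (_ : A0 = setT `&` L @^-1` `]1%R, +oo[); first exact: mL.
by rewrite setTI; apply/seteqP; split => x /=; rewrite in_itv/= andbT.
Qed.

Let risk_eq : \int[P0]_x (m x)%:E = P1 (~` A0) + P0 A0.
Proof.
have mA' := measurableC mA0; rewrite (mU mA0) addeC; congr (_ + _).
  rewrite P1E//; apply: eq_integral => x /set_mem nAx.
  have Lx : (L x <= 1)%R by rewrite leNgt; apply/negP.
  by rewrite /m min_r.
rewrite -int1//; apply: eq_integral => x /set_mem Lx.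
by rewrite /m min_l// ltW.
Qed.

Lemma minimal_risk_likelihood_ratio : minimal_risk P0 P1 = \int[P0]_x (m x)%:E.
Proof.
apply/eqP; rewrite eq_le; apply/andP; split.
  have mt : measurable_fun setT (fun x => (1 < L x)%R).
    apply: (@measurable_fun_bool _ _ _ _ true).
    by rewrite setTI (_ : _ @^-1` _ = A0)//; apply/seteqP; split => x /=; case: (1 < L x)%R.
  pose t : {mfun T >-> bool} := HB.pack (fun x => (1 < L x)%R) (isMeasurableFun.Build _ _ _ _ _ mt).
  apply: ereal_inf_lbound; exists t => //.
  rewrite risk_eq /testing_risk; congr (P1 _ + P0 _).
    by apply/seteqP; split => x /=; rewrite /A0/=; case: (1 < L x)%R.
apply: le_ereal_inf_tmp => _ [t _ <-].
have mt : measurable (t @^-1` [set true]).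
  by rewrite -[X in measurable X]setTI; exact: measurable_funP.
rewrite /testing_risk (_ : t @^-1` [set false] = ~` (t @^-1` [set true])).
  exact: risk_ge.
by apply/seteqP; split => x /=; case: (t x).
Qed.

Lemma tv_distance_likelihood_ratio : tv_distance P1 P0 = 1 - \int[P0]_x (m x)%:E.
Proof.
have finm : \int[P0]_x (m x)%:E \is a fin_num.
  rewrite ge0_fin_numE; last by apply: integral_ge0 => x _; rewrite lee_fin.
  rewrite risk_eq -ge0_fin_numE ?adde_ge0// fin_numD !fin_num_measure//.
  exact: measurableC.
have key A : measurable A -> P1 A - P0 A <= 1 - \int[P0]_x (m x)%:E.
  move=> mA; have := risk_ge mA; rewrite probability_setC//.
  rewrite -(fineK (fin_num_measure P1 _ mA)) -(fineK (fin_num_measure P0 _ mA)).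
  by rewrite -(fineK finm) -!EFinB -EFinD !lee_fin; lra.
apply/eqP; rewrite eq_le; apply/andP; split.
  apply: ge_ereal_sup => _ [A mA <-].
  (* Passing to the complement changes the sign of P1 A - P0 A, so the one-sided bound controls the
     absolute value. *)
  have := key A mA; have := key (~` A) (measurableC mA).
  rewrite !probability_setC//.
  rewrite -(fineK (fin_num_measure P1 _ mA)) -(fineK (fin_num_measure P0 _ mA)).
  rewrite -(fineK finm) -!EFinB abse_EFin !lee_fin => h1 h2.
  by rewrite ler_norml; apply/andP; split; lra.
apply: (@le_trans _ _ `|P1 A0 - P0 A0|); last by apply: ereal_sup_ubound; exists A0.
apply: le_trans (lee_abs _).
rewrite risk_eq probability_setC//.
rewrite -(fineK (fin_num_measure P1 _ mA0)) -(fineK (fin_num_measure P0 _ mA0)).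
by rewrite -!EFinB lee_fin; lra.
Qed.

End risk_of_likelihood_ratio.

(** * The likelihood ratio of the spiked model *)

Section law.
Context {R : realType} d (Omega : measurableType d) (Pr : probability Omega R).
Context (N : nat) (x : 'I_N -> {RV Pr >-> R}) (W : upper_pair N -> {RV Pr >-> R}).
Hypothesis model : spiked_wigner_model x W.

Local Notation n := #|{: upper_pair N}|.
Local Notation Y := (fun l => observation l x W).
Local Notation gam := (observation_law 0 x W).

Lemma tnth_observation0 k w : tnth (Y 0 w) k = W (enum_val k) w.
Proof. by rewrite tnth_mktuple /= mul0r sqrtr0 !mul0r add0r. Qed.

Let preimage_measurable (X : {RV Pr >-> R}) (A : set R) : measurable A ->
  measurable (X @^-1` A).
Proof. by move=> mA; rewrite -[X in measurable X]setTI; exact: measurable_funP. Qed.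

Definition spike_event (S : 'I_N -> set R) : set Omega :=
  \bigcap_(i in [set: 'I_N]) x i @^-1` S i.

Lemma measurable_spike_event S : (forall i, measurable (S i)) ->
  measurable (spike_event S).
Proof.
by move=> mS; apply: fin_bigcap_measurable => // i _; exact: preimage_measurable.
Qed.

(** At lambda = 0 the observation on the same probability space is the noise itself, so this is the
    joint independence of the spike and the noise, reindexed by the enumeration of the pairs. *)
Lemma joint_law (S : 'I_N -> set R) (A : 'I_n -> set R) :
  (forall i, measurable (S i)) -> (forall k, measurable (A k)) ->
  Pr (Y 0 @^-1` rect A `&` spike_event S) =
  ((\prod_i rademacher (S i)) * \prod_k normal_prob 0 1 (A k))%E.
Proof.
move=> mS mA; have [indep xE WE] := model.
pose B (s : 'I_N + upper_pair N) :=
  match s with inl i => S i | inr p => A (enum_rank p) end.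
have mB s : measurable (B s) by case: s => [i|p]; [exact: mS|exact: mA].
have := indep [set: 'I_N + upper_pair N]%SET B mB.
rewrite (_ : \bigcap_(i in _) _ = Y 0 @^-1` rect A `&` spike_event S); last first.
  apply/seteqP; split => [w h|w [h1 h2] [i|p] _].
  - split => [k|i _]; last by apply: (h (inl i)); rewrite /= inE.
    have := h (inr (enum_val k)); rewrite /= enum_valK tnth_observation0; apply.
    by rewrite inE.
  - exact: h2.
  - by have := h1 (enum_rank p); rewrite tnth_observation0 enum_rankK.
move=> ->; rewrite (eq_bigl xpredT); last by move=> s; rewrite inE.
rewrite big_sumType/=; congr (_ * _)%E.
  by apply: eq_bigr => i _; exact: xE.
rewrite (reindex (fun k : 'I_n => enum_val k : upper_pair N))/=; last first.
  by exists enum_rank => k _; [exact: enum_valK|exact: enum_rankK].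
by apply: eq_bigr => k _; rewrite enum_valK; exact: WE.
Qed.

Lemma iid_normal_noise : iid_normal gam.
Proof.
move=> A mA; have := joint_law (fun=> @measurableT _ _) mA.
rewrite (_ : spike_event _ = setT); last by apply/seteqP; split.
rewrite setIT big1 ?mul1e// => i _.
by rewrite /rademacher !diracT !mule1 -EFinD; congr (_%:E); lra.
Qed.

Definition spike_is (xi : spins N) : set Omega := spike_event (fun i => [set spin xi i]).

Lemma measurable_spike_is xi : measurable (spike_is xi).
Proof. by apply: measurable_spike_event => i; exact: measurable_set1. Qed.


Let c0 : 0 <= 2^-N :> R. Proof. by rewrite invr_ge0 exprn_ge0. Qed.

(** Both sides are measures in [A]; on rectangles the identity is [joint_law] with singletons, each
    spin contributing 1/2. *)
Lemma noise_spike_is xi A : measurable A ->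
  Pr (Y 0 @^-1` A `&` spike_is xi) = ((2^-N)%:E * gam A)%E.
Proof.
have mY := measurable_observation 0 x W.
pose m1 := measure_function_pushforward__canonical__measure_function_Measure
  (mrestr Pr (measurable_spike_is xi)) mY.
pose m2 := mscale (NngNum c0) gam.
move: A; change (forall A, measurable A -> m1 A = m2 A).
apply: tuple_measure_unique => [|A mA].
  rewrite /m1/= /pushforward /mrestr preimage_setT setTI.
  apply: le_lt_trans (ltry 1); apply: probability_le1.
  exact: measurable_spike_is.
rewrite [LHS]joint_law// -[RHS]/((2^-N)%:E * gam (rect A))%E.
rewrite iid_normal_noise//; congr (_ * _)%E.
rewrite (eq_bigr (fun=> (2^-1)%:E)) => [|i _].
  by rewrite prodEFin prodr_const card_ord exprVn.
have n1 : (-1 : R) <> 1 by lra.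
have s1 (a : R) : a \in [set a] by exact: mem_set.
rewrite /rademacher !diracE /spin.
case: (xi i); rewrite ?expr1 ?expr0 s1 memNset//= ?mule1 ?mule0 ?adde0 ?add0e//.
by move=> /esym.
Qed.

Lemma trivIset_spike_is (A : set Omega) :
  trivIset setT (fun xi : spins N => A `&` spike_is xi).
Proof.
apply/trivIsetP => xi ze _ _ /eqP xize; apply/seteqP; split => // w [[_ h] [_ h']].
case: xize; apply/ffunP => i; apply: (@signr_inj R).
by rewrite -[LHS](h i I) (h' i I).
Qed.

Let fin_sum (f : spins N -> \bar R) : (\sum_(xi \in setT) f xi = \sum_xi f xi)%E.
Proof.
rewrite (fsbigE (index_enum (spins N))) ?index_enum_uniq//.
  by apply: eq_bigl => xi; rewrite in_setT.
by move=> xi _; rewrite mem_index_enum.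
Qed.

(** The x_i are signs only almost surely. The events [spike_is] are disjoint and their 2^N
    probabilities 2^-N add up to 1, so the remaining event is null. *)
Lemma spike_decomposition A : measurable A ->
  (Pr A = \sum_xi Pr (A `&` spike_is xi))%E.
Proof.
have sumE B : measurable B -> (\sum_xi Pr (B `&` spike_is xi) =
    Pr (\bigcup_(xi in [set: spins N]) (B `&` spike_is xi)))%E.
  move=> mB; rewrite measure_fin_bigcup ?fin_sum//.
  - exact: finite_finset.
  - exact: trivIset_spike_is.
  - by move=> xi _; apply: measurableI => //; exact: measurable_spike_is.
have U1 : Pr (\bigcup_(xi in [set: spins N]) spike_is xi) = 1%E.
  under eq_bigcupr do rewrite -[spike_is _]setTI.
  rewrite -sumE//.
  rewrite (eq_bigr (fun=> (2^-N)%:E)) => [|xi _].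
    rewrite sumEFin sumr_const card_ffun card_bool card_ord -[_ *+ (2 ^ N)]mulr_natl natrX.
    by rewrite divff// expf_neq0.
  rewrite -[setT](preimage_setT (Y 0)) noise_spike_is//.
  by rewrite probability_setT mule1.
move=> mA; rewrite sumE// -setI_bigcupr.
have mU : measurable (\bigcup_(xi in [set: spins N]) spike_is xi).
  by apply: fin_bigcup_measurable => [|xi _]; [exact: finite_finset|exact: measurable_spike_is].
have UC : Pr (~` \bigcup_(xi in [set: spins N]) spike_is xi) = 0%E.
  by rewrite probability_setC// U1 subee.
rewrite (measureDI Pr mA mU) [X in (X + _)%E = _](_ : _ = 0%E) ?add0e//.
apply: (subset_measure0 _ _ _ UC); [exact: measurableD|exact: measurableC|].
exact: subIsetr.
Qed.

(** On [spike_is xi] the observation is the noise shifted by the signal of [xi], and the noise is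
    independent of this event; Cameron-Martin turns each shift into a Wick density, and their
    average is [lr]. *)
Lemma likelihood_ratio_observation l A : measurable A ->
  (observation_law l x W A =
   \int[gam]_(w in A) (lr (@end1 N) (@end2 N) (Num.sqrt (l / N%:R)) w)%:E)%E.
Proof.
move=> mA; set kap := Num.sqrt _.
pose s (xi : spins N) := theta (@end1 N) (@end2 N) kap (spin xi).
have mYA : measurable (Y l @^-1` A).
  by rewrite -[X in measurable X]setTI; exact: measurable_observation.
have mW xi : measurable_fun setT (fun w => (wick (s xi) w)%:E).
  by apply/measurable_EFinP; exact: measurable_wick.
rewrite [LHS](spike_decomposition mYA).
transitivity (\sum_xi (2^-N)%:E * \int[gam]_(w in A) (wick (s xi) w)%:E)%E.
  apply: eq_bigr => xi _.
  have mT : measurable (tshift (s xi) @^-1` A).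
    by rewrite -[X in measurable X]setTI; exact: measurable_tshift.
  rewrite (_ : _ `&` _ = Y 0 @^-1` (tshift (s xi) @^-1` A) `&` spike_is xi).
    rewrite noise_spike_is//; congr (_ * _)%E.
    rewrite -[tshift _ @^-1` A]setIT -integral_indic//.
    rewrite (_ : (fun w => _) = (fun w => (\1_A (tshift (s xi) w))%:E))//.
    rewrite (cameron_martin iid_normal_noise _ (f := fun w => (\1_A w)%:E)).
    - rewrite [RHS]integral_mkcond; apply: eq_integral => w _.
      rewrite /patch indicE; case: ifPn => wA; first by rewrite mul1e.
      by rewrite mul0e.
    - by apply/measurable_EFinP; exact: measurable_indic.
    - by move=> w; rewrite lee_fin.
  suff E w : spike_is xi w -> Y l w = tshift (s xi) (Y 0 w).
    by apply/seteqP; split => w [h xiw]; split => //; move: h; rewrite /= E.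
  move=> xiw; apply: eq_from_tnth => k; rewrite tnth_mktuple [RHS]tnth_mktuple tnth_observation0.
  by rewrite /= (xiw (end1 k) I) (xiw (end2 k) I) addrC.
under eq_bigr => xi _.
  rewrite -ge0_integralZl//.
    over.
  - exact: measurable_funTS.
  - by move=> w _; rewrite lee_fin ltW// wick_gt0.
rewrite -ge0_integral_sum//.
- apply: eq_integral => w _; rewrite /lr /savg mulr_sumr -sumEFin.
  by apply: eq_bigr => xi _; rewrite EFinM.
- by move=> xi; apply: measurable_funTS; exact: emeasurable_funM.
- by move=> xi w _; rewrite mule_ge0// lee_fin ltW// wick_gt0.
Qed.


End law.

Local Opaque gexp expR bs erfc.

(** * Passage to the limit *)

Section truncated_mean.
Context {R : realType} (N n : nat) (e1 e2 : 'I_n -> 'I_N).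
Variables (gam : probability (n.-tuple R) R) (kap : R).
Hypothesis gamE : iid_normal gam.
Local Notation EX := (gexp gam).
Local Notation L := (lr e1 e2 kap).

Lemma tame_min_lr : tame (fun w => Num.min 1 (L w)).
Proof.
apply: (tame_le _ (@tame_lr R N n e1 e2 kap)).
  by apply: measurable_minr => //; case: (@tame_lr R N n e1 e2 kap).
have L0 := lr_gt0 e1 e2 kap.
move=> w; have m0 : 0 <= Num.min 1 (L w) by rewrite le_min ler01 ltW.
by rewrite (ger0_norm m0) (gtr0_norm (L0 w)) ge_min lexx orbT.
Qed.

Lemma tame_bs_lr t : tame (fun w => bs t (L w)).
Proof.
have tL := @tame_lr R N n e1 e2 kap; have L0 := lr_gt0 e1 e2 kap.
apply: (@tame_le _ _ _ (fun w => L w + 1)).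
- by apply: measurableT_comp; [exact: measurable_bs|case: tL].
- by apply: tameD => //; exact: tame_cst.
- move=> w; apply: le_trans (bs_le t (L0 w)) _; exact: ler_norm.
Qed.

Lemma gexp_lr : EX L = 1.
Proof.
rewrite /lr (gexp_savg gamE) => [|x]; last exact: tame_wick.
rewrite -[RHS](savg_const N); apply: eq_savg => x; exact: (gexp_wick gamE).
Qed.

(** The pointwise error is at most t (1 + L), and L has mean 1. *)
Lemma gexp_bs_approx t : 0 < t ->
  `|EX (fun w => bs t (L w)) - EX (fun w => Num.min 1 (L w))| <= 2 * t.
Proof.
move=> t0; have L0 := lr_gt0 e1 e2 kap; have tL := @tame_lr R N n e1 e2 kap.
have tD := tameB (tame_bs_lr t) tame_min_lr.
have t1 : tame (fun w => 1 + L w) by apply: tameD => //; exact: tame_cst.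
rewrite -(gexpB gamE (tame_bs_lr t) tame_min_lr).
apply: le_trans (le_normr_gexp gamE tD) _.
have -> : 2 * t = EX (fun w => t * (1 + L w)).
  by rewrite (gexpZ gamE _ t1) (gexpD gamE (tame_cst n 1) tL) (gexp_cst gam) gexp_lr; lra.
apply: (le_gexp gamE (tame_norm tD) (tameZ t t1)) => w; exact: bs_approx.
Qed.

End truncated_mean.

Lemma sqrtr_add_le {R : realType} (a t : R) : 0 <= a -> 0 <= t ->
  Num.sqrt (a + t ^+ 2) <= Num.sqrt a + t.
Proof.
move=> a0 t0; rewrite -[leRHS]ger0_norm ?addr_ge0 ?sqrtr_ge0// -sqrtr_sqr.
have := sqr_sqrtr a0; have := sqrtr_ge0 a; move: (Num.sqrt a) => s s0 sa.
by rewrite ler_wsqrtr//; nra.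
Qed.

Lemma truncated_mean_limit {R : realType} (lam e : R) : 0 <= lam -> lam < 1 -> 0 < e ->
  exists N0, forall (N n : nat) (e1 e2 : 'I_n -> 'I_N) (gam : probability (n.-tuple R) R),
    enumerates_pairs (R := R) e1 e2 -> iid_normal gam -> (N0 < N)%N ->
    `|erfc (Num.sqrt (lr_mu lam) / 2) -
      gexp gam (fun w => Num.min 1 (lr e1 e2 (Num.sqrt (lam / N%:R)) w))| <= e.
Proof.
move=> lam0 lam1 e0; have [C [C0 mom]] := overlap_moment lam0 lam1.
(* With eta = t^2 the smoothing costs 2 t, the flow e / 2, and replacing mu + eta by mu costs t; the
   total is e. *)
pose t := e / 6; have t0 : 0 < t by rewrite divr_gt0.
have tt0 : 0 < t ^+ 2 by rewrite exprn_gt0.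
pose K := flow_const lam (t ^+ 2) C.
have mu0 : 0 <= lr_mu lam.
  have mu0 : lr_mu 0 = 0 :> R by rewrite /lr_mu !subr0 ln1; ring.
  by rewrite -mu0 lr_mu_le.
(* Any N beyond (2 K / e)^2 makes K / sqrt N at most e / 2. *)
exists (Num.truncn ((2 * K / e) ^+ 2)) => N n e1 e2 gam eP gamE N0N.
have Np : (0 < N)%N by exact: leq_ltn_trans N0N.
have := flow_estimate eP gamE Np lam0 lam1 tt0 C0 (fun P k => mom N P k Np).
rewrite sqrtr_sqr (ger0_norm (ltW t0)) -/K.
have := gexp_bs_approx e1 e2 (Num.sqrt (lam / N%:R)) gamE t0.
have KN : K / Num.sqrt N%:R <= e / 2.
  have sN : 0 < Num.sqrt N%:R :> R by rewrite sqrtr_gt0 ltr0n.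
  rewrite ler_pdivrMr// mulrC -ler_pdivrMr ?divr_gt0//.
  apply: le_trans (ler_norm _) _; rewrite -sqrtr_sqr ler_wsqrtr//.
  have -> : K / (e / 2) = 2 * K / e by field; rewrite gt_eqF.
  by apply: ltW; apply: lt_le_trans (truncnS_gt _) _; rewrite ler_nat.
have h1 : 0 <= erfc (Num.sqrt (lr_mu lam) / 2) - erfc (Num.sqrt (lr_mu lam + t ^+ 2) / 2) <= t.
  have s1 : Num.sqrt (lr_mu lam) <= Num.sqrt (lr_mu lam + t ^+ 2).
    by rewrite ler_wsqrtr// lerDl ltW.
  have s2 := sqrtr_add_le mu0 (ltW t0).
  have s3 : Num.sqrt (lr_mu lam) / 2 <= Num.sqrt (lr_mu lam + t ^+ 2) / 2 by lra.
  by rewrite subr_ge0 (erfc_nincr s3)/=; apply: le_trans (erfc_lip s3) _; lra.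
have te : t = e / 6 by []; move: h1 te KN.
move: (erfc _) (erfc _) (gexp _ _) (gexp _ _) (K / _) => a b c f k.
move=> /andP[i1 i2] te KN; rewrite !ler_norml => /andP[j1 j2] /andP[k1 k2].
by apply/andP; split; lra.
Qed.

Theorem corollary6 (R : realType) (d : nat -> measure_display)
    (Omega : forall N, measurableType (d N))
    (Pr : forall N, probability (Omega N) R)
    (x : forall N, 'I_N -> {RV (Pr N) >-> R})
    (W : forall N, upper_pair N -> {RV (Pr N) >-> R})
    (model : forall N, (0 < N)%N -> spiked_wigner_model (x N) (W N))
    (lambda : R) (lambda_ge0 : 0 <= lambda) (lambda_lt1 : lambda < 1) :
  let law N := fun l : R => observation_law l (x N) (W N) in
  let err N := minimal_risk (law N 0) (law N lambda) in
  let tv N := tv_distance (law N lambda) (law N 0) in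
  let mu := 4^-1 * (- ln (1 - lambda) - lambda) in
  [/\ cvgn err, cvgn tv, limn err = (1 - limn tv)%E &
      (1 - limn tv)%E = (erfc (Num.sqrt mu / 2))%:E].
Proof.
move=> law err tv mu.
pose L N := lr (R := R) (@end1 N) (@end2 N) (Num.sqrt (lambda / N%:R)).
pose a N := gexp (law N 0) (fun w => Num.min 1 (L N w)).
(* The model is given for positive N only, so each identity below carries this condition. *)
have gamE N : (0 < N)%N -> iid_normal (law N 0) by move=> /model /iid_normal_noise.
have aE N : (0 < N)%N -> (\int[law N 0%R]_w (Num.min 1 (L N w))%:E)%E = (a N)%:E.
  by move=> N0; apply: (integral_tame (gamE N N0)); exact: tame_min_lr.
have lawE N : (0 < N)%N -> forall A, measurable A ->
    law N lambda A = (\int[law N 0%R]_(w in A) (L N w)%:E)%E.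
  by move=> N0 A mA; exact: likelihood_ratio_observation (model N N0) _ _ mA.
have mL N : measurable_fun setT (L N).
  by case: (tame_lr (R := R) (@end1 N) (@end2 N) (Num.sqrt (lambda / N%:R))).
have L0 N w : 0 <= L N w by apply: ltW; exact: lr_gt0.
have errE N : (0 < N)%N -> err N = (a N)%:E.
  move=> N0; rewrite -aE//.
  exact: (minimal_risk_likelihood_ratio (mL N) (L0 N) (lawE N N0)).
have tvE N : (0 < N)%N -> tv N = (1 - a N)%:E.
  move=> N0; rewrite EFinB -aE//.
  exact: (tv_distance_likelihood_ratio (mL N) (L0 N) (lawE N N0)).
have a_cvg : a @ \oo --> erfc (Num.sqrt mu / 2).
  apply/cvgrPdist_le => e e0.
  have [N0 h] := truncated_mean_limit lambda_ge0 lambda_lt1 e0.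
  near=> N; have NN : (N0 < N)%N by near: N; exists N0.+1.
  by apply: h => //; [exact: sum_edges_prod|apply: gamE; exact: leq_ltn_trans NN].
(* The sequences are identified with real ones from N = 1 on; the value at N = 0 does not affect the
   limit. *)
have cvgE (u : nat -> \bar R) (b : nat -> R) l : b @ \oo --> l ->
    (forall N, (0 < N)%N -> u N = (b N)%:E) -> u @ \oo --> l%:E.
  move=> bl ub; have bl' : (EFin \o b) @ \oo --> l%:E.
    by apply: cvg_EFin => //; apply: nearW.
  apply: cvg_trans bl'; apply: near_eq_cvg; near=> N.
  by rewrite /= ub//; near: N; exists 1%N.
have err_cvg := cvgE _ _ _ a_cvg errE.
have tv_cvg : tv @ \oo --> (1 - erfc (Num.sqrt mu / 2))%:E.
  by apply: cvgE tvE; apply: cvgB => //; exact: cvg_cst.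
rewrite (cvg_lim _ err_cvg)// (cvg_lim _ tv_cvg)//.
have -> : (1 - (1 - erfc (Num.sqrt mu / 2))%:E = (erfc (Num.sqrt mu / 2))%:E)%E.
  by rewrite -EFinB; congr (_%:E); lra.
by split.
Unshelve. all: by end_near.
Qed.
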